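(* For every constant $\alpha\ge1$, it is NP-hard (under polynomial-time many-one reductions) to approximate within factor $\alpha$ the optimum value of the Local Size Minimization problem.
   Context: $\mathscr G_N=\{(i,j)\in[N]\times[N]: i\neq j\}$ is the set of CNOT gates on $N$ qubits, where $(i,j)$ means qubit $i$ controls qubit $j$. $\mathcal C(g_1,\dots,g_s)$ denotes the circuit applying gates $g_1,\dots,g_s$ in order. An $n$-qubit $m$-ancilla CNOT circuit is a CNOT circuit on $n+m$ qubits that, for every $\mathbf x\in\mathbb F_2^n$, maps $(\mathbf x,0^m)$ to $(\mathbf y,0^m)$ for some $\mathbf y$. Two such circuits are equivalent ($\cong$) if for every $\mathbf x\in\mathbb F_2^n$ their outputs on $(\mathbf x,0^m)$ agree on the first $n$ qubits. Local Size Minimization (LSM): - Input: positive integers $n,m,s,L,R$ with $1\le L\le R\le s$, and gates $g_1,\dots,g_s\in\mathscr G_{n+m}$ such that $\mathcal C(g_1,\dots,g_s)$ is an $n$-qubit $m$-ancilla CNOT circuit. - Output: the minimum $w\ge0$ such that there exist $h_1,\dots,h_w\in\mathscr G_{n+m}$ with $\mathcal C(g_1,\dots,g_s)\cong\mathcal C(g_1,\dots,g_{L-1},h_1,\dots,h_w,g_{R+1},\dots,g_s)$. *)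

(* Defs.v *)
From Stdlib Require Import Reals.
From mathcomp Require Import all_boot.
Set Implicit Arguments. Unset Strict Implicit. Unset Printing Implicit Defensive.

(* A gate (i, j) : qubit i controls qubit j.  Qubits are 0-indexed:
   the paper's qubit i in [N] is our qubit i-1. *)
Definition gate := (nat * nat)%type.

Definition gate_in (N : nat) (g : gate) : bool :=
  [&& g.1 < N, g.2 < N & g.1 != g.2].

Definition apply_gate (g : gate) (x : seq bool) : seq bool :=
  set_nth false x g.2 (xorb (nth false x g.2) (nth false x g.1)).

Definition run_circuit (gs : seq gate) (x : seq bool) : seq bool :=
  foldl (fun y g => apply_gate g y) x gs.

Definition is_ancilla_circuit (n m : nat) (gs : seq gate) : Prop :=
  all (gate_in (n + m)) gs /\
  forall x : seq bool, size x = n ->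
    drop n (run_circuit gs (x ++ nseq m false)) = nseq m false.

Definition circ_equiv (n m : nat) (gs hs : seq gate) : Prop :=
  is_ancilla_circuit n m gs /\ is_ancilla_circuit n m hs /\
  forall x : seq bool, size x = n ->
    take n (run_circuit gs (x ++ nseq m false)) =
    take n (run_circuit hs (x ++ nseq m false)).

Record lsm_instance := LSM {
  lsm_n : nat; lsm_m : nat; lsm_s : nat; lsm_L : nat; lsm_R : nat;
  lsm_gates : seq gate }.

Definition lsm_valid (I : lsm_instance) : Prop :=
  [/\ 0 < lsm_n I, 0 < lsm_m I,
      [/\ 1 <= lsm_L I, lsm_L I <= lsm_R I & lsm_R I <= lsm_s I],
      size (lsm_gates I) = lsm_s I &
      is_ancilla_circuit (lsm_n I) (lsm_m I) (lsm_gates I)].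

(* C(g_1,...,g_{L-1}, h_1,...,h_w, g_{R+1},...,g_s)  (L, R are 1-indexed) *)
Definition lsm_replace (I : lsm_instance) (hs : seq gate) : seq gate :=
  take (lsm_L I).-1 (lsm_gates I) ++ hs ++ drop (lsm_R I) (lsm_gates I).

Definition lsm_feasible (I : lsm_instance) (w : nat) : Prop :=
  exists hs : seq gate, size hs = w /\ all (gate_in (lsm_n I + lsm_m I)) hs /\
    circ_equiv (lsm_n I) (lsm_m I) (lsm_gates I) (lsm_replace I hs).

Definition lsm_opt (I : lsm_instance) (w : nat) : Prop :=
  lsm_feasible I w /\ forall w', lsm_feasible I w' -> w <= w'.

Fixpoint nat_bits_fuel (fuel n : nat) : seq bool :=
  match fuel with
  | 0 => [::]
  | f.+1 => if n == 0 then [::] else odd n :: nat_bits_fuel f n./2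
  end.

Definition nat_bits (n : nat) : seq bool := nat_bits_fuel n n.

(* self-delimiting code of a bit string: each bit b as [true; b], end [false; false] *)
Definition enc_bits (x : seq bool) : seq bool :=
  flatten [seq [:: true; b] | b <- x] ++ [:: false; false].

Definition enc_nat (n : nat) : seq bool := enc_bits (nat_bits n).

Definition enc_lsm (I : lsm_instance) (k : nat) : seq bool :=
  enc_nat (lsm_n I) ++ enc_nat (lsm_m I) ++ enc_nat (lsm_s I) ++
  enc_nat (lsm_L I) ++ enc_nat (lsm_R I) ++
  flatten [seq enc_nat g.1 ++ enc_nat g.2 | g <- lsm_gates I] ++ enc_nat k.

Definition enc_pair (x w : seq bool) : seq bool := enc_bits x ++ w.

(* 4. Model of computation: deterministic single-tape Turing machines  *)
(*    over the alphabet {0,1,blank} (blank = None).                    *)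

Inductive move := MLeft | MRight | MStay.

(* states are 'I_(tm_q.+1), start state ord0; delta = None means halt *)
Record TM := MkTM {
  tm_q : nat;
  tm_delta : 'I_tm_q.+1 -> option bool ->
             option ('I_tm_q.+1 * option bool * move) }.

(* configuration: state, left part of tape (reversed, nearest first),
   scanned symbol, right part of tape *)
Record config (M : TM) := Cfg {
  cf_state : 'I_(tm_q M).+1;
  cf_left : seq (option bool);
  cf_head : option bool;
  cf_right : seq (option bool) }.

Definition init_config (M : TM) (x : seq bool) : config M :=
  match x with
  | [::] => Cfg (ord0 : 'I_(tm_q M).+1) [::] None [::]
  | b :: x' => Cfg (ord0 : 'I_(tm_q M).+1) [::] (Some b) (map Some x')
  end.

Definition halted (M : TM) (c : config M) : bool :=
  if tm_delta (cf_state c) (cf_head c) is None then true else false.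

Definition tm_step (M : TM) (c : config M) : config M :=
  match tm_delta (cf_state c) (cf_head c) with
  | None => c
  | Some (q', w, MStay) => Cfg q' (cf_left c) w (cf_right c)
  | Some (q', w, MLeft) =>
      Cfg q' (behead (cf_left c)) (head None (cf_left c)) (w :: cf_right c)
  | Some (q', w, MRight) =>
      Cfg q' (w :: cf_left c) (head None (cf_right c)) (behead (cf_right c))
  end.

Fixpoint read_word (s : seq (option bool)) : seq bool :=
  match s with
  | Some b :: s' => b :: read_word s'
  | _ => [::]
  end.

Definition tm_output (M : TM) (c : config M) : seq bool :=
  read_word (cf_head c :: cf_right c).

Definition tm_computes_in (M : TM) (x : seq bool) (t : nat) (y : seq bool) : Prop :=
  let c := iter t (@tm_step M) (init_config M x) in
  halted c /\ tm_output c = y.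

Definition poly_time_computable (f : seq bool -> seq bool) : Prop :=
  exists (M : TM) (c k : nat), forall x : seq bool,
    exists t, t <= c * (size x) ^ k + c /\ tm_computes_in M x t (f x).

Definition language := seq bool -> Prop.

Definition in_NP (L : language) : Prop :=
  exists V : seq bool -> bool,
    poly_time_computable (fun y => [:: V y]) /\
    exists c k : nat, forall x : seq bool,
      L x <-> exists w : seq bool, size w <= c * (size x) ^ k + c /\ V (enc_pair x w).

(* 5. NP-hardness of alpha-approximating LSM (gap version):            *)
(*    every NP language reduces (poly-time many-one) to the promise     *)
(*    problem whose instances are (I, k) with                          *)
(*      YES : OPT(I) <= k,    NO : OPT(I) > alpha * k.                 *)

Definition lsm_gap_reduction (alpha : R) (L : language) (f : seq bool -> seq bool) : Prop :=
  forall x : seq bool, exists (I : lsm_instance) (k : nat),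
    f x = enc_lsm I k /\ lsm_valid I /\
    (L x -> forall w, lsm_opt I w -> w <= k) /\
    (~ L x -> forall w, lsm_opt I w -> Rlt (Rmult alpha (INR k)) (INR w)).

Definition NP_hard_to_approx_LSM (alpha : R) : Prop :=
  forall L : language, in_NP L ->
    exists f, poly_time_computable f /\ lsm_gap_reduction alpha L f.

(* Main.v *)
(* A window of a CNOT circuit whose wires carry known linear forms, and which has to add one
   prescribed form to an empty ancilla, costs exactly a shortest representation of that form:
   this is the nearest codeword problem, so it suffices to make that problem hard to approximate.

   The gap comes without PCPs, following Bhattiprolu, Guruswami and Ren.  An NP computation is
   encoded as a homogeneous quadratic system over F2, one of whose variables is forced to be 1 in
   every nonzero solution.  Replace the products x_i x_j by the entries of a matrix X: the system
   becomes linear in X, and it is solvable iff a nonzero X satisfying it has rank one.  Encode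
   rows and columns of X by a linear code C whose nonzero words all have weight close to half the
   length.  A rank one X has weight about 1/4 of the square of the length, while a symmetric X of
   higher rank has weight at least 3/2 times as much; tensor powers turn this ratio into any
   constant.  The linear constraints are imposed by repeating them as heavy codeword coordinates.

   The code C is a Hadamard code on top of pairwise independent hashing: for a random interval
   condition on (a i + b) mod M, of the right density, the support of a given vector meets the
   selected set in exactly one point with constant probability; XORs of t independent positions
   then bring the weight close to one half.

   Polynomial time is obtained from a small imperative language over unary counters, compiled to
   the single-tape machines; the functions it evaluates are closed under bounded sums, which is
   enough to write down the whole instance. *)
Require Import Defs.
From Stdlib Require Import Reals ZArith FunctionalExtensionality Lia.
From mathcomp Require Import all_boot zify.
Set Implicit Arguments. Unset Strict Implicit. Unset Printing Implicit Defensive.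

(** * Composable machine fragments *)

(** The obstacle is to keep the construction computable by a very plain machine. Every object is a
    formula in bounded sums, division and fixed powers, so the hash works modulo an arbitrary [M]
    instead of a prime. This costs a factor 4 in the second moment. Its random choices disappear
    because all of them are listed as coordinates of the code. The constants fit together as
    follows. Isolation succeeds for 1/32 of the hash functions; half of the Hadamard masks detect
    it, so the relative weight lies between 1/64 and 1/2, and [t] XORs push the bias from 31/32
    below 1/12. With [D] half the length, nonzero weights lie between 11/12 [D] and [D]. A rank one
    solution then weighs at most [D ^ 2], any other at least 3/2 times the square of 11/12, which
    exceeds 5/4, and the power [tau] of 5/4 beats [2 a + 1]. The factor 2 pays for gates reading the
    columns that are combined, a cost that the nearest codeword problem does not have; the code is
    long enough for their number to stay below [(D ^ 2) ^ tau]. *)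

Definition sym := option bool.

(* A fragment leaves through a transition [inr b], reporting one bit of information. *)
Record mach := Mach {
  st : finType; ini : st;
  tr : st -> sym -> ((st + bool) * sym * move)%type }.

(** Cells are indexed by [Z] with an explicit head position, so tapes are compared pointwise and a
    head move leaves the contents alone. The lists of [config] come back only in [reps]. *)
Definition ztape := (Z * (Z -> sym))%type.
Definition dirz (d : move) : Z :=
  match d with MLeft => -1 | MRight => 1 | MStay => 0 end.
Definition zstep (t : ztape) (w : sym) (d : move) : ztape :=
  ((t.1 + dirz d)%Z, fun z => if Z.eqb z t.1 then w else t.2 z).

Inductive run (M : mach) : st M -> ztape -> nat -> bool -> ztape -> Prop :=
| run_exit q t b w d : tr q (t.2 t.1) = (inr b, w, d) ->
    run q t 1 b (zstep t w d)
| run_step q q' t w d n b t' : tr q (t.2 t.1) = (inl q', w, d) ->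
    run q' (zstep t w d) n b t' -> run q t n.+1 b t'.

Definition runs (M : mach) (t : ztape) (n : nat) (b : bool) (t' : ztape) :=
  exists2 n', n' <= n & run (ini M) t n' b t'.

Lemma runsW M t n m b t' : n <= m -> runs M t n b t' -> runs M t m b t'.
Proof. by move=> le [n' h r]; exists n' => //; lia. Qed.

Definition act (g : sym -> sym) (d : sym -> move) (e : sym -> bool) : mach :=
  @Mach unit tt (fun _ s => (inr (e s), g s, d s)).

Definition ite (M A B : mach) : mach :=
  @Mach (st M + (st A + st B))%type (inl (ini M)) (fun q s =>
    match q with
    | inl q => let: (r, w, d) := tr q s in
        (match r with
         | inl q' => inl (inl q')
         | inr true => inl (inr (inl (ini A)))
         | inr false => inl (inr (inr (ini B))) end, w, d)
    | inr (inl q) => let: (r, w, d) := tr q s in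
        (match r with inl q' => inl (inr (inl q')) | inr b => inr b end, w, d)
    | inr (inr q) => let: (r, w, d) := tr q s in
        (match r with inl q' => inl (inr (inr q')) | inr b => inr b end, w, d)
    end).

Definition whl (M : mach) : mach :=
  @Mach (st M) (ini M) (fun q s =>
    let: (r, w, d) := tr q s in
    (match r with
     | inl q' => inl q' | inr true => inl (ini M) | inr false => inr true end, w, d)).

Definition sq (M A : mach) := ite M A A.

Lemma runs_act g d e p (f : Z -> sym) n : 0 < n ->
  runs (act g d e) (p, f) n (e (f p)) (zstep (p, f) (g (f p)) (d (f p))).
Proof. by move=> n0; exists 1 => //; apply: run_exit. Qed.

Lemma zstep_id p (f : Z -> sym) d : zstep (p, f) (f p) d = ((p + dirz d)%Z, f).
Proof.
by congr pair; apply: functional_extensionality => z /=; case: Z.eqb_spec => // ->.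
Qed.

Lemma runs_keep (d : sym -> move) e p (f : Z -> sym) n : 0 < n ->
  runs (act id d e) (p, f) n (e (f p)) ((p + dirz (d (f p)))%Z, f).
Proof. by move=> n0; have := runs_act id d e p f n0; rewrite zstep_id. Qed.

Lemma run_ite M A B q t n b t1 n2 b2 t2 :
  run q t n b t1 -> runs (if b then A else B) t1 n2 b2 t2 ->
  exists2 n', n' <= n + n2 & @run (ite M A B) (inl q) t n' b2 t2.
Proof.
move=> r [m2 le2 r2]; exists (n + m2); first by lia.
elim: r r2 => {q t n b t1} [q t b w d E r2|q q' t w d n b t' E _ IH r2].
- case: b E r2 => E r2.
  + apply: (@run_step (ite M A B) _ (inr (inl (ini A))) _ w d); first by rewrite /= E.
    elim: r2 => {t2 m2 le2 b2 E t} [q1 t b1 w1 d1 E|q1 q1' t w1 d1 n1 b1 t' E _ IH].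
    * by apply: run_exit; rewrite /= E.
    * by apply: run_step IH; rewrite /= E.
  + apply: (@run_step (ite M A B) _ (inr (inr (ini B))) _ w d); first by rewrite /= E.
    elim: r2 => {t2 m2 le2 b2 E t} [q1 t b1 w1 d1 E|q1 q1' t w1 d1 n1 b1 t' E _ IH].
    * by apply: run_exit; rewrite /= E.
    * by apply: run_step IH; rewrite /= E.
- by rewrite addSn; apply: run_step (IH r2); rewrite /= E.
Qed.

Lemma runs_ite M A B t n b t1 n2 b2 t2 :
  runs M t n b t1 -> runs (if b then A else B) t1 n2 b2 t2 ->
  runs (ite M A B) t (n + n2) b2 t2.
Proof.
move=> [m le r] r2; have [n' le' r'] := run_ite r r2.
by exists n' => //; lia.
Qed.

Lemma runs_sq M A t n b t1 n2 b2 t2 m : n + n2 <= m ->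
  runs M t n b t1 -> runs A t1 n2 b2 t2 -> runs (sq M A) t m b2 t2.
Proof. by move=> le r r2; apply: (runsW le); apply: (runs_ite r); case: (b). Qed.

Lemma runs_whl_stop M t n t1 :
  runs M t n false t1 -> runs (whl M) t n true t1.
Proof.
move=> [m le r]; exists m => //.
move: r; rewrite [ini (whl M)]/=; move: (ini M) => q r.
remember false as b eqn:Eb; elim: r Eb => {q t m b t1 le}
  [q t b w d E Eb|q q' t w d k b t' E _ IH Eb].
- by apply: (@run_exit (whl M)); rewrite /= E Eb.
- by apply: (@run_step (whl M)) (IH Eb); rewrite /= E.
Qed.

Lemma runs_whl_next M t n t1 n2 b2 t2 :
  runs M t n true t1 -> runs (whl M) t1 n2 b2 t2 -> runs (whl M) t (n + n2) b2 t2.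
Proof.
move=> [m le r] [m2 le2 r2]; exists (m + m2); first by lia.
rewrite [X in run X t]/=; move: r; move: (ini M) => q r; remember true as b eqn:Eb.
elim: r Eb r2 => {q t m b t1 le} [q t b w d E Eb r2|q q' t w d k b t' E _ IH Eb r2].
- by apply: (@run_step (whl M)) r2; rewrite /= E Eb.
- by rewrite addSn; apply: (@run_step (whl M)) (IH Eb r2); rewrite /= E.
Qed.

Ltac zl := cbn [dirz fst snd size]; lia.

Definition test (P : sym -> bool) := act id (fun _ => MStay) P.
Definition mv1 (d : move) := act id (fun _ => d) (fun _ => true).
Definition put (s : sym) (d : move) := act (fun _ => s) (fun _ => d) (fun _ => true).
Definition ret (b : bool) := act id (fun _ => MStay) (fun _ => b).
Definition mvn (d : move) (m : nat) (b : bool) := iter m (sq (mv1 d)) (ret b).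
Definition puts (l : seq sym) := foldr (fun s M => sq (put s MLeft) M) (ret true) l.
Definition scan (P : sym -> bool) (d : move) :=
  whl (act id (fun s => if P s then d else MStay) P).

Lemma runs_test P p f n : 0 < n -> runs (test P) (p, f) n (P (f p)) (p, f).
Proof. by move=> n0; have := runs_keep (fun _ => MStay) P p f n0; rewrite Z.add_0_r. Qed.

Lemma runs_mvn d m b p f :
  runs (mvn d m b) (p, f) m.+1 b ((p + Z.of_nat m * dirz d)%Z, f).
Proof.
elim: m p => [|m IH] p.
  have := @runs_keep (fun _ => MStay) (fun _ => b) p f 1 isT.
  by congr (runs _ _ _ _ (_, _)); try zl.
apply: (@runs_sq _ _ _ 1 true ((p + dirz d)%Z, f) m.+1); first by lia.
  exact: (@runs_keep (fun _ => d) (fun _ => true) p f 1 isT).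
have := IH (p + dirz d)%Z; congr (runs _ _ _ _ (_, _)); try zl.
Qed.

Lemma runs_puts l p f :
  runs (puts l) (p, f) (size l).+1 true ((p - Z.of_nat (size l))%Z,
    fun z => if ((p - Z.of_nat (size l) <? z) && (z <=? p))%Z
             then nth None l (Z.to_nat (p - z)) else f z).
Proof.
elim: l p f => [|s l IH] p f.
  have := @runs_keep (fun _ => MStay) (fun _ => true) p f 1 isT.
  congr (runs _ _ _ _ (_, _)); try zl.
  by apply: functional_extensionality => z; case: ifP => //=; lia.
apply: (@runs_sq _ _ _ 1 true _ (size l).+1); first by zl.
  exact: runs_act.
have := IH (p - 1)%Z (fun z => if Z.eqb z p then s else f z).
congr (runs _ _ _ _ (_, _)); try zl.
apply: functional_extensionality => z.
case: (Z.eqb_spec z p) => [->|h0].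
- have -> : ((p - 1 - Z.of_nat (size l) <? p) && (p <=? p - 1))%Z = false by lia.
  have -> : ((p - Z.of_nat (size (s :: l)) <? p) && (p <=? p))%Z = true.
    by cbn [size]; lia.
  by rewrite Z.sub_diag.
- have -> : ((p - Z.of_nat (size (s :: l)) <? z) && (z <=? p))%Z =
    ((p - 1 - Z.of_nat (size l) <? z) && (z <=? p - 1))%Z by cbn [size]; lia.
  case: ifP => // h1.
  by have -> : Z.to_nat (p - z) = (Z.to_nat (p - 1 - z)).+1 by lia.
Qed.

Lemma runs_scan (P : sym -> bool) d p (f : Z -> sym) m :
  (forall j, j < m -> P (f (p + Z.of_nat j * dirz d)%Z)) ->
  ~~ P (f (p + Z.of_nat m * dirz d)%Z) ->
  runs (scan P d) (p, f) m.+1 true ((p + Z.of_nat m * dirz d)%Z, f).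
Proof.
elim: m p => [|m IH] p hP hN.
  apply: runs_whl_stop; rewrite Z.mul_0_l Z.add_0_r in hN *.
  have := @runs_keep (fun s => if P s then d else MStay) P p f 1 isT.
  by rewrite (negPf hN) Z.add_0_r.
have h0 : P (f p) by have := hP 0 isT; rewrite Z.mul_0_l Z.add_0_r.
rewrite -[m.+2]/(1 + m.+1); apply: (@runs_whl_next _ _ _ ((p + dirz d)%Z, f)).
  have := @runs_keep (fun s => if P s then d else MStay) P p f 1 isT.
  by rewrite h0.
have E j : (p + dirz d + Z.of_nat j * dirz d = p + Z.of_nat j.+1 * dirz d)%Z by lia.
rewrite -E; apply: IH => [j lt|]; last by rewrite E.
by rewrite E; apply: hP.
Qed.

(** * A counter language and its compilation *)

Inductive cmd :=
| Inc (r : nat) | Dec (r : nat) | Out (b : bool) | Skip | Seq (a b : cmd)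
| IfZ (r : nat) (a b : cmd) | While (r : nat) (a : cmd) | InBit (r : nat) (a b : cmd).

Definition upd (f : nat -> nat) r v := fun i => if i == r then v else f i.
Definition cstate := ((nat -> nat) * seq bool)%type.

Inductive ex (inp : seq bool) : cmd -> cstate -> cstate -> nat -> Prop :=
| ex_inc r s : ex inp (Inc r) s (upd s.1 r (s.1 r).+1, s.2) 1
| ex_dec r s : 0 < s.1 r -> ex inp (Dec r) s (upd s.1 r (s.1 r).-1, s.2) 1
| ex_out b s : ex inp (Out b) s (s.1, rcons s.2 b) 1
| ex_skip s : ex inp Skip s s 1
| ex_seq a b s s1 s2 n m : ex inp a s s1 n -> ex inp b s1 s2 m ->
    ex inp (Seq a b) s s2 (n + m)
| ex_ifz r a b s s' n : ex inp (if s.1 r == 0 then a else b) s s' n ->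
    ex inp (IfZ r a b) s s' n.+1
| ex_while0 r a s : s.1 r = 0 -> ex inp (While r a) s s 1
| ex_whileS r a s s1 s2 n m : 0 < s.1 r -> ex inp a s s1 n ->
    ex inp (While r a) s1 s2 m -> ex inp (While r a) s s2 (n + m).+1
| ex_inbit r a b s s' n : ex inp (if nth false inp (s.1 r) then a else b) s s' n ->
    ex inp (InBit r a b) s s' n.+1.

Fixpoint below (K : nat) (c : cmd) : bool :=
  match c with
  | Inc r | Dec r => r < K | Out _ | Skip => true
  | Seq a b => below K a && below K b
  | IfZ r a b | InBit r a b => [&& r < K, below K a & below K b]
  | While r a => (r < K) && below K a
  end.

Fixpoint regbound (c : cmd) : nat :=
  match c with
  | Inc r | Dec r => r.+1 | Out _ | Skip => 0
  | Seq a b => regbound a + regbound b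
  | IfZ r a b | InBit r a b => r.+1 + regbound a + regbound b
  | While r a => r.+1 + regbound a
  end.

Lemma below_regbound c K : regbound c <= K -> below K c.
Proof.
elim: c K => //= [a IHa b IHb|r a IHa b IHb|r a IHa|r a IHa b IHb] K le.
- by rewrite IHa ?IHb; lia.
- by rewrite IHa ?IHb; lia.
- by rewrite IHa; lia.
- by rewrite IHa ?IHb; lia.
Qed.

(* Layout of the tape: cell 0 stays blank and serves as home; the output is written to its
   right; to its left lie [al] blocks of [K.+1] non-blank cells, the cell [r] of block [i]
   telling whether [i < rs r], and the cell [K] of block [i] holding the input bit [i]. *)
Definition lay (K : nat) (inp : seq bool) (al : nat) (rs : nat -> nat) (out : seq bool) :
    Z -> sym := fun z =>
  match z with
  | Z0 => None
  | Zpos _ => nth None (map Some out) (Z.to_nat (z - 1))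
  | Zneg _ => let m := Z.to_nat (- z - 1) in
      let i := m %/ K.+1 in let j := m %% K.+1 in
      if i < al then Some (if j < K then i < rs j else nth false inp i) else None
  end.

Definition cell (K i j : nat) : Z := (- Z.of_nat (i * K.+1 + j).+1)%Z.

Definition isS (s : sym) : bool := if s is None then false else true.
Definition isY (s : sym) : bool := if s is Some b then b else false.
Definition goR := scan isS MRight.
Definition goL := scan isS MLeft.
Definition push pat := sq (mv1 MLeft) (sq goL (sq (puts pat) (sq (mv1 MRight) goR))).

Section Lay.
Variable K : nat.
Implicit Types (inp : seq bool) (al : nat) (rs : nat -> nat) (out : seq bool).

Definition bit inp rs i j := if j < K then i < rs j else nth false inp i.

Lemma lay_cell inp al rs out i j : j <= K -> lay K inp al rs out (cell K i j) =
  if i < al then Some (bit inp rs i j) else None.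
Proof.
move=> le; rewrite /lay /cell /=.
have -> : Z.to_nat (Z.pos (Pos.of_succ_nat (i * K.+1 + j)) - 1) = i * K.+1 + j by lia.
by rewrite divnMDl // modnMDl divn_small ?modn_small ?addn0.
Qed.

Lemma cellP z : (z < 0)%Z -> exists i j, j <= K /\ z = cell K i j.
Proof.
move=> lt; exists (Z.to_nat (- z - 1) %/ K.+1), (Z.to_nat (- z - 1) %% K.+1); split.
  by rewrite -ltnS ltn_mod.
by rewrite /cell -divn_eq; lia.
Qed.

Lemma cell_inj i j i' j' : j <= K -> j' <= K ->
  Z.eqb (cell K i j) (cell K i' j') = (i == i') && (j == j').
Proof.
move=> le le'; apply/idP/idP => [E|/andP[/eqP-> /eqP->]]; last exact: Z.eqb_refl.
have {}E : i * K.+1 + j = i' * K.+1 + j' by rewrite /cell in E; lia.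
have -> : i = i'.
  by have := congr1 (divn^~ K.+1) E; rewrite !divnMDl // !divn_small ?addn0.
by rewrite eqxx /=; have := congr1 (modn^~ K.+1) E; rewrite !modnMDl !modn_small // => ->.
Qed.

Lemma layP inp al rs out f :
  (forall z, (0 <= z)%Z -> f z = lay K inp al rs out z) ->
  (forall i j, j <= K -> f (cell K i j) = if i < al then Some (bit inp rs i j) else None) ->
  f = lay K inp al rs out.
Proof.
move=> h1 h2; apply: functional_extensionality => z.
have [/cellP[i [j [le ->]]]|/h1//] := Z_lt_le_dec z 0.
by rewrite h2 // lay_cell.
Qed.

Lemma lay_out inp al rs out inp' al' rs' z : (0 <= z)%Z ->
  lay K inp al rs out z = lay K inp' al' rs' out z.
Proof. by case: z => //; lia. Qed.

Lemma isS_lay inp al rs out z : (z < 0)%Z ->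
  isS (lay K inp al rs out z) = (- Z.of_nat (al * K.+1) <=? z)%Z.
Proof.
move=> /cellP[i [j [le ->]]]; rewrite lay_cell //.
case: ltnP => h; rewrite /cell /=; have := leq_mul h (leqnn K.+1); rewrite ?mulSn => h1.
  by apply/esym; lia.
by apply/esym/negbTE; lia.
Qed.

Lemma goR_home inp al rs out p n : (- Z.of_nat (al * K.+1) <= p <= 0)%Z ->
  Z.to_nat (- p) < n ->
  runs goR (p, lay K inp al rs out) n true (0%Z, lay K inp al rs out).
Proof.
move=> h hn; apply: (runsW hn).
have -> : 0%Z = (p + Z.of_nat (Z.to_nat (- p)) * dirz MRight)%Z by zl.
apply: runs_scan => [j lt|].
  by rewrite isS_lay; zl.
have -> : (p + Z.of_nat (Z.to_nat (- p)) * dirz MRight)%Z = 0%Z by zl.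
by [].
Qed.

Lemma runs_push pat inp inp' al rs rs' out : size pat = K.+1 ->
  (forall i j, i < al -> j <= K -> bit inp' rs' i j = bit inp rs i j) ->
  (forall j, j <= K -> nth None pat j = Some (bit inp' rs' al j)) ->
  runs (push pat) (0%Z, lay K inp al rs out) (6 * K.+1 * al.+2) true
    (0%Z, lay K inp' al.+1 rs' out).
Proof.
move=> sz hold hnew.
have e1 := @runs_keep (fun _ => MLeft) (fun _ => true) 0 (lay K inp al rs out) 1 isT.
apply: (runs_sq _ e1 (n2 := 6 * K.+1 * al.+2 - 1)); first by lia.
have e2 : runs goL ((0 + dirz MLeft)%Z, lay K inp al rs out) (al * K.+1).+1 true
    ((-1 + Z.of_nat (al * K.+1) * dirz MLeft)%Z, lay K inp al rs out).
  apply: runs_scan => [j lt|].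
    by rewrite isS_lay; zl.
  by rewrite isS_lay; zl.
apply: (runs_sq _ e2 (n2 := 4 * K.+1 * al.+2 )); first by nia.
apply: (runs_sq _ (runs_puts pat _ _) (n2 := 3 * K.+1 * al.+2)); first by rewrite sz; nia.
have -> : (fun z => if ((-1 + Z.of_nat (al * K.+1) * dirz MLeft - Z.of_nat (size pat) <? z) &&
    (z <=? -1 + Z.of_nat (al * K.+1) * dirz MLeft))%Z
    then nth None pat (Z.to_nat (-1 + Z.of_nat (al * K.+1) * dirz MLeft - z))
    else lay K inp al rs out z) = lay K inp' al.+1 rs' out.
  apply: layP => [z h|i j le].
    rewrite sz; case: ifP => [|_]; first by zl.
    exact: lay_out.
  rewrite sz lay_cell //.
  case: (ltngtP i al) => h.
  - have := leq_mul h (leqnn K.+1); rewrite mulSn => h1.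
    rewrite (ltn_trans h (ltnSn _)) hold //.
    by rewrite ifF //; rewrite /cell; zl.
  - have := leq_mul h (leqnn K.+1); rewrite mulSn => h1.
    have h2 : al.+1 <= i by [].
    by rewrite ltnS leqNgt h ifF //; rewrite /cell; zl.
  - rewrite h ltnSn ifT; last by rewrite /cell; cbn [dirz]; nia.
    have -> : Z.to_nat (-1 + Z.of_nat (al * K.+1) * dirz MLeft - cell K al j) = j.
      by rewrite /cell; cbn [dirz]; nia.
    exact: hnew.
have e3 := @runs_keep (fun _ => MRight) (fun _ => true)
  (-1 + Z.of_nat (al * K.+1) * dirz MLeft - Z.of_nat (size pat)) (lay K inp' al.+1 rs' out) 1 isT.
apply: (runs_sq _ e3 (n2 := 2 * K.+1 * al.+2)); first by nia.
by apply: goR_home; rewrite sz; cbn [dirz]; nia.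
Qed.

(** Counters are unary marks, so a value [v] needs [v] allocated blocks. The number of blocks is
    only an upper bound: [minc] and [minb] add a fresh block each time instead of testing for room,
    at most one per instruction. *)
Definition alloc_ok inp al rs := (forall r, r < K -> rs r <= al) /\ size inp <= al.

Definition grow := push (nseq K.+1 (Some false)).

Lemma runs_grow inp al rs out : alloc_ok inp al rs ->
  runs grow (0%Z, lay K inp al rs out) (6 * K.+1 * al.+2) true (0%Z, lay K inp al.+1 rs out).
Proof.
move=> [h1 h2]; apply: runs_push => [|//|j le]; first by rewrite size_nseq.
rewrite nth_nseq ltnS le /bit; case: ltnP => h.
  by rewrite ltnNge h1.
by rewrite nth_default.
Qed.

(** The marks of register [r] occupy the same place in successive blocks, so jumps of one block
    length stop at its first unmarked cell, possibly the blank beyond the last block. *)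
Definition walk r := sq (mvn MLeft r.+1 true)
  (whl (ite (test isY) (mvn MLeft K.+1 true) (ret false))).

Lemma runs_walk r inp al rs out : alloc_ok inp al rs -> r < K ->
  runs (walk r) (0%Z, lay K inp al rs out) (6 * K.+1 * al.+2) true
    (cell K (rs r) r, lay K inp al rs out).
Proof.
move=> [h1 _] rK.
have bd : rs r * K.+1 <= al * K.+1 by rewrite leq_mul // h1.
apply: (runs_sq _ (runs_mvn _ _ _ _ _) (n2 := (K.+4) * (rs r).+1)); first by lia.
have -> : (0 + Z.of_nat r.+1 * dirz MLeft)%Z = cell K 0 r by rewrite /cell; zl.
suff key v i : i + v = rs r -> runs (whl (ite (test isY) (mvn MLeft K.+1 true) (ret false)))
    (cell K i r, lay K inp al rs out) (K.+4 * v.+1) true (cell K (rs r) r, lay K inp al rs out).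
  exact: key.
elim: v i => [|v IH] i E.
  apply: runs_whl_stop; rewrite muln1.
  have := @runs_test isY (cell K i r) (lay K inp al rs out) 1 isT.
  rewrite lay_cell; last by rewrite ltnW.
  have -> : isY (if i < al then Some (bit inp rs i r) else None) = false.
    by rewrite /bit rK -E addn0 ltnn; case: ifP.
  move=> /runs_ite e1; move: E; rewrite addn0 => <-; apply: (@runsW _ _ 2); first by lia.
  apply: (e1 _ _ 1).
  have := @runs_keep (fun _ => MStay) (fun _ => false) (cell K i r) (lay K inp al rs out) 1 isT.
  by rewrite Z.add_0_r.
rewrite mulnS; apply: runs_whl_next (IH i.+1 _); last by lia.
have := @runs_test isY (cell K i r) (lay K inp al rs out) 1 isT.
rewrite lay_cell; last by rewrite ltnW.
have := h1 r rK => h2.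
have -> : isY (if i < al then Some (bit inp rs i r) else None) = true.
  by rewrite /bit rK ifT /=; lia.
move=> /runs_ite e1; apply: (@runsW _ _ (1 + K.+2)); first by lia.
apply: e1; have := runs_mvn MLeft K.+1 true (cell K i r) (lay K inp al rs out).
by congr (runs _ _ _ _ (_, _)); rewrite /cell; zl.
Qed.

Lemma runs_put_home v d0 inp inp' al rs rs' out i j : d0 = MRight ->
  i < al -> j <= K ->
  (forall i' j', i' < al -> j' <= K -> bit inp' rs' i' j' =
     if (i' == i) && (j' == j) then v else bit inp rs i' j') ->
  runs (sq (put (Some v) d0) goR) (cell K i j, lay K inp al rs out) (6 * K.+1 * al.+2) true
    (0%Z, lay K inp' al rs' out).
Proof.
move=> -> lt le h.
have e1 := runs_act (fun _ => Some v) (fun _ => MRight) (fun _ => true)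
  (cell K i j) (lay K inp al rs out) (isT : 0 < 1).
have lm := leq_mul lt (leqnn K.+1); rewrite mulSn in lm.
apply: (runs_sq _ e1 (n2 := 2 * K.+1 * al.+2)); first by lia.
rewrite /zstep; cbn [fst snd].
have -> : (fun z => if (z =? cell K i j)%Z then Some v else lay K inp al rs out z) =
    lay K inp' al rs' out.
  apply: layP => [z hz|i' j' le'].
    by rewrite ifF ?(@lay_out inp al rs out inp' al rs') //; rewrite /cell; lia.
  rewrite cell_inj // lay_cell //; case: ifP => [/andP[/eqP-> /eqP->]|h'].
    by rewrite lt h // !eqxx.
  by case: ifP => // lt'; rewrite h // h'.
by apply: goR_home; rewrite /cell; zl.
Qed.

Definition minc r := sq grow (sq (walk r) (sq (put (Some true) MRight) goR)).
Definition mdec r := sq (walk r) (sq (mvn MRight K.+1 true) (sq (put (Some false) MRight) goR)).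
Definition mout b := sq (mv1 MRight) (sq goR (sq (put (Some b) MLeft) goL)).
Definition mtst r := sq (mvn MLeft r.+1 true)
  (ite (test isY) (mvn MRight r.+1 true) (mvn MRight r.+1 false)).
Definition minb r := sq grow (sq (walk r) (sq (mvn MLeft (K - r) true)
  (ite (test isY) (sq goR (ret true)) (sq goR (ret false))))).

Lemma alloc_okS inp al rs : alloc_ok inp al rs -> alloc_ok inp al.+1 rs.
Proof. by move=> [h1 h2]; split=> [r /h1|]; lia. Qed.

Lemma runs_inc r inp al rs out : alloc_ok inp al rs -> r < K ->
  runs (minc r) (0%Z, lay K inp al rs out) (24 * K.+1 * al.+3) true
    (0%Z, lay K inp al.+1 (upd rs r (rs r).+1) out).
Proof.
move=> hi rK; have := hi.1 r rK => h.
apply: (runs_sq _ (runs_grow _ hi) (n2 := 13 * K.+1 * al.+3)); first by lia.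
apply: (runs_sq _ (runs_walk _ (alloc_okS hi) rK) (n2 := 6 * K.+1 * al.+3)); first by lia.
apply: runs_put_home => //; first by lia.
move=> i' j' lt le; rewrite /bit /upd; case: (ltnP j' K) => h'.
  by case: (j' =P r) => [->|]; rewrite ?andbF // andbT; case: eqP; lia.
by rewrite andbC ifF //; lia.
Qed.

Lemma runs_dec r inp al rs out : alloc_ok inp al rs -> r < K -> 0 < rs r ->
  runs (mdec r) (0%Z, lay K inp al rs out) (24 * K.+1 * al.+3) true
    (0%Z, lay K inp al (upd rs r (rs r).-1) out).
Proof.
move=> hi rK h0; have := hi.1 r rK => h.
apply: (runs_sq _ (runs_walk _ hi rK) (n2 := 13 * K.+1 * al.+2)); first by lia.
apply: (runs_sq _ (runs_mvn _ _ _ _ _) (n2 := 6 * K.+1 * al.+2)); first by lia.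
have -> : (cell K (rs r) r + Z.of_nat K.+1 * dirz MRight)%Z = cell K (rs r).-1 r.
  by move: h0; case: (rs r) => // v _; rewrite /cell mulSn; zl.
apply: runs_put_home => //; [by lia|by lia|].
move=> i' j' lt le; rewrite /bit /upd; case: (ltnP j' K) => h'.
  by case: (j' =P r) => [->|]; rewrite ?andbF // andbT; case: eqP; lia.
by rewrite andbC ifF //; lia.
Qed.

Lemma runs_tst r inp al rs out : alloc_ok inp al rs -> r < K ->
  runs (mtst r) (0%Z, lay K inp al rs out) (6 * K.+1 * al.+2) (0 < rs r)
    (0%Z, lay K inp al rs out).
Proof.
move=> hi rK; have := hi.1 r rK => h.
apply: (runs_sq _ (runs_mvn _ _ _ _ _) (n2 := r.+4)); first by lia.
have -> : (0 + Z.of_nat r.+1 * dirz MLeft)%Z = cell K 0 r by rewrite /cell; zl.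
have := @runs_test isY (cell K 0 r) (lay K inp al rs out) 1 isT.
rewrite lay_cell; last by rewrite ltnW.
have -> : isY (if 0 < al then Some (bit inp rs 0 r) else None) = (0 < rs r).
  by rewrite /bit rK; case: ifP => //= h'; lia.
move=> e1; apply: (@runsW _ _ (1 + r.+2)); first by lia.
apply: (runs_ite e1); have := runs_mvn MRight r.+1 (0 < rs r) (cell K 0 r) (lay K inp al rs out).
have -> : (cell K 0 r + Z.of_nat r.+1 * dirz MRight)%Z = 0%Z by rewrite /cell; zl.
by case: (0 < rs r).
Qed.

Lemma runs_inb r inp al rs out : alloc_ok inp al rs -> r < K ->
  runs (minb r) (0%Z, lay K inp al rs out) (24 * K.+1 * al.+3) (nth false inp (rs r))
    (0%Z, lay K inp al.+1 rs out).
Proof.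
move=> hi rK; have := hi.1 r rK => h.
have lm : (rs r).+1 * K.+1 <= al.+1 * K.+1 by rewrite leq_mul.
rewrite mulSn in lm.
apply: (runs_sq _ (runs_grow _ hi) (n2 := 13 * K.+1 * al.+3)); first by lia.
apply: (runs_sq _ (runs_walk _ (alloc_okS hi) rK) (n2 := 6 * K.+1 * al.+3)); first by lia.
apply: (runs_sq _ (runs_mvn _ _ _ _ _) (n2 := 4 * K.+1 * al.+3)); first by lia.
have -> : (cell K (rs r) r + Z.of_nat (K - r) * dirz MLeft)%Z = cell K (rs r) K.
  by rewrite /cell; zl.
have := @runs_test isY (cell K (rs r) K) (lay K inp al.+1 rs out) 1 isT.
rewrite lay_cell // ltnS h /bit ltnn /= => e1.
apply: (@runsW _ _ (1 + (3 * K.+1 * al.+3))); first by lia.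
apply: (runs_ite e1).
have e2 : runs goR (cell K (rs r) K, lay K inp al.+1 rs out) (2 * K.+1 * al.+3) true
   (0%Z, lay K inp al.+1 rs out).
  by apply: goR_home; rewrite /cell; zl.
have e3 b := @runs_keep (fun _ => MStay) (fun _ => b) 0 (lay K inp al.+1 rs out) 1 isT.
by case: (nth _ _ _); apply: (runs_sq _ e2 (e3 _)); lia.
Qed.

Lemma runs_out b inp al rs out :
  runs (mout b) (0%Z, lay K inp al rs out) (4 * (size out).+2) true
    (0%Z, lay K inp al rs (rcons out b)).
Proof.
have e1 := @runs_keep (fun _ => MRight) (fun _ => true) 0 (lay K inp al rs out) 1 isT.
apply: (runs_sq _ e1 (n2 := 3 * (size out).+2)); first by lia.
have sm o j : lay K inp al rs o (1 + Z.of_nat j) = nth None (map Some o) j.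
  have -> : (1 + Z.of_nat j = Z.pos (Pos.of_succ_nat j))%Z by lia.
  by rewrite /lay; congr nth; lia.
have e2 : runs goR ((0 + dirz MRight)%Z, lay K inp al rs out) (size out).+1 true
    ((1 + Z.of_nat (size out) * dirz MRight)%Z, lay K inp al rs out).
  apply: runs_scan => [j lt|]; cbn [dirz]; rewrite Z.mul_1_r ?Z.add_0_l sm.
    by rewrite (nth_map false).
  by rewrite nth_default ?size_map.
apply: (runs_sq _ e2 (n2 := 2 * (size out).+2)); first by lia.
apply: (runs_sq _ (runs_act _ _ _ _ _ (isT : 0 < 1)) (n2 := (size out).+1)); first by lia.
rewrite /zstep; cbn [fst snd].
have -> : (fun z => if (z =? 1 + Z.of_nat (size out) * dirz MRight)%Z then Some b
    else lay K inp al rs out z) = lay K inp al rs (rcons out b).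
  apply: functional_extensionality => z; cbn [dirz]; rewrite Z.mul_1_r.
  have [hz|hz] := Z_lt_le_dec z 0; first by rewrite ifF; [case: z hz|lia].
  have [->|hz0] := Z.eq_dec z 0; first by rewrite ifF; [|lia].
  have -> : z = (1 + Z.of_nat (Z.to_nat (z - 1)))%Z by lia.
  rewrite !sm map_rcons nth_rcons size_map; move: (Z.to_nat _) => j.
  case: (ltngtP j (size out)) => h; [by rewrite ifF //; lia| |by rewrite ifT //; lia].
  by rewrite ifF ?nth_default ?size_map //; lia.
have -> : 0%Z = (1 + Z.of_nat (size out) * dirz MRight + dirz MLeft +
  Z.of_nat (size out) * dirz MLeft)%Z by zl.
apply: runs_scan => [j lt|].
  have -> : (1 + Z.of_nat (size out) * dirz MRight + dirz MLeft + Z.of_nat j * dirz MLeft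
     = 1 + Z.of_nat (size out - j.+1))%Z by zl.
  by rewrite sm (nth_map false) // size_rcons; lia.
by have -> : (1 + Z.of_nat (size out) * dirz MRight + dirz MLeft +
  Z.of_nat (size out) * dirz MLeft = 0)%Z by zl.
Qed.
End Lay.

Fixpoint compile (K : nat) (c : cmd) : mach :=
  match c with
  | Inc r => minc K r | Dec r => mdec K r | Out b => mout b | Skip => ret true
  | Seq a b => sq (compile K a) (compile K b)
  | IfZ r a b => ite (mtst r) (compile K b) (compile K a)
  | While r a => whl (ite (mtst r) (sq (compile K a) (ret true)) (ret false))
  | InBit r a b => ite (minb K r) (compile K a) (compile K b)
  end.

Lemma alloc_okU K inp al rs r v : alloc_ok K inp al rs -> v <= al -> alloc_ok K inp al (upd rs r v).
Proof. by move=> [h1 h2] le; split=> // i hi; rewrite /upd; case: eqP => // _; apply: h1. Qed.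

Lemma runs_ret b p f : runs (ret b) (p, f) 1 b (p, f).
Proof.
by have := @runs_keep (fun _ => MStay) (fun _ => b) p f 1 isT; rewrite Z.add_0_r.
Qed.

(** Blocks plus output symbols grow by at most one per instruction, so the tape in use stays below
    [al + size s.2 + n], up to the block length, and each instruction sweeps it boundedly often: the
    slowdown is quadratic. *)
Definition simulates K inp (M : mach) (C : nat) (s s' : cstate) n :=
  forall al, alloc_ok K inp al s.1 -> exists al' b, [/\ al' + size s'.2 <= al + size s.2 + n, alloc_ok K inp al' s'.1 &
    runs M (0%Z, lay K inp al s.1 s.2) (C * (n * (al + size s.2 + n).+1)) b
      (0%Z, lay K inp al' s'.1 s'.2)].

Lemma simulatesW K inp M C C' s s' n : C <= C' ->
  simulates K inp M C s s' n -> simulates K inp M C' s s' n.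
Proof.
move=> le h al /h [al' [b [h1 h2 h3]]]; exists al', b; split => //.
by apply: runsW h3; rewrite leq_mul.
Qed.

Lemma time_add C n m A B : B <= A + n -> 
  C * (n * (A + n).+1) + C * (m * (B + m).+1) + C * A.+1 <= C * ((n + m).+1 * (A + (n + m).+1).+1).
Proof.
move=> le; rewrite -!mulnDr leq_mul //.
have h1 : m * (B + m).+1 <= m * (A + (n + m).+1).+1 by rewrite leq_mul //; lia.
have h2 : n * (A + n).+1 <= n * (A + (n + m).+1).+1 by rewrite leq_mul //; lia.
by rewrite mulSn mulnDl; lia.
Qed.

Lemma time_addn C n m A B : B <= A + n -> 
  C * (n * (A + n).+1) + C * (m * (B + m).+1) <= C * ((n + m) * (A + (n + m)).+1).
Proof.
move=> le; rewrite -mulnDr leq_mul // mulnDl leq_add // leq_mul //; lia.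
Qed.

Lemma time_step C k n A B : k <= C * A.+1 -> B <= A.+1 ->
  k + C * (n * (B + n).+1) <= C * (n.+1 * (A + n.+1).+1).
Proof.
move=> le1 le2; rewrite mulSn mulnDr leq_add //.
  by apply: leq_trans le1 _; rewrite leq_mul //; lia.
by rewrite !leq_mul //; lia.
Qed.

Lemma ex_seqE inp a b s s' n : ex inp (Seq a b) s s' n ->
  exists s1 n1 n2, [/\ n = n1 + n2, ex inp a s s1 n1 & ex inp b s1 s' n2].
Proof. by move=> e; inversion e; subst; do 3!eexists; split; eauto. Qed.

Lemma ex_ifzE inp r a b s s' n : ex inp (IfZ r a b) s s' n ->
  exists2 m, n = m.+1 & ex inp (if s.1 r == 0 then a else b) s s' m.
Proof. by move=> e; inversion e; subst; eexists; eauto. Qed.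

Lemma ex_inbitE inp r a b s s' n : ex inp (InBit r a b) s s' n ->
  exists2 m, n = m.+1 & ex inp (if nth false inp (s.1 r) then a else b) s s' m.
Proof. by move=> e; inversion e; subst; eexists; eauto. Qed.

Lemma compile_ok K c : below K c ->
  exists C, forall inp s s' n, ex inp c s s' n -> simulates K inp (compile K c) C s s' n.
Proof.
set w := K.+1.
elim: c => [r|r|b| |a IHa b IHb|r a IHa b IHb|r a IHa|r a IHa b IHb] /= hb.
- exists (100 * w) => inp s s' n e; inversion e; subst => al hi.
  exists al.+1, true; split; [by rewrite /=; lia| |].
    by apply: alloc_okU; [exact: alloc_okS|rewrite ltnS; apply: hi.1].
  by apply: runsW (runs_inc s.2 hi hb); rewrite -/w mul1n; nia.
- exists (100 * w) => inp s s' n e; inversion e; subst => al hi.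
  exists al, true; split; [by rewrite /=; lia| |].
    by apply: alloc_okU => //; have := hi.1 r hb; lia.
  by apply: runsW (runs_dec s.2 hi hb _) => //; rewrite -/w mul1n; nia.
- exists (100 * w) => inp s s' n e; inversion e; subst => al hi.
  exists al, true; split; [by rewrite size_rcons; lia|by []|].
  by apply: runsW (runs_out K b inp al s.1 s.2) => //; rewrite mul1n /w; nia.
- exists 1 => inp s s' n e; inversion e; subst => al hi.
  exists al, true; split => //; try lia.
  by apply: runsW (runs_ret _ _ _) => //; rewrite mul1n.
- have [/IHa [Ca IA] /IHb [Cb IB]] := andP hb.
  exists (Ca + Cb) => inp s s' _ /ex_seqE [s1 [n1 [n2 [-> H1 H4]]]] al hi.
  have [al1 [b1 [l1 i1 r1]]] := simulatesW (leq_addr Cb Ca) (IA _ _ _ _ H1) hi.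
  have [al2 [b2 [l2 i2 r2]]] := simulatesW (leq_addl Ca Cb) (IB _ _ _ _ H4) i1.
  exists al2, b2; split => //; try lia.
  by apply: runs_sq r1 r2; apply: time_addn; lia.
- have [hr /andP[/IHa [Ca IA] /IHb [Cb IB]]] := andP hb.
  exists (100 * w + Ca + Cb) => inp s s' _ /ex_ifzE [n0 -> H4] al hi.
  have S : simulates K inp (compile K (if s.1 r == 0 then a else b))
      (100 * w + Ca + Cb) s s' n0.
    by move: H4; case: ifP => _ H4; [apply: simulatesW (IA _ _ _ _ H4)|
       apply: simulatesW (IB _ _ _ _ H4)]; lia.
  have [al2 [b2 [l2 i2 r2]]] := S _ hi.
  exists al2, b2; split => //; try lia.
  have e1 := runs_tst s.2 hi hr.
  have e2 : runs (if 0 < s.1 r then compile K b else compile K a) (0%Z, lay K inp al s.1 s.2)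
    ((100 * w + Ca + Cb) * (n0 * (al + size s.2 + n0).+1)) b2 (0%Z, lay K inp al2 s'.1 s'.2).
    by move: r2; case: (s.1 r).
  apply: runsW (runs_ite e1 e2).
  by apply: time_step; [rewrite -/w; nia|lia].
- have [hr /IHa [Ca IA]] := andP hb.
  exists (100 * w + Ca) => inp s s' n e.
  (* The iterations repeat the same command, so the induction is on the execution and carries the
     equation for the command along. *)
  remember (While r a) as c eqn:Ec.
  induction e as [| | | | | |r' a' s h0|r' a' s s1 s2 n m h0 e1 _ e2 IH|] => //;
    case: Ec => ? ? al hi; subst r' a'.
  + exists al, true; split => //; try lia.
    have := runs_tst s.2 hi hr; rewrite h0 => r1.
    apply: (runsW _ (runs_whl_stop (runs_ite r1 (runs_ret _ _ _)))).
    by rewrite -/w mul1n; nia.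
  + have [al1 [b1 [l1 i1 r1]]] := simulatesW (leq_addl (100 * w) Ca) (IA _ _ _ _ e1) hi.
    have [al2 [b2 [l2 i2 r2]]] := IH erefl _ i1.
    exists al2, b2; split => //; try lia.
    have := runs_tst s.2 hi hr; rewrite h0 => r0.
    have r3 := @runs_ite _ (sq (compile K a) (ret true)) (ret false) _ _ _ _ _ _ _ r0
      (runs_sq (leqnn _) r1 (runs_ret true _ _)).
    apply: (runsW _ (runs_whl_next r3 r2)).
    apply: leq_trans (time_add (100 * w + Ca) m l1).
    have le1 : 6 * K.+1 * al.+2 + 1 <= (100 * w + Ca) * (al + size s.2).+1.
      by rewrite -/w; nia.
    have gen k X Y Z : k + 1 <= Z -> k + (X + 1) + Y <= X + Y + Z by lia.
    exact: gen.
- have [hr /andP[/IHa [Ca IA] /IHb [Cb IB]]] := andP hb.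
  exists (100 * w + Ca + Cb) => inp s s' _ /ex_inbitE [n0 -> H4] al hi.
  have S : simulates K inp
      (compile K (if nth false inp (s.1 r) then a else b)) (100 * w + Ca + Cb) s s' n0.
    by move: H4; case: ifP => _ H4; [apply: simulatesW (IA _ _ _ _ H4)|
       apply: simulatesW (IB _ _ _ _ H4)]; lia.
  have [al2 [b2 [l2 i2 r2]]] := S _ (alloc_okS hi).
  exists al2, b2; split => //; try lia.
  have e1 := runs_inb s.2 hi hr.
  have e2 : runs (if nth false inp (s.1 r) then compile K a else compile K b)
    (0%Z, lay K inp al.+1 s.1 s.2)
    ((100 * w + Ca + Cb) * (n0 * (al.+1 + size s.2 + n0).+1)) b2 (0%Z, lay K inp al2 s'.1 s'.2).
    by move: r2; case: (nth _ _ _).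
  apply: runsW (runs_ite e1 e2).
  by apply: time_step; [rewrite -/w; nia|lia].
Qed.

(* The input is read from its last bit on, so that it gets stored reversed and its cells become
   free for the output; register 0 counts its length. *)
Definition regs0 n : nat -> nat := fun r => if r == 0 then n else 0.
Definition inpat K b : seq sym := Some true :: nseq K.-1 (Some false) ++ [:: Some b].
Definition load1 K b := sq (put None MLeft) (sq goL (push (inpat K b))).
Definition loadbody K := sq (mv1 MRight) (sq goR (sq (mv1 MLeft)
  (ite (test isS) (ite (test isY) (load1 K true) (load1 K false)) (ret false)))).
Definition load K := sq (mv1 MLeft) (whl (loadbody K)).

Lemma lay_pos K inp al rs o j : lay K inp al rs o (1 + Z.of_nat j) = nth None (map Some o) j.
Proof.
have -> : (1 + Z.of_nat j = Z.pos (Pos.of_succ_nat j))%Z by lia.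
by rewrite /lay; congr nth; lia.
Qed.

Lemma runs_goL_home K inp al rs out m : m = size out ->
  runs goL (Z.of_nat m, lay K inp al rs out) m.+1 true (0%Z, lay K inp al rs out).
Proof.
move=> E; have -> : 0%Z = (Z.of_nat m + Z.of_nat m * dirz MLeft)%Z by zl.
apply: runs_scan => [j lt|].
  have -> : (Z.of_nat m + Z.of_nat j * dirz MLeft = 1 + Z.of_nat (m - j.+1))%Z by zl.
  by rewrite lay_pos (nth_map false) //; lia.
by have -> : (Z.of_nat m + Z.of_nat m * dirz MLeft = 0)%Z by zl.
Qed.

Lemma runs_loadbody K inp x b : 0 < K ->
  runs (loadbody K) (0%Z, lay K inp (size inp) (regs0 (size inp)) (rcons x b))
    (20 * K.+1 * (size x + size inp).+3) true
    (0%Z, lay K (rcons inp b) (size inp).+1 (regs0 (size inp).+1) x).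
Proof.
move=> K0; set al := size inp.
have e1 := @runs_keep (fun _ => MRight) (fun _ => true) 0 (lay K inp al (regs0 al) (rcons x b)) 1 isT.
apply: (runs_sq _ e1 (n2 := 19 * K.+1 * (size x + al).+3)); first by lia.
have e2 : runs goR ((0 + dirz MRight)%Z, lay K inp al (regs0 al) (rcons x b)) (size x).+2 true
    ((1 + Z.of_nat (size x).+1)%Z, lay K inp al (regs0 al) (rcons x b)).
  have -> : (1 + Z.of_nat (size x).+1)%Z =
    ((0 + dirz MRight) + Z.of_nat (size x).+1 * dirz MRight)%Z by zl.
  apply: runs_scan => [j lt|]; cbn [dirz]; rewrite Z.mul_1_r ?Z.add_0_l lay_pos.
    by rewrite (nth_map false) ?size_rcons.
  by rewrite nth_default ?size_map ?size_rcons.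
apply: (runs_sq _ e2 (n2 := 18 * K.+1 * (size x + al).+3)); first by lia.
have e3 := @runs_keep (fun _ => MLeft) (fun _ => true) (1 + Z.of_nat (size x).+1)
  (lay K inp al (regs0 al) (rcons x b)) 1 isT.
apply: (runs_sq _ e3 (n2 := 17 * K.+1 * (size x + al).+3)); first by lia.
have -> : (1 + Z.of_nat (size x).+1 + dirz MLeft = 1 + Z.of_nat (size x))%Z by zl.
have sy : lay K inp al (regs0 al) (rcons x b) (1 + Z.of_nat (size x)) = Some b.
  by rewrite lay_pos (nth_map false) ?size_rcons // nth_rcons ltnn eqxx.
have := @runs_test isS (1 + Z.of_nat (size x)) (lay K inp al (regs0 al) (rcons x b)) 1 isT.
have := @runs_test isY (1 + Z.of_nat (size x)) (lay K inp al (regs0 al) (rcons x b)) 1 isT.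
rewrite sy /= => e5 e4; apply: (@runsW _ _ (1 + (1 + 16 * K.+1 * (size x + al).+3))).
  by lia.
apply: (runs_ite e4); apply: (runs_ite e5).
suff h : runs (load1 K b) ((1 + Z.of_nat (size x))%Z, lay K inp al (regs0 al) (rcons x b))
   (16 * K.+1 * (size x + al).+3) true (0%Z, lay K (rcons inp b) al.+1 (regs0 al.+1) x).
  by case: (b) h.
apply: (runs_sq _ (runs_act _ _ _ _ _ (isT : 0 < 1)) (n2 := 15 * K.+1 * (size x + al).+3)).
  by lia.
rewrite /zstep; cbn [fst snd].
have -> : (fun z => if (z =? 1 + Z.of_nat (size x))%Z then None
    else lay K inp al (regs0 al) (rcons x b) z) = lay K inp al (regs0 al) x.
  apply: functional_extensionality => z.
  have [hz|hz] := Z_lt_le_dec z 0; first by rewrite ifF; [case: z hz|lia].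
  have [->|hz0] := Z.eq_dec z 0; first by rewrite ifF; [|lia].
  have -> : z = (1 + Z.of_nat (Z.to_nat (z - 1)))%Z by lia.
  rewrite !lay_pos map_rcons nth_rcons size_map; move: (Z.to_nat _) => j.
  case: (ltngtP j (size x)) => h; [by rewrite ifF //; lia| |].
    by rewrite ifF ?nth_default ?size_map //; lia.
  by rewrite ifT ?nth_default ?size_map //; lia.
have -> : (1 + Z.of_nat (size x) + dirz MLeft = Z.of_nat (size x))%Z by zl.
apply: (runs_sq _ (runs_goL_home _ _ _ _ erefl) (n2 := 6 * K.+1 * al.+2)).
  have h1 : 6 * K.+1 * al.+2 <= 6 * K.+1 * (size x + al).+3 by rewrite leq_mul //; lia.
  have h2 : (size x + al).+3 <= 9 * K.+1 * (size x + al).+3 by rewrite leq_pmull.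
  by rewrite -[15]/(9 + 6) mulnDl mulnDl; lia.
apply: runs_push.
- by rewrite /= size_cat size_nseq /=; lia.
- move=> i j lt le; rewrite /bit /regs0; case: (ltnP j K) => hj.
    by case: eqP => // _; rewrite lt; lia.
  by rewrite nth_rcons lt.
- move=> j le; rewrite /bit /regs0 /inpat; case: j le => [|j] le; first by rewrite K0 ltnSn.
  rewrite [nth None _ _]/= nth_cat size_nseq nth_nseq; case: (ltnP j.+1 K) => hj.
    by rewrite ifT ?ifT //; lia.
  have -> : j = K.-1 by lia.
  by rewrite ltnn subnn nth_rcons ltnn eqxx.
Qed.

Lemma runs_load K x : 0 < K ->
  runs (load K) (1%Z, lay K [::] 0 (regs0 0) x) (40 * K.+1 * (size x).+3 ^ 2) true
    (0%Z, lay K (rev x) (size x) (regs0 (size x)) [::]).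
Proof.
move=> K0.
have e1 := @runs_keep (fun _ => MLeft) (fun _ => true) 1 (lay K [::] 0 (regs0 0) x) 1 isT.
apply: (runs_sq _ e1 (n2 := (size x).+1 * (20 * K.+1 * (size x + 0).+3))); first by nia.
have -> : (1 + dirz MLeft)%Z = 0%Z by [].
suff key inp : runs (whl (loadbody K)) (0%Z, lay K inp (size inp) (regs0 (size inp)) x)
    ((size x).+1 * (20 * K.+1 * (size x + size inp).+3)) true
    (0%Z, lay K (inp ++ rev x) (size x + size inp) (regs0 (size x + size inp)) [::]).
  by have := key [::]; rewrite /= !addn0.
clear e1.
elim/last_ind: x inp => [|x b IH] inp.
  apply: runs_whl_stop; rewrite mul1n cats0 !add0n.
  apply: (runs_sq _ (@runs_keep (fun _ => MRight) (fun _ => true) 0 _ 1 isT)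
    (n2 := 10 * K.+1 * (size inp).+3)); first by lia.
  have e2 : runs goR ((0 + dirz MRight)%Z, lay K inp (size inp) (regs0 (size inp)) [::]) 1 true
      ((1 + Z.of_nat 0 * dirz MRight)%Z, lay K inp (size inp) (regs0 (size inp)) [::]).
    exact: runs_scan.
  apply: (runs_sq _ e2 (n2 := 9 * K.+1 * (size inp).+3)); first by lia.
  apply: (runs_sq _ (@runs_keep (fun _ => MLeft) (fun _ => true) _ _ 1 isT)
    (n2 := 8 * K.+1 * (size inp).+3)); first by lia.
  have -> : (1 + Z.of_nat 0 * dirz MRight + dirz MLeft)%Z = 0%Z by [].
  have e4 := @runs_test isS 0 (lay K inp (size inp) (regs0 (size inp)) [::]) 1 isT.
  apply: (@runsW _ _ (1 + 1)); first by lia.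
  by apply: (runs_ite (b := false) e4); apply: runs_ret.
rewrite size_rcons mulSn; apply: (@runsW _ _ (20 * K.+1 * (size x + size inp).+3 +
  (size x).+1 * (20 * K.+1 * (size x + (size inp).+1).+3))).
  by rewrite addSnnS leq_add // leq_mul //; lia.
apply: runs_whl_next (runs_loadbody _ _ _ K0) _.
have := IH (rcons inp b); rewrite size_rcons rev_rcons cat_rcons.
by rewrite addSnnS.
Qed.

(* State 0 of the machine is an alias of the initial state, the others enumerate [option (st M)];
   [None] is the halting state. *)
Section ToTM.
Variable M : mach.
Definition tmst := option (st M).
Definition tmdec (i : 'I_#|{: tmst}|.+1) : tmst :=
  if unlift ord0 i is Some j then enum_val j else Some (ini M).
Definition tmenc (q : tmst) : 'I_#|{: tmst}|.+1 := lift ord0 (enum_rank q).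
Lemma tmencK q : tmdec (tmenc q) = q.
Proof. by rewrite /tmdec /tmenc liftK enum_rankK. Qed.
Lemma tmdec0 : tmdec ord0 = Some (ini M).
Proof. by rewrite /tmdec unlift_none. Qed.

Definition toTM : TM := @MkTM #|{: tmst}| (fun i s =>
  if tmdec i is Some q then
    let: (r, w, d) := tr q s in
    Some (tmenc (match r with inl q' => Some q' | inr _ => None end), w, d)
  else None).

Definition reps (c : config toTM) (t : ztape) :=
  [/\ cf_head c = t.2 t.1,
      forall i, nth None (cf_left c) i = t.2 (t.1 - 1 - Z.of_nat i)%Z &
      forall i, nth None (cf_right c) i = t.2 (t.1 + 1 + Z.of_nat i)%Z].

Lemma reps_step c t q r w d : reps c t -> tmdec (cf_state c) = Some q ->
  tr q (t.2 t.1) = (r, w, d) ->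
  [/\ ~~ halted c, tmdec (cf_state (tm_step c)) = (if r is inl q' then Some q' else None) &
  reps (tm_step c) (zstep t w d)].
Proof.
case: c => s l h rt [/= h1 h2 h3] E1 E2.
rewrite /halted /tm_step /= E1 h1 E2.
have ne z : z <> t.1 -> (if (z =? t.1)%Z then w else t.2 z) = t.2 z.
  by move=> ne; case: Z.eqb_spec.
case: d {E2} => /=; (split=> //; first by rewrite tmencK).
- split=> /=.
  + by rewrite ne -?nth0 ?h2; [congr (t.2 _)|]; lia.
  + by move=> i; rewrite nth_behead h2 ne; [congr (t.2 _)|]; lia.
  + case=> [|i] /=; first by rewrite ifT //; lia.
    by rewrite h3 ne; [congr (t.2 _)|]; lia.
- split=> /=.
  + by rewrite ne -?nth0 ?h3; [congr (t.2 _)|]; lia.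
  + case=> [|i] /=; first by rewrite ifT //; lia.
    by rewrite h2 ne; [congr (t.2 _)|]; lia.
  + by move=> i; rewrite nth_behead h3 ne; [congr (t.2 _)|]; lia.
- split=> /=.
  + by rewrite ifT //; lia.
  + by move=> i; rewrite h2 ne; [congr (t.2 _)|]; lia.
  + by move=> i; rewrite h3 ne; [congr (t.2 _)|]; lia.
Qed.

Lemma reps_run q t n b t' : run q t n b t' -> forall c, reps c t ->
  tmdec (cf_state c) = Some q ->
  halted (iter n (@tm_step toTM) c) /\ reps (iter n (@tm_step toTM) c) t'.
Proof.
elim=> {q t n b t'} [q t b w d E|q q' t w d n b t' E _ IH] c hr hq.
  have [_ h1 h2] := reps_step hr hq E; split=> //.
  by rewrite /halted /= h1.
have [_ h1 h2] := reps_step hr hq E.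
by rewrite iterSr; apply: IH.
Qed.

Lemma tmdec_init x : tmdec (cf_state (init_config toTM x)) = Some (ini M).
Proof. by case: x => [|b x]; apply: tmdec0. Qed.

End ToTM.

Lemma read_wordE s (o : seq bool) : (forall i, nth None s i = nth None (map Some o) i) ->
  read_word s = o.
Proof.
elim: o s => [|b o IH] [|a s] h //=.
- by have := h 0 => /= ->.
- by have := h 0.
- by have := h 0 => /= ->; rewrite (IH s) // => i; have := h i.+1.
Qed.

Theorem cmd_poly_time (c : cmd) (f : seq bool -> seq bool) E :
  (forall x, exists rs n, n <= (size x).+2 ^ E /\
     ex (rev x) c (regs0 (size x), [::]) (rs, f x) n) ->
  poly_time_computable f.
Proof.
move=> H; set K := (regbound c).+1.
have [C hC] := compile_ok (below_regbound (leqnSn (regbound c)) : below K c).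
(* The final move puts the head on cell 1, where the output starts and where [tm_output] begins to
   read. *)
set M := sq (load K) (sq (compile K c) (mv1 MRight)).
pose D := 40 * K.+1 * 4 + C * 2 + 1.
exists (toTM M), (D * 3 ^ (E + E + 2)), (E + E + 2) => x.
have [rs [n [le e]]] := H x; set N := (size x).+2.
have hi : alloc_ok K (rev x) (size x) (regs0 (size x)).
  by rewrite /alloc_ok size_rev; split=> // r _; rewrite /regs0; case: eqP.
have [al' [b [/= _ _ r2]]] := hC _ _ _ _ e _ hi.
have r3 := @runs_keep (fun _ => MRight) (fun _ => true) 0 (lay K (rev x) al' rs (f x)) 1 isT.
have [n' len r] := runs_sq (leqnn _) (@runs_load K x isT) (runs_sq (leqnn _) r2 r3).
exists n'; split.
  have N1 : N ^ 1 <= N ^ (E + E + 2) by rewrite leq_pexp2l //; lia.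
  have N2 : N ^ 2 <= N ^ (E + E + 2) by rewrite leq_pexp2l //; lia.
  have N3 : n * (size x + 0 + n).+1 <= 2 * N ^ (E + E + 2).
    have h1 : (size x + 0 + n).+1 <= 2 * N ^ (E + 1).
      have : N ^ 1 <= N ^ (E + 1) by rewrite leq_pexp2l //; lia.
      have : N ^ E <= N ^ (E + 1) by rewrite leq_pexp2l //; lia.
      by rewrite expn1; move: le; rewrite -/N; rewrite {4}/N; lia.
    apply: leq_trans (leq_mul le h1) _; rewrite mulnCA leq_mul // -/N -expnD leq_pexp2l //; lia.
  have N4 : (size x).+3 ^ 2 <= 4 * N ^ 2 by rewrite -[4]/(2 ^ 2) -expnMn leq_exp2r //; lia.
  have le2 : n' <= D * N ^ (E + E + 2).
    apply: leq_trans len _; rewrite /D !mulnDl mul1n addnA leq_add //; last by rewrite expn_gt0.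
    rewrite leq_add //.
      by apply: leq_trans (leq_mul (leqnn (40 * K.+1)) N4) _; rewrite mulnA leq_mul.
    by rewrite -[X in _ <= X]mulnA leq_mul.
  apply: leq_trans le2 _; rewrite -mulnA -mulnDr leq_mul // -expnMn.
  (* [N] is at most [3 * size x] for a nonempty input; for the empty one the additive constant of
     the bound takes over. *)
  case: (posnP (size x)) => [E0|gt].
    rewrite /N E0; apply: leq_trans (leq_addl _ _); rewrite leq_exp2r //; lia.
  by apply: leq_trans (leq_addr _ _); rewrite leq_exp2r ?addn2 //; lia.
rewrite /tm_computes_in.
have := reps_run r (c := init_config (toTM M) x).
case=> [| |hh [h1 h2 h3]].
- have z f0 : (forall i, nth None (map Some x) i = f0 (1 + Z.of_nat i)%Z) ->
     (forall i, None = f0 (1 - 1 - Z.of_nat i)%Z) ->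
     reps (init_config (toTM M) x) (1%Z, f0).
    move=> g1 g2; have g3 i : f0 (1 - 1 - Z.of_nat i)%Z = None by rewrite -g2.
    have g4 i : f0 (1 + 1 + Z.of_nat i)%Z = nth None (map Some x) i.+1.
      by rewrite g1; congr f0; lia.
    have g5 : f0 1%Z = nth None (map Some x) 0 by rewrite g1.
    by case: (x) g4 g5 => [|b0 y] g4 g5; split; cbn [fst snd init_config cf_head cf_left cf_right];
      move=> *; rewrite ?g5 ?g3 ?g4 ?nth_nil.
  apply: z => i; first by rewrite lay_pos.
  by case: i => // i; rewrite /lay; case E2: (1 - 1 - _)%Z => //; lia.
- exact: tmdec_init.
split=> //; apply: read_wordE => i /=.
case: i => [|i]; [cbn [nth]|rewrite [LHS]/=].
  by rewrite h1 /=; have := lay_pos K (rev x) al' rs (f x) 0.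
rewrite h3 -[RHS](lay_pos K (rev x) al' rs (f x)); cbn [fst snd].
by congr (lay _ _ _ _ _ _); zl.
Qed.

(** * Timed execution of counter programs *)

Ltac upds := apply: functional_extensionality => ?; rewrite /upd;
  repeat (case: eqP => ?); subst; try congruence; try lia.

Definition exle inp c s s' B := exists2 n, n <= B & ex inp c s s' n.

Lemma exleW inp c s s' n m : n <= m -> exle inp c s s' n -> exle inp c s s' m.
Proof. by move=> le [n' le' e]; exists n' => //; lia. Qed.

Lemma exle_inc inp r rs rs' out B : 0 < B -> rs' = upd rs r (rs r).+1 ->
  exle inp (Inc r) (rs, out) (rs', out) B.
Proof. by move=> hB ->; exists 1 => //; apply: (ex_inc inp r (rs, out)). Qed.

Lemma exle_dec inp r rs rs' out B : 0 < B -> 0 < rs r -> rs' = upd rs r (rs r).-1 ->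
  exle inp (Dec r) (rs, out) (rs', out) B.
Proof. by move=> hB h ->; exists 1 => //; apply: (@ex_dec inp r (rs, out)). Qed.

Lemma exle_skip inp s B : 0 < B -> exle inp Skip s s B.
Proof. by move=> hB; exists 1 => //; apply: ex_skip. Qed.

Lemma exle_seq inp a b s s1 s2 n m B : n + m <= B ->
  exle inp a s s1 n -> exle inp b s1 s2 m -> exle inp (Seq a b) s s2 B.
Proof.
move=> le [n1 l1 e1] [n2 l2 e2]; exists (n1 + n2); first by lia.
exact: ex_seq e1 e2.
Qed.

Lemma exle_ifz inp r a b s s' n B : n < B ->
  exle inp (if s.1 r == 0 then a else b) s s' n -> exle inp (IfZ r a b) s s' B.
Proof. by move=> le [n1 l1 e1]; exists n1.+1; [lia|apply: ex_ifz]. Qed.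

Lemma exle_inbit inp r a b s s' n B : n < B ->
  exle inp (if nth false inp (s.1 r) then a else b) s s' n -> exle inp (InBit r a b) s s' B.
Proof. by move=> le [n1 l1 e1]; exists n1.+1; [lia|apply: ex_inbit]. Qed.

(** [S j] is the whole state before iteration [j]. Giving it in closed form replaces a loop
    invariant. *)
Lemma exle_loop inp a r (S : nat -> cstate) c g :
  (forall j, j <= g -> (S j).1 r = g - j) ->
  (forall j, j < g -> exle inp a (S j) (S j.+1) c) ->
  exle inp (While r a) (S 0) (S g) (g * c.+1 + 1).
Proof.
move=> h1 h2; suff key d : d <= g -> exle inp (While r a) (S (g - d)) (S g) (d * c.+1 + 1).
  by have := key g; rewrite subnn; apply.
elim: d => [|d IH] le.
  by exists 1 => //; rewrite subn0; apply: ex_while0; rewrite h1 // subnn.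
have [n le1 e1] := h2 (g - d.+1) (ltac:(lia)).
have [m le2 e2] := IH (ltnW le).
exists (n + m).+1; first by rewrite mulSn; lia.
apply: ex_whileS e1 _; first by rewrite h1; lia.
by have -> : (g - d.+1).+1 = g - d by lia.
Qed.

Definition drain a b := While a (Seq (Dec a) (Inc b)).
Definition clear a := While a (Dec a).

Lemma exle_drain inp a b rs rs' out B : a != b -> 3 * rs a + 1 <= B ->
  rs' = upd (upd rs b (rs b + rs a)) a 0 -> exle inp (drain a b) (rs, out) (rs', out) B.
Proof.
move=> /eqP ab le ->.
pose S j : cstate := (upd (upd rs b (rs b + j)) a (rs a - j), out).
have -> : (rs, out) = S 0 by congr pair; rewrite addn0 subn0; upds.
have -> : (upd (upd rs b (rs b + rs a)) a 0, out) = S (rs a) by rewrite /S subnn.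
apply: (@exleW _ _ _ _ (rs a * 3 + 1)); first by lia.
apply: exle_loop => j lt; first by rewrite /= /upd eqxx.
apply: (@exle_seq _ _ _ _ (upd (upd rs b (rs b + j)) a (rs a - j.+1), out) _ 1 1) => //.
  by apply: exle_dec => //; [rewrite /upd eqxx; lia|upds].
by apply: exle_inc => //; upds.
Qed.

Lemma exle_clear inp a rs rs' out B : 2 * rs a + 1 <= B -> rs' = upd rs a 0 ->
  exle inp (clear a) (rs, out) (rs', out) B.
Proof.
move=> le ->.
pose S j : cstate := (upd rs a (rs a - j), out).
have -> : (rs, out) = S 0 by congr pair; rewrite subn0; upds.
have -> : (upd rs a 0, out) = S (rs a) by rewrite /S subnn.
apply: (@exleW _ _ _ _ (rs a * 2 + 1)); first by lia.
apply: exle_loop => j lt; first by rewrite /= /upd eqxx.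
by apply: exle_dec => //; [rewrite /upd eqxx; lia|upds].
Qed.

Definition copy a b t := Seq (While a (Seq (Dec a) (Seq (Inc b) (Inc t)))) (drain t a).

Lemma exle_copy inp a b t rs rs' out B : a != b -> a != t -> b != t -> rs t = 0 ->
  7 * rs a + 2 <= B ->
  rs' = upd rs b (rs b + rs a) -> exle inp (copy a b t) (rs, out) (rs', out) B.
Proof.
move=> /eqP ab /eqP at_ /eqP bt t0 le ->.
pose S j : cstate := (upd (upd (upd rs b (rs b + j)) t j) a (rs a - j), out).
apply: (@exle_seq _ _ _ _ (S (rs a)) _ (rs a * 4 + 1) (3 * rs a + 1)); first by lia.
  have -> : (rs, out) = S 0 by congr pair; rewrite addn0 subn0; upds.
  apply: exle_loop => j lt; first by rewrite /= /upd eqxx.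
  apply: (@exle_seq _ _ _ _ (upd (upd (upd rs b (rs b + j)) t j) a (rs a - j.+1), out) _ 1 2) => //.
    by apply: exle_dec => //; [rewrite /upd eqxx; lia|upds].
  apply: (@exle_seq _ _ _ _ (upd (upd (upd rs b (rs b + j.+1)) t j) a (rs a - j.+1), out) _ 1 1) => //.
    by apply: exle_inc => //; upds.
  by apply: exle_inc => //; upds.
have e : upd (upd (upd rs b (rs b + rs a)) t (rs a)) a (rs a - rs a) t = rs a.
  by rewrite /upd eqxx; case: (t =P a) => // ?; congruence.
by apply: exle_drain; rewrite ?e; [apply/eqP; congruence| |upds].
Qed.

(** * Polynomial-time evaluable functions *)

Section Comp.
Implicit Types (inp : seq bool) (e : seq nat).

(** The bound is a power of [N >= 2], so one larger exponent absorbs constants and sums. In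
    [evaluable] the program is chosen before [D] and the exponent [E] after it: the same code can
    then run inside a loop, where the index has a larger bound, at the price of a larger exponent.
    Registers from [k] on are scratch space. *)
Definition env_ok inp (rs : nat -> nat) (rho : seq nat) k N D :=
  [/\ rs 0 = size inp, N = (size inp).+2, all (fun v => v <= N ^ D) (map rs rho) &
      forall r, k <= r -> rs r = 0].

(* [F inp e] can be evaluated by a program, in time polynomial in the size of [inp] and in
   the values of the environment [e], whatever registers [rho] hold that environment. *)
Definition evaluable (F : seq bool -> seq nat -> nat) := forall rho k,
  0 < k -> all (fun r => r < k) rho -> exists c, forall D, exists E,
  forall inp rs out N, env_ok inp rs rho k N D ->
  F inp (map rs rho) <= N ^ E /\
  exle inp c (rs, out) (upd rs k (F inp (map rs rho)), out) (N ^ E).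

Definition outs (G : seq bool -> seq nat -> seq bool) := forall rho k,
  0 < k -> all (fun r => r < k) rho -> exists c, forall D, exists E,
  forall inp rs out N, env_ok inp rs rho k N D ->
  exle inp c (rs, out) (rs, out ++ G inp (map rs rho)) (N ^ E).

Lemma const_pow c N a : 1 < N -> c * N ^ a <= N ^ (c + a).
Proof.
move=> N1; rewrite expnD leq_mul //.
by apply: ltnW; apply: ltn_expl.
Qed.

Lemma pow_mono N a b : 1 < N -> a <= b -> N ^ a <= N ^ b.
Proof. by move=> N1 le; rewrite leq_pexp2l //; lia. Qed.

Lemma map_upd rs k v rho : all (fun r => r < k) rho -> map (upd rs k v) rho = map rs rho.
Proof.
move=> /allP h; apply/eq_in_map => r /h lt; rewrite /upd.
by case: eqP lt => // ->; rewrite ltnn.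
Qed.

Lemma all_lt_leq rho k m : k <= m -> all (fun r => r < k) rho -> all (fun r => r < m) rho.
Proof. by move=> le; apply: sub_all => r /= lt; lia. Qed.

Lemma env_ok_upd inp rs rho k N D v : 0 < k -> all (fun r => r < k) rho ->
  env_ok inp rs rho k N D -> env_ok inp (upd rs k v) rho k.+1 N D.
Proof.
move=> k0 hr [h1 h2 h3 h4]; split=> //.
- by rewrite /upd; case: eqP k0 => // <-.
- by rewrite map_upd.
- by move=> r le; rewrite /upd; case: eqP => [E|_]; [lia|apply: h4; lia].
Qed.

Lemma comp_size : evaluable (fun inp _ => size inp).
Proof.
move=> rho k k0 hr; exists (copy 0 k k.+1) => D; exists (9 + 1) => inp rs out N [h1 h2 h3 h4].
have N1 : 1 < N by lia.
have := const_pow 9 1 N1; rewrite expn1 => hN.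
split; first by lia.
apply: exle_copy; try by rewrite -?h1; lia.
- by apply: h4; lia.
- by rewrite h4 // h1.
Qed.

Lemma comp_nth i : evaluable (fun _ e => nth 0 e i).
Proof.
move=> rho k k0 hr; case: (ltnP i (size rho)) => hi.
  exists (copy (nth 0 rho i) k k.+1) => D; exists (9 + D) => inp rs out N [h1 h2 h3 h4].
  have N1 : 1 < N by lia.
  have := const_pow 9 D N1 => hN.
  have lt : nth 0 rho i < k by apply: (allP hr); apply: mem_nth.
  have le : rs (nth 0 rho i) <= N ^ D.
    by move/allP: h3; apply; apply: map_f; apply: mem_nth.
  have pos : 0 < N ^ D by rewrite expn_gt0; lia.
  rewrite (nth_map 0) //; split; first by lia.
  apply: exle_copy; try by lia.
  - by apply: h4; lia.
  - by rewrite (h4 k).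
exists Skip => D; exists 0 => inp rs out N [h1 h2 h3 h4].
rewrite nth_default ?size_map //; split => //.
have -> : upd rs k 0 = rs by upds; rewrite h4 //; lia.
exact: exle_skip.
Qed.

Lemma comp_const c : evaluable (fun _ _ => c).
Proof.
move=> rho k k0 hr; exists (iter c (Seq (Inc k)) Skip) => D; exists (c.+1 + 0) => inp rs out N.
move=> [h1 h2 h3 h4]; have N1 : 1 < N by lia.
have := const_pow c.+1 0 N1; rewrite expn0 muln1 => hN; split; first by lia.
apply: (exleW hN) => {hN}.
suff key rs0 : exle inp (iter c (Seq (Inc k)) Skip) (rs0, out) (upd rs0 k (rs0 k + c), out) c.+1.
  by have := key rs; rewrite (h4 k).
clear; elim: c rs0 => [|c IH] rs0 /=.
  by rewrite addn0; have -> : upd rs0 k (rs0 k) = rs0 by [upds]; exact: exle_skip.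
apply: (@exle_seq _ _ _ _ (upd rs0 k (rs0 k).+1, out) _ 1 c.+1) => //.
  exact: exle_inc.
have := IH (upd rs0 k (rs0 k).+1).
have -> : upd rs0 k (rs0 k).+1 k = (rs0 k).+1 by rewrite /upd eqxx.
by congr exle; congr pair; upds.
Qed.
(** The bound on [op] keeps values polynomial. The code [fin] finds its operands in registers [k]
    and [k.+1], leaves the result in [k] and must restore [k.+1] to zero. *)
Lemma comp_op (op : seq bool -> nat -> nat -> nat) (fin : nat -> cmd) F G :
  (forall inp a b, op inp a b <= a + b + 1) ->
  (forall inp k rs out, exle inp (fin k) (rs, out)
     (upd (upd rs k (op inp (rs k) (rs k.+1))) k.+1 0, out) (10 * (rs k + rs k.+1) + 10)) ->
  evaluable F -> evaluable G -> evaluable (fun inp e => op inp (F inp e) (G inp e)).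
Proof.
move=> hop hfin hF hG rho k k0 hr.
have [cF HF] := hF rho k k0 hr.
have [cG HG] := hG rho k.+1 isT (all_lt_leq (leqnSn k) hr).
exists (Seq cF (Seq cG (fin k))) => D.
have [EF {}HF] := HF D; have [EG {}HG] := HG D.
exists (34 + (EF + EG)) => inp rs out N ok.
have N1 : 1 < N by case: ok => _ -> _ _.
have [vF eF] := HF inp rs out N ok.
have := HG inp (upd rs k (F inp (map rs rho))) out N (env_ok_upd _ k0 hr ok).
rewrite map_upd //; set a := F _ _ in vF eF *; set b := G _ _ => -[vG eG].
have hN := const_pow 34 (EF + EG) N1.
have := pow_mono N1 (leq_addr EG EF); have := pow_mono N1 (leq_addl EF EG) => l1 l2.
have l3 : 0 < N ^ (EF + EG) by rewrite expn_gt0; lia.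
split; first by have := hop inp a b; lia.
apply: (@exle_seq _ _ _ _ (upd rs k a, out) _ (N ^ EF) (33 * N ^ (EF + EG))) => //.
  by lia.
apply: (@exle_seq _ _ _ _ (upd (upd rs k a) k.+1 b, out) _ (N ^ EG) (32 * N ^ (EF + EG))) => //.
  by lia.
have e1 : upd (upd rs k a) k.+1 b k = a by rewrite /upd eqxx; case: eqP; lia.
have e2 : upd (upd rs k a) k.+1 b k.+1 = b by rewrite /upd eqxx.
have [_ _ _ h4] := ok; have := h4 k.+1 (leqnSn k) => z.
have := hfin inp k (upd (upd rs k a) k.+1 b) out; rewrite e1 e2.
have -> : upd (upd (upd (upd rs k a) k.+1 b) k (op inp a b)) k.+1 0 = upd rs k (op inp a b).
  by upds.
by apply: exleW; lia.
Qed.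

Lemma comp_add F G : evaluable F -> evaluable G -> evaluable (fun inp e => F inp e + G inp e).
Proof.
apply: (@comp_op (fun _ a b => a + b) (fun k => drain k.+1 k)) => [inp a b|inp k rs out].
  by rewrite addn1.
by apply: exle_drain; [lia|lia|upds].
Qed.

Lemma comp_sub F G : evaluable F -> evaluable G -> evaluable (fun inp e => F inp e - G inp e).
Proof.
apply: (@comp_op (fun _ a b => a - b)
  (fun k => While k.+1 (Seq (Dec k.+1) (IfZ k Skip (Dec k))))) => [inp a b|inp k rs out].
  by lia.
pose S j : cstate := (upd (upd rs k.+1 (rs k.+1 - j)) k (rs k - j), out).
have -> : (rs, out) = S 0 by congr pair; rewrite !subn0; upds.
have -> : (upd (upd rs k (rs k - rs k.+1)) k.+1 0, out) = S (rs k.+1).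
  by rewrite /S subnn; congr pair; upds.
apply: (@exleW _ _ _ _ (rs k.+1 * 4 + 1)); first by lia.
apply: exle_loop => j lt; first by rewrite /S /upd /= eqxx; case: eqP; lia.
apply: (@exle_seq _ _ _ _ (upd (upd rs k.+1 (rs k.+1 - j.+1)) k (rs k - j), out) _ 1 2) => //.
  by apply: exle_dec => //; [rewrite /upd eqxx; case: eqP; lia|upds].
apply: (@exle_ifz _ _ _ _ _ _ 1) => //.
have -> : (upd (upd rs k.+1 (rs k.+1 - j.+1)) k (rs k - j), out).1 k = rs k - j.
  by rewrite /= /upd eqxx.
case: eqP => h.
  have -> : S j.+1 = (upd (upd rs k.+1 (rs k.+1 - j.+1)) k (rs k - j), out).
    by congr pair; upds.
  exact: exle_skip.
by apply: exle_dec => //; [rewrite /upd eqxx; lia|upds].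
Qed.

Lemma comp_eq0 F : evaluable F -> evaluable (fun inp e => F inp e == 0).
Proof.
move=> hF; apply: (@comp_op (fun _ a b => nat_of_bool (a == 0))
  (fun k => Seq (clear k.+1) (IfZ k (Inc k) (clear k))) F (fun _ _ => 0)) => //.
- by move=> inp a b; case: eqP; lia.
- move=> inp k rs out.
  apply: (@exle_seq _ _ _ _ (upd rs k.+1 0, out) _ (2 * rs k.+1 + 1) (2 * rs k + 2)); first by lia.
    exact: exle_clear.
  apply: (@exle_ifz _ _ _ _ _ _ (2 * rs k + 1)); first by lia.
  have -> : (upd rs k.+1 0, out).1 k = rs k by rewrite /= /upd; case: eqP; lia.
  case: eqP => h; first by apply: exle_inc; [lia|upds].
  by apply: exle_clear; [rewrite /upd; case: eqP; lia|upds].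
- exact: comp_const.
Qed.

Lemma comp_input F : evaluable F -> evaluable (fun inp e => nth false inp (F inp e)).
Proof.
move=> hF; apply: (@comp_op (fun inp a b => nat_of_bool (nth false inp a))
  (fun k => Seq (clear k.+1) (InBit k (Seq (clear k) (Inc k)) (clear k))) F (fun _ _ => 0)) => //.
- by move=> inp a b; case: nth; lia.
- move=> inp k rs out.
  apply: (@exle_seq _ _ _ _ (upd rs k.+1 0, out) _ (2 * rs k.+1 + 1) (2 * rs k + 3)); first by lia.
    exact: exle_clear.
  apply: (@exle_inbit _ _ _ _ _ _ (2 * rs k + 2)); first by lia.
  have e : upd rs k.+1 0 k = rs k by rewrite /= /upd; case: eqP; lia.
  have -> : (upd rs k.+1 0, out).1 k = rs k by rewrite /= e.
  case: nth; last by apply: exle_clear; [rewrite e; lia|upds].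
  apply: (@exle_seq _ _ _ _ (upd (upd rs k.+1 0) k 0, out) _ (2 * rs k + 1) 1); first by lia.
    by apply: exle_clear; [rewrite e; lia|].
  by apply: exle_inc; [lia|upds].
- exact: comp_const.
Qed.

Lemma comp_ext F G : (forall inp e, F inp e = G inp e) -> evaluable F -> evaluable G.
Proof.
by move=> E; have -> : F = G by do 2!apply: functional_extensionality => ?.
Qed.

Lemma comp_behead F : evaluable F -> evaluable (fun inp e => F inp (behead e)).
Proof.
move=> hF rho k k0 hr.
have hr' : all (fun r => r < k) (behead rho) by case: rho hr => //= r rho /andP[].
have [c H] := hF _ k k0 hr'; exists c => D; have [E {}H] := H D; exists E.
move=> inp rs out N [h1 h2 h3 h4]; rewrite behead_map.
apply: H; split=> //.
by case: (rho) h3 => //= r rho' /andP[].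
Qed.

Lemma comp_head : evaluable (fun _ e => head 0 e).
Proof. by apply: comp_ext (comp_nth 0) => inp e; rewrite nth0. Qed.

(** The index is pushed in front of the environment, as with de Bruijn indices, so the body reaches
    the outer arguments through [behead]. Its values lie below [N ^ EF], which is why the body is
    used at exponent [D + EF]. *)
Lemma comp_sum F G : evaluable F -> evaluable (fun inp e => G inp (behead e) (head 0 e)) ->
  evaluable (fun inp e => \sum_(i < F inp e) G inp e i).
Proof.
move=> hF hG rho k k0 hr.
have [cF HF] := hF rho k k0 hr.
have hr' : all (fun r => r < k.+3) (k.+1 :: rho).
  by rewrite /= (@all_lt_leq rho k k.+3) ?andbT //; lia.
have [cG HG] := hG (k.+1 :: rho) k.+3 isT hr'.
pose body := Seq cG (Seq (drain k.+3 k.+2) (Seq (Inc k.+1) (Dec k))).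
exists (Seq cF (Seq (While k body) (Seq (clear k.+1) (drain k.+2 k)))) => D.
have [EF {}HF] := HF D; have [EG {}HG] := HG (D + EF).
exists (24 + (EF + EG)) => inp rs out N ok.
have [h1 h2 h3 h4] := ok; have N1 : 1 < N by lia.
have [vF eF] := HF inp rs out N ok; set g := F _ _ in vF eF *.
pose e := map rs rho; pose s j := \sum_(i < j) G inp e i.
(* Register [k] counts down, [k.+1] is the index, [k.+2] accumulates; the body leaves its value in
   [k.+3]. *)
pose S j : cstate := (upd (upd (upd rs k.+2 (s j)) k.+1 j) k (g - j), out).
have posF : 0 < N ^ EF by rewrite expn_gt0; lia.
have posG : 0 < N ^ EG by rewrite expn_gt0; lia.
have step j : j < g -> G inp e j <= N ^ EG /\ exle inp body (S j) (S j.+1) (7 * N ^ EG).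
  move=> lt; pose rs1 := (S j).1.
  have env1 : map rs1 (k.+1 :: rho) = j :: e.
    congr cons; first by rewrite /rs1 /S /upd /=; repeat (case: eqP => ?); lia.
    apply/eq_in_map => r /(allP hr) lt'.
    by rewrite /rs1 /S /upd /=; repeat (case: eqP => ?); lia.
  have ok1 : env_ok inp rs1 (k.+1 :: rho) k.+3 N (D + EF).
    split=> //.
    - by rewrite /rs1 /S /upd /=; repeat (case: eqP => ?); lia.
    - rewrite env1 /=; apply/andP; split.
        have := pow_mono N1 (leq_addl D EF); lia.
      by apply: sub_all h3 => v /= le; have := pow_mono N1 (leq_addr EF D); lia.
    - move=> r le; have := h4 r (ltac:(lia)).
      by rewrite /rs1 /S /upd /=; repeat (case: eqP => ?); lia.
  have := HG inp rs1 out N ok1; rewrite env1 => -[vG eG]; split=> //.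
  have z := h4 k.+3 (ltac:(lia)).
  apply: (@exle_seq _ _ _ _ (upd rs1 k.+3 (G inp e j), out) _ (N ^ EG) (6 * N ^ EG));
    [lia|exact: eG|].
  apply: (@exle_seq _ _ _ _ (upd rs1 k.+2 (s j.+1), out) _ (4 * N ^ EG) (2 * N ^ EG)); first by lia.
    apply: exle_drain; first by lia.
      by rewrite /upd eqxx; have h : G inp e j <= N ^ EG := vG; lia.
    rewrite {1}/s big_ord_recr /= -/(s j) /rs1 /S /=.
    by upds; rewrite ?big_ord_recr //=; lia.
  apply: (@exle_seq _ _ _ _ (upd (upd rs1 k.+2 (s j.+1)) k.+1 j.+1, out) _ 1 1); first by lia.
    by apply: exle_inc => //; rewrite /rs1 /S /=; upds.
  by apply: exle_dec => //; [rewrite /rs1 /S /upd /=; repeat (case: eqP => ?); lia|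
    rewrite /rs1 /S /=; upds].
have sle : s g <= N ^ (EF + EG).
  rewrite /s expnD; apply: leq_trans (_ : g * N ^ EG <= _); last by rewrite leq_mul.
  have -> : g * N ^ EG = \sum_(i < g) N ^ EG by rewrite sum_nat_const card_ord.
  apply: leq_sum => i _.
  by have [] := step i (ltn_ord i).
have loop := exle_loop (r := k) (S := S) (g := g) (c := 7 * N ^ EG) (a := body) (inp := inp)
  (fun j _ => ltac:(by rewrite /S /upd /= eqxx)) (fun j lt => (step j lt).2).
have hN := const_pow 24 (EF + EG) N1.
have l0 : g * (7 * N ^ EG).+1 <= 8 * N ^ (EF + EG).
  apply: leq_trans (_ : N ^ EF * (8 * N ^ EG) <= _); first by rewrite leq_mul //; lia.
  by rewrite expnD mulnCA.
have l1 : N ^ EF <= N ^ (EF + EG) by rewrite pow_mono // leq_addr.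
split; first by rewrite -/(s g); lia.
rewrite -/e -/(s g).
have [z1 z2] : rs k.+1 = 0 /\ rs k.+2 = 0 by split; apply: h4; lia.
apply: (@exle_seq _ _ _ _ (upd rs k g, out) _ (N ^ EF) (23 * N ^ (EF + EG))) => //; first by lia.
apply: (@exle_seq _ _ _ _ (S g) _ (9 * N ^ (EF + EG)) (14 * N ^ (EF + EG))); first by lia.
  have -> : (upd rs k g, out) = S 0.
    by rewrite /S /s big_ord0 subn0; congr pair; upds.
  by apply: exleW loop; lia.
apply: (@exle_seq _ _ _ _ (upd (S g).1 k.+1 0, out) _ (3 * N ^ (EF + EG)) (4 * N ^ (EF + EG)));
  first by lia.
  apply: exle_clear => //; rewrite /S /upd /= ; repeat (case: eqP => ?); lia.
apply: exle_drain; first by lia.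
  by rewrite /S /upd /=; repeat (case: eqP => ?); lia.
by rewrite /S /= subnn; upds.
Qed.

End Comp.

(** * Programs that write output *)

Lemma outs_ext G G' : (forall inp e, G inp e = G' inp e) -> outs G -> outs G'.
Proof.
by move=> E; have -> : G = G' by do 2!apply: functional_extensionality => ?.
Qed.

Lemma outs_nil : outs (fun _ _ => [::]).
Proof.
move=> rho k k0 hr; exists Skip => D; exists 0 => inp rs out N ok.
by rewrite cats0; apply: exle_skip.
Qed.

Lemma outs_bit b : outs (fun _ _ => [:: b]).
Proof.
move=> rho k k0 hr; exists (Out b) => D; exists 0 => inp rs out N ok.
by rewrite cats1; exists 1 => //; apply: (ex_out inp b (rs, out)).
Qed.

Lemma outs_cat G H : outs G -> outs H -> outs (fun inp e => G inp e ++ H inp e).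
Proof.
move=> hG hH rho k k0 hr.
have [cG {}hG] := hG rho k k0 hr; have [cH {}hH] := hH rho k k0 hr.
exists (Seq cG cH) => D; have [EG {}hG] := hG D; have [EH {}hH] := hH D.
exists (2 + (EG + EH)) => inp rs out N ok.
have N1 : 1 < N by case: ok => _ -> _ _.
have := const_pow 2 (EG + EH) N1.
have := pow_mono N1 (leq_addr EH EG); have := pow_mono N1 (leq_addl EG EH) => l1 l2 l3.
rewrite catA; apply: exle_seq (hG _ _ _ _ ok) (hH _ _ _ _ ok); lia.
Qed.

Lemma outs_if b G H : evaluable (fun inp e => nat_of_bool (b inp e)) -> outs G -> outs H ->
  outs (fun inp e => if b inp e then G inp e else H inp e).
Proof.
move=> hb hG hH rho k k0 hr.
have [cb {}hb] := hb rho k k0 hr.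
have [cG {}hG] := hG rho k k0 hr; have [cH {}hH] := hH rho k k0 hr.
exists (Seq cb (IfZ k cH (Seq (Dec k) cG))) => D.
have [Eb {}hb] := hb D; have [EG {}hG] := hG D; have [EH {}hH] := hH D.
exists (6 + (Eb + EG + EH)) => inp rs out N ok.
have N1 : 1 < N by case: ok => _ -> _ _.
have := const_pow 6 (Eb + EG + EH) N1; set X := N ^ (_ + _ + _).
have : N ^ Eb <= X by rewrite pow_mono //; lia.
have : N ^ EG <= X by rewrite pow_mono //; lia.
have : N ^ EH <= X by rewrite pow_mono //; lia.
have X0 : 0 < X by rewrite expn_gt0; lia.
move=> l1 l2 l3 l4; have [_ e1] := hb _ _ out _ ok; have [_ _ _ z] := ok.
apply: (exle_seq (m := 3 + X)) e1 _; first by lia.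
apply: (exle_ifz (n := 1 + X)); first by lia.
have -> : forall v, (upd rs k v, out).1 k = v by move=> v; rewrite /= /upd eqxx.
case: (b _ _) => /=.
  apply: (exle_seq (n := 1) (m := N ^ EG)) (hG _ _ _ _ ok); first by lia.
  by apply: exle_dec => //; [rewrite /upd eqxx|have zk := z k (leqnn k); upds].
have -> : upd rs k 0 = rs by have zk := z k (leqnn k); upds.
by apply: exleW (hH _ _ _ _ ok); lia.
Qed.

Lemma outs_flatten F G : evaluable F -> outs (fun inp e => G inp (behead e) (head 0 e)) ->
  outs (fun inp e => flatten [seq G inp e i | i <- iota 0 (F inp e)]).
Proof.
move=> hF hG rho k k0 hr.
have [cF HF] := hF rho k k0 hr.
have hr' : all (fun r => r < k.+2) (k.+1 :: rho).
  by rewrite /= (@all_lt_leq rho k k.+2) ?andbT //; lia.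
have [cG HG] := hG (k.+1 :: rho) k.+2 isT hr'.
pose body := Seq cG (Seq (Inc k.+1) (Dec k)).
exists (Seq cF (Seq (While k body) (clear k.+1))) => D.
have [EF {}HF] := HF D; have [EG {}HG] := HG (D + EF).
exists (24 + (EF + EG)) => inp rs out N ok.
have [h1 h2 h3 h4] := ok; have N1 : 1 < N by lia.
have [vF eF] := HF inp rs out N ok; set g := F _ _ in vF eF *.
pose e := map rs rho; pose s j := flatten [seq G inp e i | i <- iota 0 j].
pose S j : cstate := (upd (upd rs k.+1 j) k (g - j), out ++ s j).
have posF : 0 < N ^ EF by rewrite expn_gt0; lia.
have posG : 0 < N ^ EG by rewrite expn_gt0; lia.
have step j : j < g -> exle inp body (S j) (S j.+1) (3 * N ^ EG).
  move=> lt; pose rs1 := (S j).1.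
  have env1 : map rs1 (k.+1 :: rho) = j :: e.
    congr cons; first by rewrite /rs1 /S /upd /=; repeat (case: eqP => ?); lia.
    apply/eq_in_map => r /(allP hr) lt'.
    by rewrite /rs1 /S /upd /=; repeat (case: eqP => ?); lia.
  have ok1 : env_ok inp rs1 (k.+1 :: rho) k.+2 N (D + EF).
    split=> //.
    - by rewrite /rs1 /S /upd /=; repeat (case: eqP => ?); lia.
    - rewrite env1 /=; apply/andP; split.
        have := pow_mono N1 (leq_addl D EF); lia.
      by apply: sub_all h3 => v /= le; have := pow_mono N1 (leq_addr EF D); lia.
    - move=> r le; have := h4 r (ltac:(lia)).
      by rewrite /rs1 /S /upd /=; repeat (case: eqP => ?); lia.
  have := HG inp rs1 (out ++ s j) N ok1; rewrite env1 => eG.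
  have -> : S j.+1 = (upd (upd rs k.+1 j.+1) k (g - j.+1), (out ++ s j) ++ G inp e j).
    by congr pair; rewrite /s -addn1 iotaD map_cat flatten_cat /= cats0 catA.
  apply: (@exle_seq _ _ _ _ (rs1, (out ++ s j) ++ G inp e j) _ (N ^ EG) (2 * N ^ EG));
    [lia|exact: eG|].
  apply: (@exle_seq _ _ _ _ (upd rs1 k.+1 j.+1, (out ++ s j) ++ G inp e j) _ 1 1); first by lia.
    by apply: exle_inc => //; rewrite /rs1 /S /=; upds.
  by apply: exle_dec => //; [rewrite /rs1 /S /upd /=; repeat (case: eqP => ?); lia|
    rewrite /rs1 /S /=; upds].
have loop := exle_loop (r := k) (S := S) (g := g) (c := 3 * N ^ EG) (a := body) (inp := inp)
  (fun j _ => ltac:(by rewrite /S /upd /= eqxx)) (fun j lt => step j lt).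
have hN := const_pow 24 (EF + EG) N1.
have l0 : g * (3 * N ^ EG).+1 <= 4 * N ^ (EF + EG).
  apply: leq_trans (_ : N ^ EF * (4 * N ^ EG) <= _); first by rewrite leq_mul //; lia.
  by rewrite expnD mulnCA.
have l1 : N ^ EF <= N ^ (EF + EG) by rewrite pow_mono // leq_addr.
have [z0 z1] : rs k = 0 /\ rs k.+1 = 0 by split; apply: h4; lia.
apply: (@exle_seq _ _ _ _ (upd rs k g, out) _ (N ^ EF) (23 * N ^ (EF + EG))) => //; first by lia.
apply: (@exle_seq _ _ _ _ (S g) _ (9 * N ^ (EF + EG)) (14 * N ^ (EF + EG))); first by lia.
  have -> : (upd rs k g, out) = S 0.
    by rewrite /S /s /= cats0 subn0; congr pair; upds.
  by apply: exleW loop; lia.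
apply: exle_clear; first by rewrite /S /upd /=; repeat (case: eqP => ?); lia.
by rewrite /S /= subnn; upds.
Qed.

(** The machine stores its input reversed, so programs see [rev x]. In all later constructions [inp]
    is therefore the reversed input. *)
Theorem outs_poly_time G : outs G -> poly_time_computable (fun x => G (rev x) [::]).
Proof.
move=> hG; have [c H] := hG [::] 1 isT isT; have [E {}H] := H 0.
apply: (@cmd_poly_time c _ E) => x.
have [|n le e] := H (rev x) (regs0 (size x)) [::] (size x).+2.
  by split; rewrite ?size_rev // => -[|r].
by exists (regs0 (size x)), n.
Qed.

(** * Arithmetic and Boolean operations derived from bounded sums *)

Lemma comp_mul F G : evaluable F -> evaluable G -> evaluable (fun inp e => F inp e * G inp e).
Proof.
move=> hF hG; apply: comp_ext (comp_sum hF (G := fun inp e _ => G inp e) (comp_behead hG)).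
by move=> inp e; rewrite sum_nat_const card_ord.
Qed.

Lemma comp_exp F n : evaluable F -> evaluable (fun inp e => F inp e ^ n).
Proof.
move=> hF; elim: n => [|n IH]; first exact: comp_const 1.
by apply: comp_ext (comp_mul hF IH) => inp e; rewrite expnS.
Qed.

Notation compb b := (evaluable (fun inp e => nat_of_bool (b inp e))).

Lemma compb_leq F G : evaluable F -> evaluable G -> compb (fun inp e => F inp e <= G inp e).
Proof. by move=> hF hG; apply: comp_ext (comp_eq0 (comp_sub hF hG)) => inp e. Qed.

Lemma comp_succ F : evaluable F -> evaluable (fun inp e => (F inp e).+1).
Proof.
by move=> hF; apply: comp_ext (comp_add hF (comp_const 1)) => inp e; rewrite addn1.
Qed.

Lemma compb_and a b : compb a -> compb b -> compb (fun inp e => a inp e && b inp e).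
Proof. by move=> ha hb; apply: comp_ext (comp_mul ha hb) => inp e; rewrite mulnb. Qed.

Lemma compb_neg a : compb a -> compb (fun inp e => ~~ a inp e).
Proof. by move=> ha; apply: comp_ext (comp_eq0 ha) => inp e; case: (a _ _). Qed.

Lemma compb_eq F G : evaluable F -> evaluable G -> compb (fun inp e => F inp e == G inp e).
Proof.
move=> hF hG; apply: comp_ext (compb_and (compb_leq hF hG) (compb_leq hG hF)) => inp e.
by rewrite eqn_leq.
Qed.

Lemma comp_if b F G : compb b -> evaluable F -> evaluable G ->
  evaluable (fun inp e => if b inp e then F inp e else G inp e).
Proof.
move=> hb hF hG; apply: comp_ext (comp_add (comp_mul hb hF) (comp_mul (compb_neg hb) hG)).
by move=> inp e; case: (b _ _) => /=; rewrite ?mul1n ?mul0n ?addn0.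
Qed.

Lemma sum_ltn m n : m <= n -> \sum_(i < n) (i < m) = m.
Proof.
move=> le; rewrite -(big_mkord xpredT (fun i => nat_of_bool (i < m))).
rewrite (big_cat_nat _ le) //= [X in _ + X]big_nat_cond [X in _ + X]big1 ?addn0.
  rewrite big_nat_cond (eq_bigr (fun _ => 1)) => [|i /andP[/andP[_ ->]]] //.
  by rewrite -big_nat_cond sum_nat_const_nat subn0 muln1.
by move=> i /andP[/andP[h _] _]; rewrite ltnNge h.
Qed.

(** The quotient counts the positive multiples of the divisor that do not exceed the dividend; the
    guard [0 < G inp e] reproduces [divn0]. *)
Lemma comp_div F G : evaluable F -> evaluable G -> evaluable (fun inp e => F inp e %/ G inp e).
Proof.
move=> hF hG; pose H inp e i := nat_of_bool ((0 < G inp e) && (i.+1 * G inp e <= F inp e)).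
have hH : evaluable (fun inp e => \sum_(i < F inp e) H inp e i).
  apply: comp_sum => //; apply: compb_and.
    exact: compb_leq (comp_const 1) (comp_behead hG).
  apply: compb_leq (comp_behead hF); apply: comp_mul (comp_behead hG).
  exact: comp_succ comp_head.
apply: comp_ext hH => inp e; rewrite /H; case: (posnP (G inp e)) => [->|gt] /=.
  by rewrite divn0 big1.
under eq_bigr do rewrite -leq_divRL //.
by apply: sum_ltn; apply: leq_div.
Qed.

Lemma comp_mod F G : evaluable F -> evaluable G -> evaluable (fun inp e => F inp e %% G inp e).
Proof.
move=> hF hG; apply: comp_ext (comp_sub hF (comp_mul (comp_div hF hG) hG)) => inp e.
by rewrite {1}(divn_eq (F inp e) (G inp e)) addKn.
Qed.

Lemma compb_odd F : evaluable F -> compb (fun inp e => odd (F inp e)).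
Proof.
move=> hF; apply: comp_ext (comp_mod hF (comp_const 2)) => inp e.
by rewrite modn2.
Qed.

Lemma compb_xor a b : compb a -> compb b -> compb (fun inp e => a inp e (+) b inp e).
Proof.
move=> ha hb; apply: comp_ext (compb_odd (comp_add ha hb)) => inp e.
by rewrite oddD !oddb.
Qed.

Lemma odd_sum n (b : nat -> bool) :
  odd (\sum_(i < n) b i) = \big[addb/false]_(i < n) b i.
Proof.
elim: n => [|n IH]; first by rewrite !big_ord0.
by rewrite !big_ord_recr /= oddD IH oddb.
Qed.

Lemma compb_xsum F b : evaluable F -> compb (fun inp e => b inp (behead e) (head 0 e)) ->
  compb (fun inp e => \big[addb/false]_(i < F inp e) b inp e i).
Proof.
move=> hF hb.
have := compb_odd (comp_sum hF (G := fun inp e i => nat_of_bool (b inp e i)) hb).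
by apply: comp_ext => inp e; rewrite odd_sum.
Qed.

Definition pow2 d := d == 2 ^ logn 2 d.

Lemma pow2_exp k : pow2 (2 ^ k).
Proof. by rewrite /pow2 pfactorK. Qed.

(** The absence of odd divisors above 1 is a bounded search, unlike the logarithm in [pow2]. *)
Lemma pow2E d : pow2 d = (0 < d) && (\sum_(e < d.+1) [&& 1 < e, odd e & e %| d] == 0).
Proof.
apply/idP/andP => [/eqP ->|[d0]]; rewrite sum_nat_eq0.
  split; first by rewrite expn_gt0.
  apply/forallP => -[e le] /=; rewrite eqb0; apply/and3P => -[e1 e2] /dvdn_pfactor -/(_ isT).
  by case=> [[|m]] _ E; rewrite E ?expnS ?oddM in e1 e2.
move=> /forallP h; apply/eqP.
have lt : d %/ 2 ^ logn 2 d < d.+1 by rewrite ltnS leq_div.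
have := h (Ordinal lt); rewrite /= eqb0 dvdn_div ?pfactor_dvdnn // andbT.
have -> : odd (d %/ 2 ^ logn 2 d).
  by rewrite -[odd _]negbK -dvdn2 dvdn_divRL ?pfactor_dvdnn // -expnS pfactor_dvdn // ltnn.
rewrite andbT -leqNgt => le1.
have : 0 < d %/ 2 ^ logn 2 d by rewrite divn_gt0 ?expn_gt0 // dvdn_leq ?pfactor_dvdnn.
move=> gt; have E : d %/ 2 ^ logn 2 d = 1 by lia.
by rewrite -[LHS](divnK (pfactor_dvdnn 2 d)) E mul1n.
Qed.

Lemma compb_pow2 F : evaluable F -> compb (fun inp e => pow2 (F inp e)).
Proof.
move=> hF; pose b d e := [&& 1 < e, odd e & e %| d].
have h : compb (fun inp e => (0 < F inp e) && (\sum_(i < (F inp e).+1) b (F inp e) i == 0)).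
  apply: compb_and; first exact: compb_leq (comp_const 1) hF.
  apply: comp_eq0; apply: (comp_sum (G := fun inp e i => nat_of_bool (b (F inp e) i))).
    exact: comp_succ.
  apply: compb_and; first exact: compb_leq (comp_const 2) comp_head.
  apply: compb_and; first exact: compb_odd comp_head.
  by apply: comp_eq0; apply: comp_mod; [apply: comp_behead|apply: comp_head].
by apply: comp_ext h => inp e; rewrite pow2E.
Qed.

Definition pow2s n := [seq d <- iota 0 n.+1 | pow2 d].

Lemma pow2_double d : pow2 d.*2 = pow2 d.
Proof.
case: (posnP d) => [->//|gt]; rewrite /pow2 -mul2n lognM // logn_prime // expnD expn1.
by rewrite eqn_pmul2l.
Qed.

Lemma pow2_odd d : odd d -> pow2 d -> d = 1.
Proof. by move=> + /eqP E; rewrite E; case: (logn 2 d) => // k; rewrite expnS oddM. Qed.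

(** Mirrors one step of [nat_bits_fuel]: the power 1 yields the lowest digit, the doubled powers the
    digits of the half. Both lists increase strictly, so comparing their members is enough. *)
Lemma pow2s_half n : 0 < n -> pow2s n = 1 :: map double (pow2s n./2).
Proof.
move=> n0; apply: (irr_sorted_eq ltn_trans ltnn).
- by apply: sorted_filter; [apply: ltn_trans|apply: iota_ltn_sorted].
- rewrite /= (path_sortedE ltn_trans); apply/andP; split.
    apply/allP => x /mapP[d]; rewrite mem_filter => /andP[/eqP -> _] ->.
    by rewrite -[1]/(2 ^ 0) -mul2n -expnS ltn_exp2l.
  rewrite sorted_map; apply: (@sub_sorted _ ltn); first by move=> a b /=; rewrite ltn_double.
  by apply: sorted_filter; [apply: ltn_trans|apply: iota_ltn_sorted].
move=> d; rewrite mem_filter mem_iota inE leq0n add0n ltnS.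
case: (boolP (odd d)) => od.
  have -> : (d \in map double (pow2s n./2)) = false.
    by apply/negbTE/mapP => -[d' _ E]; rewrite E odd_double in od.
  by rewrite orbF; apply/andP/eqP => [[/(pow2_odd od)]|->]; last split.
have [h ->] : exists h, d = h.*2.
  by exists d./2; have := odd_double_half d; rewrite (negbTE od).
rewrite pow2_double mem_map; last exact: double_inj.
rewrite mem_filter mem_iota leq0n add0n ltnS geq_half_double.
by have -> : (h.*2 == 1) = false by lia.
Qed.

(* The binary digits of a number n, lowest first, are the parities of n %/ d for the powers of
   two d <= n, in increasing order. *)
Lemma outs_enc_nat F : evaluable F -> outs (fun inp e => enc_nat (F inp e)).
Proof.
move=> hF.
pose G inp e d := if pow2 d then [:: true; odd (F inp e %/ d)] else [::].
have hG : outs (fun inp e => flatten [seq G inp e i | i <- iota 0 (F inp e).+1]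
    ++ [:: false; false]).
  apply: outs_cat; last exact: outs_cat (outs_bit false) (outs_bit false).
  apply: outs_flatten; first exact: comp_succ.
  apply: outs_if; [exact: compb_pow2 comp_head| |exact: outs_nil].
  apply: (outs_cat (outs_bit true)).
  pose b inp e := odd (F inp (behead e) %/ head 0 e).
  suff : outs (fun inp e => if b inp e then [:: true] else [:: false]).
    by apply: outs_ext => inp e; rewrite -/(b inp e); case: b.
  apply: outs_if; try exact: outs_bit.
  by apply: compb_odd; apply: comp_div; [apply: comp_behead|apply: comp_head].
apply: outs_ext hG => inp e; rewrite /enc_nat /enc_bits; congr (_ ++ _).
rewrite {}/G; move: (F inp e) => {hF inp e F} n; rewrite /nat_bits.
pose g m d := [:: true; odd (m %/ d)].
have -> : flatten [seq if pow2 i then g n i else [::] | i <- iota 0 n.+1] =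
    flatten [seq g n d | d <- pow2s n].
  by rewrite /pow2s; elim: (iota _ _) => //= d s ->; case: (pow2 d).
suff key f m : m <= f -> flatten [seq g m d | d <- pow2s m] =
    flatten [seq [:: true; b] | b <- nat_bits_fuel f m] by exact: key.
elim: f m => [|f IH] m le; first by have -> : m = 0 by lia.
rewrite /=; case: eqP => [->|/eqP m0] //.
rewrite pow2s_half ?lt0n //= -IH; last by lia.
rewrite /g /= divn1.
congr [:: _, _ & flatten _]; rewrite -map_comp; apply: eq_map => d /=.
by rewrite -muln2 mulnC divnMA divn2.
Qed.

(** * Binary codes with nonzero weights close to one half *)

Notation xsum n b := (\big[addb/false]_(i < n) b i).
Definition wt n (b : nat -> bool) := \sum_(i < n) b i.

Section BigMul.
Variables (R : Type) (idx : R) (op : Monoid.com_law idx).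

(** Pairs are coded as numbers [a + m * b] throughout. Together with [digit0] this replaces product
    types and keeps all indices evaluable. *)
Lemma big_ord_mul m n (F : nat -> R) :
  \big[op/idx]_(p < m * n) F p = \big[op/idx]_(a < m) \big[op/idx]_(b < n) F (a + m * b).
Proof.
elim: n => [|n IH].
  by rewrite muln0 big_ord0 big1 // => i _; rewrite big_ord0.
rewrite mulnSr big_split_ord /= IH -big_split /=.
by apply: eq_bigr => i _; rewrite big_ord_recr /= addnC.
Qed.
End BigMul.

Definition sum_ord_mul := @big_ord_mul nat 0 addn.

Lemma digit0 m a b : a < m -> (a + m * b) %% m = a /\ (a + m * b) %/ m = b.
Proof.
move=> lt; have m0 : 0 < m by lia.
by rewrite addnC mulnC modnMDl modn_small // divnMDl // divn_small ?addn0.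
Qed.

(** Bernoulli's inequality for [1 + 1 / a], cleared of denominators. It supplies both amplification
    exponents: [t] for 32 against 31 and [tau] for 5 against 4. *)
Lemma expS_gt c a : exists t, c * a ^ t <= a.+1 ^ t.
Proof.
case: a => [|a]; first by exists 1; rewrite exp0n // muln0.
have key t : a.+1 ^ t * (a.+1 + t) <= a.+2 ^ t * a.+1.
  elim: t => [|t IH]; first by rewrite !expn0 addn0 leqnn.
  rewrite !expnS; have : a.+2 * (a.+1 ^ t * (a.+1 + t)) <= a.+2 * (a.+2 ^ t * a.+1).
    by rewrite leq_mul.
  rewrite -[X in _ -> _ <= X]mulnA; apply: leq_trans.
  rewrite (mulnC a.+1) -mulnA (mulnCA a.+2) leq_mul //; nia.
exists (c * a.+1); have := key (c * a.+1); set X := a.+1 ^ _; set Y := a.+2 ^ _ => h.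
have : X * (a.+1 * c) <= Y * a.+1.
  by apply: leq_trans h; rewrite leq_mul // (mulnC c) leq_addl.
by rewrite mulnCA mulnC leq_pmul2r // mulnC.
Qed.

Lemma leq_expW m n t : m <= n -> m ^ t <= n ^ t.
Proof. by case: t => // t le; rewrite leq_exp2r. Qed.

Lemma wtE n b : wt n b = #|[pred i : 'I_n | b i]|.
Proof. by rewrite /wt -sum1_card [RHS]big_mkcond; apply: eq_bigr => i _; rewrite inE; case: (b i). Qed.

(* The map a |-> (quotient, remainder / dl) of v + a dl is injective on the a counted here,
   and takes at most (dl + 1) (m / dl + 1) values. *)
Lemma hash_pair M m v dl : 0 < dl -> dl < m -> m <= M -> v < m ->
  wt M (fun a => (v + a * dl) %% M < m) <= 4 * m.
Proof.
move=> d0 dm mM vm; have M0 : 0 < M by lia.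
rewrite wtE; pose f (a : 'I_M) : 'I_dl.+1 * 'I_(m %/ dl).+1 :=
  (inord ((v + a * dl) %/ M), inord ((v + a * dl) %% M %/ dl)).
(* Since [0 < dl < m], passing to the successor at most doubles each factor, whence the 4. *)
apply: (@leq_trans (dl.+1 * (m %/ dl).+1)); last first.
  have := leq_divM m dl; have := leq_div m dl; nia.
have -> : dl.+1 * (m %/ dl).+1 = #|{: 'I_dl.+1 * 'I_(m %/ dl).+1}|.
  by rewrite card_prod !card_ord.
apply: (leq_card_in f) => a1 a2; rewrite !inE => h1 h2 [E1 E2]; apply: val_inj => /=.
have b1 (a : 'I_M) : (v + a * dl) %/ M < dl.+1.
  rewrite ltnS -ltnS ltn_divLR //; have : a.+1 * dl <= M * dl by rewrite leq_mul.
  by rewrite !mulSn (mulnC M); lia.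
have b2 r : r < m -> r %/ dl < (m %/ dl).+1 by move=> h; rewrite ltnS leq_div2r // ltnW.
have {}E1 : (v + a1 * dl) %/ M = (v + a2 * dl) %/ M.
  by have := congr1 (@nat_of_ord _) E1; rewrite !inordK.
have {}E2 : (v + a1 * dl) %% M %/ dl = (v + a2 * dl) %% M %/ dl.
  by have := congr1 (@nat_of_ord _) E2; rewrite !inordK // b2.
have e1 := divn_eq (v + a1 * dl) M; have e2 := divn_eq (v + a2 * dl) M.
have e3 := divn_eq ((v + a1 * dl) %% M) dl; have e4 := divn_eq ((v + a2 * dl) %% M) dl.
have e5 := ltn_pmod ((v + a1 * dl) %% M) d0; have e6 := ltn_pmod ((v + a2 * dl) %% M) d0.
rewrite E1 e3 in e1; rewrite e4 in e2; rewrite E2 in e1.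
move: e1 e2 e5 e6; set q := _ * M; set s := _ %/ dl * dl.
move: (_ %% dl) (_ %% dl) => r1 r2 e1 e2 e5 e6.
(* Equal quotients and equal blocks of length [dl] put the two values less than [dl] apart, while
   distinct multiples of [dl] differ by at least [dl]. *)
case: (ltngtP a1 a2) => // lt; exfalso.
  by have : a1.+1 * dl <= a2 * dl by [rewrite leq_mul]; rewrite mulSn; lia.
by have : a2.+1 * dl <= a1 * dl by [rewrite leq_mul]; rewrite mulSn; lia.
Qed.

Lemma sum_shift M c (F : nat -> nat) : 0 < M ->
  \sum_(b < M) F ((c + b) %% M) = \sum_(b < M) F b.
Proof.
move=> M0; pose h (b : 'I_M) : 'I_M := Ordinal (ltn_pmod (c + b) M0).
have hi : injective h.
  move=> b1 b2 /(congr1 val) /= /eqP; rewrite eqn_modDl !modn_small // => /eqP.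
  exact: val_inj.
by rewrite [RHS](reindex_inj hi).
Qed.

Definition hashed (M m a b i : nat) : bool := (a * i + b) %% M < m.

Lemma hash_single M m i : 0 < M -> m <= M ->
  \sum_(a < M) \sum_(b < M) hashed M m a b i = M * m.
Proof.
move=> M0 mM; under eq_bigr => a _ do
  rewrite (sum_shift (a * i) (fun v => nat_of_bool (v < m)) M0) sum_ltn //.
by rewrite sum_nat_const card_ord.
Qed.

(** With [v = (a * i + b) %% M] in place of [b], the second event says that [v + a * (j - i)] falls
    below [m] modulo [M], and [hash_pair] counts this over [a]. Exact pairwise independence would
    give [m * m]; the factor 4 is the price of a modulus that need not be prime. *)
Lemma hash_double M m i j : 0 < m -> m <= M -> i != j -> i < m -> j < m ->
  \sum_(a < M) \sum_(b < M) (hashed M m a b i && hashed M m a b j) <= 4 * m * m.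
Proof.
move=> m0 mM ne im jm; have M0 : 0 < M by lia.
wlog lt : i j ne im jm / i < j.
  move=> H; case: (ltngtP i j) => [|lt|E]; first exact: H.
    under eq_bigr => a _ do under eq_bigr => b _ do rewrite andbC.
    by apply: H; rewrite // eq_sym.
  by rewrite E eqxx in ne.
have E a b : hashed M m a b j = (((a * i + b) %% M + a * (j - i)) %% M < m).
  rewrite /hashed modnDml; congr leq; congr S; congr (_ %% _).
  by rewrite mulnBr; have : a * i <= a * j by [rewrite leq_mul // ltnW]; lia.
under eq_bigr => a _ do under eq_bigr => b _ do rewrite E.
under eq_bigr => a _ do rewrite
  (sum_shift (a * i) (fun v => nat_of_bool ((v < m) && ((v + a * (j - i)) %% M < m))) M0).
rewrite exchange_big /=; apply: leq_trans (_ : \sum_(v < M) (v < m) * (4 * m) <= _).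
  apply: leq_sum => v _; case: (ltnP v m) => vm /=; last by rewrite big1.
  by rewrite mul1n; apply: hash_pair => //; lia.
by rewrite -big_distrl /= sum_ltn // mulnC.
Qed.

(* Bonferroni: averaging [odd n >= 2 n - n ^ 2] bounds the parity by the first two moments. *)
Lemma odd_ge n : 2 * n <= n * n + odd n.
Proof. by case: n => [|[|n]] //; nia. Qed.

Lemma wt_sqr N (b : nat -> bool) :
  wt N b * wt N b = \sum_(i < N) \sum_(j < N) (b i && b j).
Proof.
rewrite /wt big_distrlr /=; apply: eq_bigr => i _; apply: eq_bigr => j _.
by rewrite mulnb.
Qed.

Section Isolation.
Variables (M m N : nat) (x : nat -> bool).
Hypotheses (m0 : 0 < m) (mM : m <= M) (Nm : N <= m).

Let T a b := wt N (fun i => x i && hashed M m a b i).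

Lemma sum_T : \sum_(a < M) \sum_(b < M) T a b = wt N x * (M * m).
Proof.
have M0 : 0 < M by lia.
rewrite /T /wt; under eq_bigr => a _ do rewrite exchange_big /=.
rewrite exchange_big /= big_distrl /=; apply: eq_bigr => i _.
case: (x i) => /=; last by rewrite mul0n big1 // => a _; rewrite big1.
by rewrite mul1n hash_single.
Qed.

(** In the expanded square the diagonal gives the first term by [hash_single], the other pairs the
    second by [hash_double], which applies because [N <= m] keeps all positions below [m]. *)
Lemma sum_T2 : \sum_(a < M) \sum_(b < M) T a b * T a b <=
  wt N x * (M * m) + wt N x * wt N x * (4 * m * m).
Proof.
have M0 : 0 < M by lia.
under eq_bigr => a _ do under eq_bigr => b _ do rewrite /T wt_sqr.
under eq_bigr => a _ do rewrite exchange_big /=.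
rewrite exchange_big /=.
under eq_bigr => i _ do (under eq_bigr => a _ do rewrite exchange_big /=).
under eq_bigr => i _ do rewrite exchange_big /=.
rewrite wt_sqr {1}/wt !big_distrl -big_split /=; apply: leq_sum => i _.
rewrite big_distrl /=.
case xi: (x i); last by rewrite !big1 // => j _; rewrite big1 // => a _; rewrite big1.
rewrite mul1n (bigD1 i) //= leq_add //.
  under eq_bigr => a _ do under eq_bigr => b _ do rewrite xi andbb /=.
  by rewrite hash_single.
rewrite [X in _ <= X](bigD1 i) //= -[X in X <= _]add0n leq_add //.
apply: leq_sum => j ne; case xj: (x j) => /=; last first.
  by rewrite big1 // => a _; rewrite big1 // => b _; rewrite andbF.
rewrite mul1n; apply: hash_double => //.
- by rewrite eq_sym.
- by have := ltn_ord i; lia.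
- by have := ltn_ord j; lia.
Qed.

Lemma isolation : wt N x * (M * m) <= \sum_(a < M) \sum_(b < M) odd (T a b) +
  wt N x * wt N x * (4 * m * m).
Proof.
have : 2 * (\sum_(a < M) \sum_(b < M) T a b) <=
    \sum_(a < M) \sum_(b < M) T a b * T a b + \sum_(a < M) \sum_(b < M) odd (T a b).
  rewrite big_distrr -big_split /=; apply: leq_sum => a _.
  rewrite big_distrr -big_split /=; apply: leq_sum => b _.
  exact: odd_ge.
by rewrite sum_T; have := sum_T2; lia.
Qed.
End Isolation.

Lemma odd_wt n b : odd (wt n b) = xsum n b.
Proof. exact: odd_sum. Qed.

Section Code.
Variables (N J : nat).
Let H := 2 ^ J.
Let M := H * N.
Hypotheses (N0 : 0 < N) (NH : 16 * N <= H).

Lemma isolating_level x : 0 < wt N x -> exists2 j, j < J &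
  M * M <= 32 * \sum_(a < M) \sum_(b < M) xsum N (fun i => (((a * i + b) %% M) * 2 ^ j < M) && x i).
Proof.
set k := wt N x => k0.
have kN : k <= N.
  apply: leq_trans (_ : \sum_(i < N) 1 <= _); last by rewrite sum1_card card_ord.
  by apply: leq_sum => i _; case: (x i).
(* A density between [1 / (16 k)] and [1 / (8 k)]: the second moment term of [isolation] is then at
   most half of the first, and the remaining half is still at least [M * M / 32]. The hypothesis
   [NH] provides a level that fine. *)
pose j := up_log 2 (8 * k).
have d1 : 8 * k <= 2 ^ j by apply: up_logP.
have j0 : 0 < j by rewrite /j up_log_gt0; lia.
have d2 : 2 ^ j < 16 * k.
  have : 2 ^ j.-1 < 8 * k by apply: up_log_gtn => //; lia.
  by rewrite -{2}(prednK j0) expnS; lia.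
have jJ : j < J by rewrite -(@ltn_exp2l 2) //; rewrite -/H; lia.
exists j => //; set d := 2 ^ j in d1 d2 *.
pose m := 2 ^ (J - j) * N.
have EM : M = d * m by rewrite /M /H /m mulnA -expnD subnKC // ltnW.
have d0 : 0 < d by rewrite expn_gt0.
have e0 : 0 < 2 ^ (J - j) by rewrite expn_gt0.
have Nm : N <= m by rewrite /m leq_pmull.
have m0 : 0 < m by lia.
have mM : m <= M by rewrite EM leq_pmull.
have := isolation x m0 mM Nm; rewrite -/k.
have E a b : odd (wt N (fun i => x i && hashed M m a b i)) =
    xsum N (fun i => (((a * i + b) %% M) * d < M) && x i).
  rewrite odd_wt; apply: eq_bigr => i _; rewrite andbC /hashed; congr (_ && _).
  by rewrite [_ * d]mulnC -[in LHS](ltn_pmul2l d0) -EM.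
under eq_bigr => a _ do under eq_bigr => b _ do rewrite E.
set S := \sum_(a < M) _ => h.
have h1 : k * k * (4 * m * m) * 2 <= k * (M * m).
  rewrite EM; have : 8 * k * (k * m * m) <= d * (k * m * m) by rewrite leq_mul.
  by lia.
have h2 : M * M <= 16 * (k * (M * m)).
  rewrite {2}EM; have : d * (m * M) <= 16 * k * (m * M) by rewrite leq_mul // ltnW.
  by lia.
lia.
Qed.

(** The Hadamard codeword of the [J] bits [h], at position [mu]. *)
Definition mask_bit (h : nat -> bool) mu := xsum J (fun j => odd (mu %/ 2 ^ j) && h j).

(** The code indexes its levels by powers of two, because [2 ^ j] with varying [j] is not covered by
    [comp_exp]; the analysis goes back to exponents here. *)
Lemma xsum_pow2 n (g : nat -> bool) :
  xsum (2 ^ n) (fun d => pow2 d && g d) = xsum n (fun j => g (2 ^ j)).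
Proof.
elim: n => [|n IH]; first by rewrite big_ord0 big_ord1.
rewrite big_ord_recr /= -IH expnS mul2n -addnn big_split_ord /=; congr addb.
rewrite (bigD1 (Ordinal (expn_gt0 2 n : 0 < 2 ^ n))) //= addn0 pow2_exp /=.
rewrite big1 ?addbF // => i; rewrite -val_eqE /= => i0.
suff -> : pow2 (2 ^ n + i) = false by [].
apply/negbTE/negP => /eqP E; set k := logn _ _ in E.
have lt1 : 2 ^ n < 2 ^ k by rewrite -E; lia.
have lt2 : 2 ^ k < 2 ^ n.+1 by rewrite -E expnS; have := ltn_ord i; lia.
by move: lt1 lt2; rewrite !ltn_exp2l //; lia.
Qed.

(** Induction on the lowest mask bit: if [h 0] holds, exactly one of its two values gives an odd
    sum, whatever the other bits are; otherwise it has no influence. *)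
Lemma wt_mask h : 2 * wt (2 ^ J) (mask_bit h) = has h (iota 0 J) * 2 ^ J.
Proof.
rewrite /mask_bit /wt; elim: J h => [|n IH] h.
  by rewrite big_ord1 big_ord0.
rewrite expnS (sum_ord_mul 2 (2 ^ n)
  (fun mu => nat_of_bool (xsum n.+1 (fun j => odd (mu %/ 2 ^ j) && h j)))) exchange_big /=.
have E (b : 'I_(2 ^ n)) : \sum_(a < 2) xsum n.+1 (fun j => odd ((a + 2 * b) %/ 2 ^ j) && h j) =
   if h 0 then 1 else 2 * xsum n (fun j => odd (b %/ 2 ^ j) && h j.+1).
  have E a : a < 2 -> xsum n.+1 (fun j => odd ((a + 2 * b) %/ 2 ^ j) && h j) =
      (odd a && h 0) (+) xsum n (fun j => odd (b %/ 2 ^ j) && h j.+1).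
    move=> lt; rewrite big_ord_recl /= expn0 divn1 oddD mul2n odd_double addbF.
    congr addb; apply: eq_bigr => j _; rewrite /bump /= add1n expnS divnMA -mul2n.
    by rewrite (digit0 _ lt).2.
  under eq_bigr => a _ do rewrite E //.
  by rewrite !big_ord_recl big_ord0 /=; case: (h 0); case: (\big[_/_]_(i < n) _).
under eq_bigr => b _ do rewrite E.
case h0: (h 0) => /=.
  by rewrite sum_nat_const card_ord muln1 mul1n.
rewrite -big_distrr /= (IH (fun j => h j.+1)) mulnCA.
by rewrite (iotaDl 1 0) has_map.
Qed.

(* A position p encodes the hash parameters a, b < M and a mask mu < H; the powers of two d < H
   index both the bits of the mask and the densities 1 / d of the hash. *)
Definition code1 p i := xsum H (fun d => pow2 d && (odd ((p %/ (M * M)) %/ d) &&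
  (((p %% M * i + (p %/ M) %% M) %% M) * d < M))).
Definition cw (c : nat -> nat -> bool) x p := xsum N (fun i => c p i && x i).

Let P := M * (M * H).
Let hx x a b j := xsum N (fun i => (((a * i + b) %% M) * 2 ^ j < M) && x i).

Lemma cw_code1 x a b mu : a < M -> b < M ->
  cw code1 x (a + M * (b + M * mu)) = mask_bit (hx x a b) mu.
Proof.
move=> aM bM; have [e1 e2] := digit0 (b + M * mu) aM; have [e3 e4] := digit0 mu bM.
rewrite /cw /code1 /H divnMA e1 e2 e3 e4.
under eq_bigr => i _ do rewrite
  (xsum_pow2 J (fun d => odd (mu %/ d) && ((a * i + b) %% M * d < M))) big_distrl /=.
rewrite exchange_big /=; apply: eq_bigr => j _; rewrite /hx big_distrr /=.
by apply: eq_bigr => i _; rewrite andbA.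
Qed.

Lemma wt_code1 x : 2 * wt P (cw code1 x) =
  \sum_(a < M) \sum_(b < M) has (hx x a b) (iota 0 J) * H.
Proof.
rewrite /wt /P (sum_ord_mul _ _ (fun p => nat_of_bool (cw code1 x p))) big_distrr; apply: eq_bigr => a _ /=.
rewrite (sum_ord_mul _ _ (fun p => nat_of_bool (cw code1 x (a + M * p)))) big_distrr;
  apply: eq_bigr => b _ /=.
under eq_bigr => mu _ do rewrite cw_code1 //.
exact: wt_mask.
Qed.

Lemma code1_le x : 2 * wt P (cw code1 x) <= P.
Proof.
rewrite wt_code1; apply: leq_trans (_ : \sum_(a < M) \sum_(b < M) H <= _); last first.
  by rewrite !sum_nat_const !card_ord.
by do 2!(apply: leq_sum => ? _); rewrite -[X in _ <= X]mul1n leq_mul // leq_b1.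
Qed.

(** At an isolating level one hash in 32 makes some bit of [hx] true, and half of the masks detect
    it. *)
Lemma code1_ge x : 0 < wt N x -> P <= 64 * wt P (cw code1 x).
Proof.
move=> /isolating_level[j jJ h]; rewrite -[64]/(32 * 2) -mulnA wt_code1 /P mulnA.
apply: leq_trans (leq_mul h (leqnn H)) _; rewrite -mulnA leq_mul // big_distrl /=.
apply: leq_sum => a _; rewrite big_distrl; apply: leq_sum => b _ /=; rewrite leq_mul //.
case E: (\big[_/_]_(i < N) _) => //; suff -> : has (hx x a b) (iota 0 J) by [].
by apply/hasP; exists j; rewrite ?mem_iota.
Qed.

Fixpoint codeT t p i := if t is t'.+1 then code1 (p %% P) i (+) codeT t' (p %/ P) i else false.

(* P - 2 w is the bias of a word of weight w; it is multiplicative under XOR of positions. *)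
Lemma wt_codeT t x : 2 * wt (P ^ t) (cw (codeT t) x) + (P - 2 * wt P (cw code1 x)) ^ t = P ^ t.
Proof.
elim: t => [|t IH].
  by rewrite /wt /cw big_ord1 big1.
have E a b : a < P -> cw (codeT t.+1) x (a + P * b) = cw code1 x a (+) cw (codeT t) x b.
  move=> aP; have [e1 e2] := digit0 b aP; rewrite /cw -big_split; apply: eq_bigr => i _ /=.
  by rewrite e1 e2; case: (x i); rewrite ?andbT ?andbF.
have := code1_le x; set w1 := wt P (cw code1 x) in IH *; set wt_ := wt _ _ in IH => le1.
have -> : wt (P ^ t.+1) (cw (codeT t.+1) x) = w1 * (P ^ t - wt_) + (P - w1) * wt_.
  rewrite /wt expnS (sum_ord_mul _ _ (fun p => nat_of_bool (cw (codeT t.+1) x p))).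
  have Ea (a : 'I_P) : \sum_(b < P ^ t) cw (codeT t.+1) x (a + P * b) =
      if cw code1 x a then P ^ t - wt_ else wt_.
    under eq_bigr => b _ do rewrite E //.
    case: (cw code1 x a) => //=.
    apply: (@addnI wt_); rewrite subnKC; last by move: IH; lia.
    rewrite /wt_ /wt -big_split /= -[RHS]card_ord -[RHS]sum1_card; apply: eq_bigr => b _.
    by case: (cw _ _ _).
  under eq_bigr => a _ do rewrite Ea.
  have -> : P - w1 = \sum_(a < P) ~~ cw code1 x a.
    apply: (@addnI w1); rewrite subnKC; last by lia.
    rewrite /w1 /wt -big_split /= -[LHS]card_ord -[LHS]sum1_card; apply: eq_bigr => a _.
    by case: (cw _ _ _).
  rewrite /w1 /wt !big_distrl -big_split; apply: eq_bigr => a _ /=.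
  by case: (cw _ _ _); rewrite ?mul1n ?mul0n ?addn0.
rewrite !expnS -IH; move: (_ ^ t) => X.
have [D ->] : exists D, P = 2 * w1 + D by exists (P - 2 * w1); lia.
have -> : 2 * w1 + D - 2 * w1 = D by lia.
have -> : 2 * w1 + D - w1 = w1 + D by lia.
have -> : 2 * wt_ + X - wt_ = wt_ + X by lia.
by nia.
Qed.

(** By [code1_ge] the bias is at most 31/32 of the length, and its [t]-th power at most one twelfth,
    so the relative weight lies between 11/24 and 1/2. *)
Lemma balanced t x : 12 * 31 ^ t <= 32 ^ t -> 0 < wt N x ->
  2 * wt (P ^ t) (cw (codeT t) x) <= P ^ t /\
  11 * P ^ t <= 24 * wt (P ^ t) (cw (codeT t) x).
Proof.
move=> ht x0; have := wt_codeT t x; set w := wt _ _; set D := _ - _ => E.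
split; first by lia.
have h1 : 32 * D <= 31 * P by have := code1_ge x0; rewrite /D; lia.
have h2 : 32 ^ t * D ^ t <= 31 ^ t * P ^ t by rewrite -!expnMn leq_expW.
have h3 : 32 ^ t * (12 * D ^ t) <= 32 ^ t * P ^ t.
  rewrite mulnCA; apply: leq_trans (leq_mul (leqnn 12) h2) _.
  by rewrite mulnA leq_mul.
have : 12 * D ^ t <= P ^ t by rewrite leq_pmul2l ?expn_gt0 in h3.
lia.
Qed.
End Code.

(** * The weight gap between rank one and higher rank, and its tensor powers *)

Definition xsum_ord_mul := @big_ord_mul bool false addb.

Lemma wt_gt0P n (b : nat -> bool) : reflect (exists2 i, i < n & b i) (0 < wt n b).
Proof.
apply: (iffP idP) => [|[i lt bi]].
  rewrite lt0n sum_nat_eq0 => /forallPn[i]; rewrite /= eqb0 negbK => bi.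
  by exists (i : nat).
by rewrite /wt (bigD1 (Ordinal lt)) //= bi.
Qed.

Section Rank.
Variables (N P d : nat) (C : nat -> nat -> bool).
Hypothesis N0 : 0 < N.
Hypothesis Cd : forall x, 0 < wt N x -> d <= wt P (cw N C x).

(** The tensor square of [C], acting on rows and columns of the matrix with entries
    [X (i + N * j)]. *)
Definition sqcode p u := C (p %% P) (u %% N) && C (p %/ P) (u %/ N).

Lemma cw_sqcode X p1 p2 : p1 < P ->
  cw (N * N) sqcode X (p1 + P * p2) =
  cw N C (fun i => cw N C (fun j => X (i + N * j)) p2) p1.
Proof.
move=> lt; have [e1 e2] := digit0 p2 lt; rewrite /cw /sqcode e1 e2.
rewrite (xsum_ord_mul N N (fun u => C p1 (u %% N) && C p2 (u %/ N) && X u)).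
apply: eq_bigr => i _; rewrite big_distrr /=; apply: eq_bigr => j _.
by have [-> ->] := digit0 j (ltn_ord i); rewrite andbA.
Qed.

Lemma wt_sqcode X : wt (P * P) (cw (N * N) sqcode X) =
  \sum_(p2 < P) wt P (cw N C (fun i => cw N C (fun j => X (i + N * j)) p2)).
Proof.
rewrite /wt (sum_ord_mul P P (fun p => nat_of_bool (cw (N * N) sqcode X p))).
rewrite exchange_big; apply: eq_bigr => p2 _; apply: eq_bigr => p1 _ /=.
by rewrite cw_sqcode.
Qed.

Definition sqvec (x : nat -> bool) u := x (u %% N) && x (u %/ N).

Lemma cw_ext M c (x y : nat -> bool) p : (forall i, i < M -> x i = y i) -> cw M c x p = cw M c y p.
Proof. by move=> E; apply: eq_bigr => i _; rewrite E. Qed.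

Lemma wt_ext M (x y : nat -> bool) : (forall i, i < M -> x i = y i) -> wt M x = wt M y.
Proof. by move=> E; apply: eq_bigr => i _; rewrite E. Qed.

Lemma wt_sqvec x : wt (P * P) (cw (N * N) sqcode (sqvec x)) = wt P (cw N C x) ^ 2.
Proof.
rewrite wt_sqcode -mulnn {2}/wt big_distrl /=; apply: eq_bigr => p2 _.
have E i : i < N -> cw N C (fun j => sqvec x (i + N * j)) p2 = cw N C x p2 && x i.
  move=> lt; rewrite /cw big_distrl /=; apply: eq_bigr => j _; rewrite /sqvec.
  by have [-> ->] := digit0 j lt; rewrite -andbA; congr andb; rewrite andbC.
have -> : wt P (cw N C (fun i => cw N C (fun j => sqvec x (i + N * j)) p2)) =
   wt P (fun p => cw N C x p2 && cw N C x p).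
  apply: wt_ext => p _; rewrite (cw_ext _ _ E) /cw big_distrr /=.
  by apply: eq_bigr => i _; rewrite andbCA.
case: (cw N C x p2) => /=; rewrite ?mul1n ?mul0n //.
by rewrite /wt big1.
Qed.

(* Two distinct nonzero rows r, r' of X also give the nonzero r + r', and a coordinate where
   one of their three codewords is nonzero is a coordinate for exactly two of them. *)
Lemma rank_gap X :
  (forall i j, i < N -> j < N -> X (i + N * j) = X (j + N * i)) ->
  0 < wt (N * N) X ->
  ~ (exists x, forall i j, i < N -> j < N -> X (i + N * j) = x i && x j) ->
  3 * (d * d) <= 2 * wt (P * P) (cw (N * N) sqcode X).
Proof.
move=> sym X0 nr1; pose r i j := X (i + N * j).
have [i1 l1 r1] : exists2 i, i < N & 0 < wt N (r i).
  move/wt_gt0P: X0 => [u lt Xu].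
  exists (u %% N); first by rewrite ltn_mod.
  apply/wt_gt0P; exists (u %/ N); first by rewrite ltn_divLR.
  by rewrite /r addnC mulnC -divn_eq.
have [i2 l2 [r2 r12]] : exists2 i, i < N &
    0 < wt N (r i) /\ 0 < wt N (fun j => r i1 j (+) r i j).
  case: (boolP [exists i : 'I_N, (0 < wt N (r i)) && (0 < wt N (fun j => r i1 j (+) r i j))]).
    by move=> /existsP[i /andP[h1 h2]]; exists (i : nat).
  (* Otherwise all nonzero rows coincide, and by symmetry [X] is the square of the indicator of its
     nonzero rows. *)
  move=> /existsPn h; case: nr1; exists (fun i => 0 < wt N (r i)).
  have h' i : i < N -> 0 < wt N (r i) -> forall j, j < N -> r i j = r i1 j.
    move=> lt ri j ltj; have := h (Ordinal lt); rewrite /= ri /= => /wt_gt0P h0.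
    apply/eqP/negbNE/negP => ne; apply: h0; exists j => //.
    by move: ne; case: (r i j); case: (r i1 j).
  have rE i j : i < N -> j < N -> r i j = (0 < wt N (r i)) && r i1 j.
    move=> li lj; case: (boolP (0 < wt N (r i))) => [ri|/wt_gt0P ri]; first exact: h'.
    by apply/negP => rij; apply: ri; exists j.
  (* If [r i1 j] holds, row [j] is nonzero by symmetry, hence equal to row [i1], and its entry at
     [i1] is true. *)
  have r11 : r i1 i1.
    have [j lj rj] := wt_gt0P _ _ r1.
    by move: rj; rewrite {1}/r sym // -/(r j i1) rE // => /andP[].
  move=> i j li lj; rewrite -/(r i j) rE //; congr andb.
  by rewrite /r sym // -/(r j i1) rE // r11 andbT.
rewrite wt_sqcode.
pose W i p := cw N C (r i) p.
have W12 p : cw N C (fun j => r i1 j (+) r i2 j) p = W i1 p (+) W i2 p.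
  by rewrite /W /cw -big_split; apply: eq_bigr => j _ /=; rewrite andb_addr.
have step p : W i1 p || W i2 p -> d <= wt P (cw N C (fun i => W i p)).
  by move=> h; apply: Cd; apply/wt_gt0P; case/orP: h; [exists i1|exists i2].
apply: (@leq_trans (2 * \sum_(p < P) (W i1 p || W i2 p) * d)); last first.
  rewrite leq_mul //; apply: leq_sum => p _.
  by case: orP => // /orP /step; rewrite mul1n.
rewrite -big_distrl mulnA mulnA leq_mul //=.
have := leq_add (leq_add (Cd r1) (Cd r2)) (Cd r12).
have -> : d + d + d = 3 * d by lia.
move=> /leq_trans; apply; rewrite /wt -!big_split big_distrr /=; apply: leq_sum => p _.
by rewrite W12 -/(W i1 p) -/(W i2 p); case: (W i1 p); case: (W i2 p).
Qed.
End Rank.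

(* Pairs, and tuples of length t, are numbers in mixed radix, least significant entry first. *)
Section Tensor.
Variables (I P R : nat) (K q : nat -> nat -> bool).
Hypothesis I0 : 0 < I.

Fixpoint tcode t p u := if t is t'.+1 then K (p %% P) (u %% I) && tcode t' (p %/ P) (u %/ I)
  else true.
Fixpoint tvec (y : nat -> bool) t u := if t is t'.+1 then y (u %% I) && tvec y t' (u %/ I) else true.

Definition sat (y : nat -> bool) := forall c, c < R -> cw I q y c = false.
(** Each fibre in direction [l], with the lower digits [lo] and the upper digits [hi] frozen, solves
    the constraints: this is membership in the [t]-th tensor power of the solution space. *)
Definition tsat t (Z : nat -> bool) := forall l c lo hi, l < t -> c < R -> lo < I ^ l ->
  hi < I ^ (t - l.+1) -> cw I q (fun i => Z (lo + I ^ l * (i + I * hi))) c = false.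

Lemma cw_tcode t Z p p' : p < P -> cw (I ^ t.+1) (tcode t.+1) Z (p + P * p') =
  cw (I ^ t) (tcode t) (fun u => cw I K (fun i => Z (i + I * u)) p) p'.
Proof.
move=> lt; have [e1 e2] := digit0 p' lt; rewrite /cw /= e1 e2 expnS.
rewrite (xsum_ord_mul I (I ^ t) (fun u => K p (u %% I) && tcode t p' (u %/ I) && Z u)).
rewrite exchange_big; apply: eq_bigr => u _ /=; rewrite big_distrr; apply: eq_bigr => i _ /=.
by have [-> ->] := digit0 u (ltn_ord i); rewrite andbCA andbA.
Qed.

(** Minimum distance is multiplicative. A nonzero fibre in slot 0 has at least [d] ones in its
    codeword, and contracting slot 0 at each of these positions leaves a nonzero tensor with one
    slot less. All fibres involved satisfy [sat], so the bound [d] is only asked of solutions. *)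
Lemma tensor_gap d t Z :
  (forall y, sat y -> 0 < wt I y -> d <= wt P (cw I K y)) ->
  tsat t Z -> 0 < wt (I ^ t) Z -> d ^ t <= wt (P ^ t) (cw (I ^ t) (tcode t) Z).
Proof.
move=> Hd; elim: t Z => [|t IH] Z hs Z0.
  by rewrite /wt !big_ord1 /cw big_ord1 /= in Z0 *.
pose Y p u := cw I K (fun i => Z (i + I * u)) p.
have [u lu zu] : exists2 u, u < I ^ t & 0 < wt I (fun i => Z (i + I * u)).
  move/wt_gt0P: Z0 => [u lt Zu]; exists (u %/ I).
    by rewrite ltn_divLR // mulnC -expnS.
  apply/wt_gt0P; exists (u %% I); first by rewrite ltn_mod.
  by rewrite addnC mulnC -divn_eq.
have su : sat (fun i => Z (i + I * u)).
  move=> c lc; have := hs 0 c 0 u isT lc isT; rewrite subn1 => /(_ lu).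
  by rewrite expn0 => E; rewrite -[RHS]E; apply: cw_ext => i _; rewrite add0n mul1n.
rewrite expnS; apply: leq_trans (leq_mul (Hd _ su zu) (leqnn _)) _.
rewrite {2}/wt expnS (sum_ord_mul P (P ^ t) (fun p => nat_of_bool (cw (I ^ t.+1) (tcode t.+1) Z p))).
rewrite /wt big_distrl /=; apply: leq_sum => p _.
case E: (cw I K _ p); rewrite ?mul0n // mul1n.
have : d ^ t <= wt (P ^ t) (cw (I ^ t) (tcode t) (Y p)).
  apply: IH; last by apply/wt_gt0P; exists u.
  (* The contraction is a sum of slices of [Z], and each slice meets the constraints in the
     remaining slots. *)
  move=> l c lo hi lt lc llo lhi; rewrite /cw /Y /cw.
  under eq_bigr => i _ do rewrite big_distrr.
  rewrite exchange_big /= big1 // => i _.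
  have : cw I q (fun i' => Z ((i + I * lo) + I ^ l.+1 * (i' + I * hi))) c = false.
    apply: hs => //; rewrite expnS; have := ltn_ord i.
    by have : I * lo.+1 <= I * I ^ l by [rewrite leq_mul]; rewrite mulnS; lia.
  rewrite /cw => E1; transitivity (K p i && false); last by rewrite andbF.
  rewrite -[X in _ = _ && X]E1 big_distrr; apply: eq_bigr => i' _ /=; rewrite andbCA; do 2!congr andb.
  by congr Z; rewrite expnS -mulnA -addnA mulnDr.
move=> /leq_trans; apply; apply: eq_leq; apply: eq_bigr => p' _.
by rewrite cw_tcode.
Qed.

Lemma tvec_cat y t l lo v : l <= t -> lo < I ^ l ->
  tvec y t (lo + I ^ l * v) = tvec y l lo && tvec y (t - l) v.
Proof.
elim: l t lo v => [|l IH] t lo v lt llo.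
  by have -> : lo = 0; [by case: lo llo|rewrite subn0 expn0 mul1n add0n].
case: t lt => // t lt /=.
have -> : lo + I ^ l.+1 * v = lo %% I + I * (lo %/ I + I ^ l * v).
  by rewrite {1}(divn_eq lo I) expnS mulnDr mulnA; lia.
have [-> ->] := digit0 (lo %/ I + I ^ l * v) (ltn_pmod lo I0).
by rewrite IH ?subSS ?andbA // ltn_divLR // mulnC -expnS.
Qed.

Lemma tsat_tvec y t : sat y -> tsat t (tvec y t).
Proof.
move=> hs l c lo hi lt lc llo lhi; have := hs c lc; rewrite /cw => E.
transitivity ((tvec y l lo && tvec y (t - l.+1) hi) && false); last by rewrite andbF.
rewrite -[X in _ = _ && X]E big_distrr; apply: eq_bigr => i _ /=.
rewrite tvec_cat ?(ltnW lt) //.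
have -> : t - l = (t - l.+1).+1 by lia.
rewrite [tvec y _.+1 _]/=.
have [-> ->] := digit0 hi (ltn_ord i).
by case: (q c i); case: (y i); case: (tvec y l lo); case: (tvec _ _ _).
Qed.

Lemma wt_tvec y t : wt (P ^ t) (cw (I ^ t) (tcode t) (tvec y t)) = wt P (cw I K y) ^ t.
Proof.
elim: t => [|t IH]; first by rewrite /wt /cw !big_ord1.
rewrite [RHS]expnS -IH {1}/wt [P ^ t.+1]expnS.
rewrite (sum_ord_mul P (P ^ t) (fun p => nat_of_bool (cw (I ^ t.+1) (tcode t.+1) (tvec y t.+1) p))).
rewrite [in RHS]/wt big_distrl /=; apply: eq_bigr => p _.
have E p' : cw (I ^ t.+1) (tcode t.+1) (tvec y t.+1) (p + P * p') =
    cw I K y p && cw (I ^ t) (tcode t) (tvec y t) p'.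
  rewrite cw_tcode // /cw big_distrr; apply: eq_bigr => u _ /=.
  rewrite andbCA; congr andb; rewrite big_distrl; apply: eq_bigr => i _ /=.
  by have [-> ->] := digit0 u (ltn_ord i); rewrite andbA.
under eq_bigr => p' _ do rewrite E.
by case: (cw I K y p) => /=; rewrite ?mul1n // mul0n big1.
Qed.
End Tensor.

(** * From nearest codewords to local size minimization *)

Definition fapply (g : gate) (s : nat -> bool) : nat -> bool :=
  fun j => if j == g.2 then s g.2 (+) s g.1 else s j.
Definition frun (gs : seq gate) s := foldl (fun s g => fapply g s) s gs.

Lemma nth_run gs x : nth false (run_circuit gs x) = frun gs (nth false x).
Proof.
elim: gs x => //= g gs IH x; rewrite IH; congr frun.
apply: functional_extensionality => j; rewrite /apply_gate nth_set_nth /fapply /=.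
by case: eqP => // _; case: (nth _ _ _); case: (nth _ _ _).
Qed.

Lemma size_run N gs x : all (gate_in N) gs -> size x = N -> size (run_circuit gs x) = N.
Proof.
elim: gs x => //= g gs IH x /andP[/and3P[_ h _] hs] sz; apply: IH => //.
by rewrite /apply_gate size_set_nth sz; apply/maxn_idPr.
Qed.

Lemma frun_cat a b s : frun (a ++ b) s = frun b (frun a s).
Proof. exact: foldl_cat. Qed.

(** No control is ever a target, so all controls keep their initial values and the gates commute. *)
Lemma frun_disjoint (T : pred nat) gs s :
  all (fun g => ~~ T g.1 && T g.2) gs ->
  frun gs s = fun j => s j (+) \big[addb/false]_(g <- gs | g.2 == j) s g.1.
Proof.
move=> h; apply: functional_extensionality => j.
elim: gs s h => [|g gs IH] s /=; first by rewrite big_nil addbF.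
move=> /andP[/andP[h1 h2] hs]; rewrite IH // big_cons.
have -> : \big[addb/false]_(g' <- gs | g'.2 == j) fapply g s g'.1 =
    \big[addb/false]_(g' <- gs | g'.2 == j) s g'.1.
  rewrite big_seq_cond [RHS]big_seq_cond; apply: eq_bigr => g' /andP[/(allP hs) /andP[h3 _] _].
  by rewrite /fapply; case: eqP h3 => // ->; rewrite h2.
rewrite /fapply [j == _]eq_sym; case: eqP => // <-.
by rewrite addbA.
Qed.

(* Each gate brings at most one new wire, its control, into the form carried by any wire. *)
Lemma frun_support N hs j : all (gate_in N) hs -> j < N ->
  exists U : nat -> bool, (forall i, U i -> i = j \/ i \in map fst hs) /\
    forall s, frun hs s j = cw N (fun _ => s) U 0.
Proof.
elim/last_ind: hs j => [|hs g IH] j hall lt.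
  exists (fun i => i == j); split=> [i /eqP|s]; first by left.
  rewrite /cw (bigD1 (Ordinal lt)) //= eqxx andbT big1 ?addbF // => i ne.
  by have -> : (i == j :> nat) = false; [apply/negbTE|rewrite andbF].
move: hall; rewrite all_rcons => /andP[/and3P[g1 g2 _] hall].
have [U [U1 U2]] := IH j hall lt; have [V [V1 V2]] := IH g.1 hall g1.
exists (if j == g.2 then fun i => U i (+) V i else U); split=> [i|s].
  rewrite map_rcons mem_rcons inE.
  case: eqP => [_|_ /U1[->|->]]; [|by left|by right; rewrite orbT].
  case Ui: (U i); first by case: (U1 _ Ui) => [->|->] _; [left|right; rewrite orbT].
  by move=> /= /V1[->|->]; right; rewrite ?eqxx ?orbT.
rewrite -cats1 frun_cat /= /fapply; case: eqP => [E|_]; last exact: U2.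
rewrite -E U2 V2 /cw -big_split; apply: eq_bigr => i _ /=.
by rewrite andb_addr.
Qed.

Lemma size_filter_wt N (U : nat -> bool) : size [seq i <- iota 0 N | U i] = wt N U.
Proof.
rewrite size_filter -sum1_count [LHS]big_mkcond /wt.
rewrite -(big_mkord xpredT (fun i => nat_of_bool (U i))) /index_iota subn0.
by apply: eq_bigr => i _; case: (U i).
Qed.

Lemma wt_size N (U : nat -> bool) (s : seq nat) : (forall i, U i -> i \in s) -> wt N U <= size s.
Proof.
move=> h; rewrite -size_filter_wt.
apply: uniq_leq_size; first by rewrite filter_uniq // iota_uniq.
by move=> i; rewrite mem_filter => /andP[/h].
Qed.

Lemma xsum_iota n (F : nat -> bool) : \big[addb/false]_(i <- iota 0 n) F i = xsum n F.
Proof. by rewrite -(big_mkord xpredT F) /index_iota subn0. Qed.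

(* Wires [0, n) hold the inputs x, wire [n + u] is to hold the form of column [u] of [A], wire
   [n + G] stays zero and wire [tgt] receives the form [b].  A zero entry is written as a gate
   controlled by wire [n + G], so that the number of gates does not depend on [A] and [b]. *)
Section Gadget.
Variables (n G : nat) (A : nat -> nat -> bool) (b : nat -> bool).
Hypothesis n0 : 0 < n.

Definition ctrl (c : bool) p := if c then p else n + G.
Definition tgt := (n + G).+1.
Definition pre : seq gate := flatten [seq [seq (ctrl (A p u) p, n + u) | p <- iota 0 n] | u <- iota 0 G].
Definition win : seq gate := [seq (ctrl (b p) p, tgt) | p <- iota 0 n].
(** On a clean zero wire [pre] and [win] undo themselves, so the whole circuit acts as the identity;
    its window is the first [win]. A replacement still faces the tail [win ++ pre] and must deliver
    the form [b] on [tgt]. The ancillas are the [G] column wires, the zero wire and [tgt]. *)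
Definition ncp_lsm := LSM n G.+2 (2 * (G * n + n)) (G * n).+1 (G * n + n) (pre ++ win ++ win ++ pre).

Let N := n + G.+2.

Lemma size_pre : size pre = G * n.
Proof.
rewrite /pre size_flatten /shape -map_comp sumnE big_map /=.
under eq_bigr => u _ do rewrite size_map size_iota.
by rewrite big_const_seq count_predT size_iota iter_addn_0 mulnC.
Qed.

Lemma size_win : size win = n.
Proof. by rewrite size_map size_iota. Qed.

Lemma replaceE hs : lsm_replace ncp_lsm hs = pre ++ hs ++ (win ++ pre).
Proof.
rewrite /lsm_replace /= take_size_cat ?size_pre //; congr (_ ++ (_ ++ _)).
by rewrite catA drop_size_cat // size_cat size_pre size_win.
Qed.

Lemma pre_in : all (gate_in N) pre.
Proof.
apply/allP => g /flattenP[s /mapP[u]]; rewrite mem_iota => /andP[_ lu] -> /mapP[p].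
rewrite mem_iota => /andP[_ lp] ->; rewrite /gate_in /ctrl /N /=.
by apply/and3P; case: (A p u); split; lia.
Qed.

Lemma win_in : all (gate_in N) win.
Proof.
apply/allP => g /mapP[p]; rewrite mem_iota => /andP[_ lp] ->; rewrite /gate_in /ctrl /N /tgt /=.
by apply/and3P; case: (b p); split; lia.
Qed.

Lemma xsum_ctrl (F : nat -> bool) s : s (n + G) = false ->
  xsum n (fun p => s (ctrl (F p) p)) = xsum n (fun p => F p && s p).
Proof.
by move=> h; apply: eq_bigr => p _; rewrite /ctrl; case: (F p) => //=; rewrite h.
Qed.

Definition preX s j := if (n <= j < n + G) then xsum n (fun p => A p (j - n) && s p) else false.

Lemma frun_pre s : s (n + G) = false -> frun pre s = fun j => s j (+) preX s j.
Proof.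
move=> h; rewrite (@frun_disjoint (fun j => n <= j < n + G)); last first.
  apply/allP => g /flattenP[t /mapP[u]]; rewrite mem_iota => /andP[_ lu] -> /mapP[p].
  rewrite mem_iota => /andP[_ lp] ->; rewrite /ctrl /=.
  by case: (A p u); apply/andP; split; lia.
apply: functional_extensionality => j; congr addb.
rewrite /pre big_flatten big_map /preX.
have E u : \big[addb/false]_(g <- [seq (ctrl (A p u) p, n + u) | p <- iota 0 n] | g.2 == j) s g.1 =
    (n + u == j) && xsum n (fun p => A p u && s p).
  rewrite big_map /=; case: eqP => _ /=; last by rewrite big_pred0.
  by rewrite (xsum_iota n (fun p => s (ctrl (A p u) p))) (xsum_ctrl (fun p => A p u)).
under eq_bigr => u _ do rewrite E.
rewrite (xsum_iota G (fun u => (n + u == j) && xsum n (fun p => A p u && s p))).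
case: ifP => hj.
  have lt : j - n < G by lia.
  rewrite (bigD1 (Ordinal lt)) //= subnKC; last by lia.
  rewrite eqxx /= [X in _ (+) X]big1 ?addbF // => u ne; case: eqP => // E1.
  by move/eqP: ne; case; apply: val_inj => /=; lia.
by rewrite big1 // => u _; case: eqP => // E1; have := ltn_ord u; lia.
Qed.

Lemma frun_win s : s (n + G) = false ->
  frun win s = fun j => s j (+) ((j == tgt) && xsum n (fun p => b p && s p)).
Proof.
move=> h; rewrite (@frun_disjoint (pred1 tgt)); last first.
  apply/allP => g /mapP[p]; rewrite mem_iota => /andP[_ lp] ->; rewrite /ctrl /tgt /=.
  by rewrite eqxx andbT; case: (b p); apply/eqP; lia.
apply: functional_extensionality => j; congr addb.
rewrite big_map /= eq_sym; case: eqP => _ /=; last by rewrite big_pred0.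
by rewrite (xsum_iota n (fun p => s (ctrl (b p) p))) (xsum_ctrl b).
Qed.

Definition ini0 (x : seq bool) := x ++ nseq G.+2 false.

Lemma nth_ini0 x j : size x = n -> nth false (ini0 x) j = (j < n) && nth false x j.
Proof. by move=> sz; rewrite nth_cat sz nth_nseq; case: ltnP => //= _; case: ifP. Qed.

Lemma size_ini0 x : size x = n -> size (ini0 x) = N.
Proof. by move=> sz; rewrite size_cat size_nseq sz. Qed.

Lemma ancilla_nth gs x : all (gate_in N) gs -> size x = n ->
  drop n (run_circuit gs (ini0 x)) = nseq G.+2 false <->
  forall j, n <= j -> frun gs (nth false (ini0 x)) j = false.
Proof.
move=> hall sz; have szr := size_run hall (size_ini0 sz); rewrite -nth_run; split => [E j le|h].
  by rewrite -(subnKC le) -nth_drop E nth_nseq; case: ifP.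
apply: (@eq_from_nth _ false); first by rewrite size_drop szr size_nseq /N; lia.
by move=> i lt; rewrite nth_drop h ?leq_addr // nth_nseq; case: ifP.
Qed.

Lemma output_nth gs x (y : nat -> bool) : all (gate_in N) gs -> size x = n ->
  (forall j, j < n -> frun gs (nth false (ini0 x)) j = y j) <->
  take n (run_circuit gs (ini0 x)) = mkseq y n.
Proof.
move=> hall sz; have szr := size_run hall (size_ini0 sz); rewrite -nth_run; split => [h|E j lt].
  have st : size (take n (run_circuit gs (ini0 x))) = n by rewrite size_take szr /N ifT //; lia.
  apply: (@eq_from_nth _ false); rewrite ?size_mkseq // => i; rewrite st => lt.
  by rewrite nth_take // h // nth_mkseq.
by rewrite -(nth_take false lt) E nth_mkseq.
Qed.

(** The tail inverts the first half: [s'] is the state before [pre], and [s] the state once the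
    window has filled [tgt]. *)
Lemma frun_two (s s' : nat -> bool) : s (n + G) = false -> s tgt = xsum n (fun p => b p && s p) ->
  (forall j, s j = s' j (+) preX s' j (+) ((j == tgt) && s tgt)) ->
  s' tgt = false -> frun (win ++ pre) s = s'.
Proof.
move=> h1 h2 h3 h4; rewrite frun_cat frun_win // frun_pre; last first.
  by rewrite h1 (_ : (n + G == tgt) = false) // /tgt; lia.
have E p : p < n -> s p = s' p.
  by move=> lt; rewrite h3 /preX leqNgt lt /= addbF (_ : (p == tgt) = false) ?addbF // /tgt; lia.
apply: functional_extensionality => j.
have -> : preX (fun j => s j (+) ((j == tgt) && xsum n (fun p => b p && s p))) j = preX s' j.
  rewrite /preX; case: ifP => // hj; apply: eq_bigr => p _; congr andb.
  have lt := ltn_ord p; rewrite E //; have -> : (p == tgt :> nat) = false by rewrite /tgt; lia.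
  by rewrite addbF.
rewrite -h2 h3; case: (s' j); case: (preX s' j); case: (_ && _) => //.
Qed.

Lemma frun_pre_ini x : size x = n ->
  frun pre (nth false (ini0 x)) = fun j => nth false (ini0 x) j (+) preX (nth false (ini0 x)) j.
Proof. by move=> sz; rewrite frun_pre // nth_ini0 // ltnNge leq_addr. Qed.

(** The replacement need only act correctly when the column wires hold the forms of [A], as they do
    after [pre]; this lets it draw on them. *)
Lemma completed_run hs x : size x = n ->
  (forall s, s (n + G) = false -> s tgt = false ->
    (forall j, n <= j < n + G -> s j = xsum n (fun p => A p (j - n) && s p)) ->
    frun hs s = fun j => s j (+) ((j == tgt) && xsum n (fun p => b p && s p))) ->
  frun (pre ++ hs ++ win ++ pre) (nth false (ini0 x)) = nth false (ini0 x).
Proof.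
move=> sz hh; rewrite 2!frun_cat frun_pre_ini //; set s0 := nth false (ini0 x).
have s0z j : n <= j -> s0 j = false by move=> le; rewrite /s0 nth_ini0 // ltnNge le.
have pz j : ~~ (n <= j < n + G) -> preX s0 j = false by rewrite /preX => /negbTE ->.
set s1 := fun j => s0 j (+) preX s0 j.
have s1p p : p < n -> s1 p = s0 p by move=> lt; rewrite /s1 pz ?addbF //; lia.
have s1b (F : nat -> bool) : xsum n (fun p => F p && s1 p) = xsum n (fun p => F p && s0 p).
  by apply: eq_bigr => p _; rewrite s1p.
have e1 : s1 (n + G) = false by rewrite /s1 s0z ?pz //; lia.
have e2 : s1 tgt = false by rewrite /s1 s0z ?pz // /tgt; lia.
rewrite hh //; last first.
  move=> j hj; rewrite (s1b (fun p => A p (j - n))) /s1 s0z /preX ?hj //; lia.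
apply: frun_two.
- by rewrite e1 /= /tgt (_ : (n + G == _) = false) //; lia.
- rewrite e2 eqxx /= ; apply: eq_bigr => p _; congr andb.
  by rewrite (_ : (p == tgt :> nat) = false) ?addbF // /tgt; have := ltn_ord p; lia.
- by move=> j; rewrite e2 eqxx.
- by apply: s0z; rewrite /tgt; lia.
Qed.

Lemma ncp_anc hs : all (gate_in N) hs ->
  (forall x, size x = n -> frun (pre ++ hs ++ win ++ pre) (nth false (ini0 x)) = nth false (ini0 x)) ->
  is_ancilla_circuit n G.+2 (pre ++ hs ++ win ++ pre).
Proof.
move=> hin h; have hall : all (gate_in N) (pre ++ hs ++ win ++ pre).
  by rewrite !all_cat pre_in win_in hin.
split=> // x sz; apply/(ancilla_nth hall sz) => j le.
by rewrite h // nth_ini0 // ltnNge le.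
Qed.

Lemma win_completed x : size x = n ->
  frun (pre ++ win ++ win ++ pre) (nth false (ini0 x)) = nth false (ini0 x).
Proof. by move=> sz; apply: completed_run => // s h _ _; apply: frun_win. Qed.

Lemma ncp_valid : lsm_valid ncp_lsm.
Proof.
split=> //=.
- by split; lia.
- by rewrite !size_cat size_pre size_win; lia.
- by apply: ncp_anc; [apply: win_in|apply: win_completed].
Qed.

(** The form left on [tgt] combines columns [Z] and single inputs. As it must be [b], the inputs
    involved are exactly the positions where the columns alone miss [b], and each of them has to be
    the control of some gate in the window. *)
Lemma ncp_lower w : lsm_feasible ncp_lsm w ->
  exists Z, wt n (fun p => cw G A Z p != b p) <= w.
Proof.
move=> [hs [<- [hin [_ [[hall hanc] heq]]]]]; rewrite replaceE in hall hanc heq.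
have hall0 : all (gate_in N) (pre ++ win ++ win ++ pre) by rewrite !all_cat pre_in win_in.
have tN : tgt < N by rewrite /tgt /N; lia.
have [U [U1 U2]] := frun_support hin tN.
exists (fun u => U (n + u)).
apply: leq_trans (_ : wt n (fun p => U p) <= _); last first.
  apply: (@leq_trans (wt n (fun i => U i && (i < n)))).
    by apply: eq_leq; apply: wt_ext => i ->; rewrite andbT.
  rewrite -(size_map fst); apply: wt_size => i /andP[/U1[->|//]]; rewrite /tgt; lia.
(* Coefficient [p] is read off by running the circuit on the unit vector at [p]; the support [U] is
   the same for all inputs. *)
apply: eq_leq; apply: wt_ext => p lp; pose x := mkseq (pred1 p) n.
have sz : size x = n by rewrite size_mkseq.
set s0 := nth false (ini0 x).
have s0E j : s0 j = (j == p).
  rewrite /s0 nth_ini0 //; case: ltnP => h /=; first by rewrite nth_mkseq.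
  by apply/esym/eqP; lia.
set s2 := frun hs (frun pre s0).
have fE : frun (pre ++ hs ++ win ++ pre) s0 = frun pre (frun win s2) by rewrite !frun_cat.
have fz j : n <= j -> frun pre (frun win s2) j = false.
  by rewrite -fE; move: j; apply/(ancilla_nth hall sz)/hanc.
have fx j : j < n -> frun pre (frun win s2) j = (j == p).
  rewrite -fE; move: j; apply/(output_nth _ hall sz); rewrite -heq //.
  by apply/(output_nth _ hall0 sz) => j _; rewrite win_completed // -/s0 s0E.
have pz j s : ~~ (n <= j < n + G) -> preX s j = false by rewrite /preX => /negbTE ->.
(* The tail never targets the zero wire, so it must already be clean when the window ends. Only then
   do the dummy gates of the tail have no effect. *)
have zG : s2 (n + G) = false.
  have keep gs : all (fun g : gate => g.2 != n + G) gs -> forall s, frun gs s (n + G) = s (n + G).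
    elim: gs => //= g gs IH /andP[ne h] s; rewrite IH // /fapply.
    by rewrite eq_sym (negbTE ne).
  rewrite -(fz (n + G)) ?leq_addr // !keep //.
    by apply/allP => g /mapP[q _ ->]; rewrite /tgt /=; apply/eqP; lia.
  apply/allP => g /flattenP[t /mapP[u]]; rewrite mem_iota => /andP[_ lu] -> /mapP[q _ ->] /=.
  by apply/eqP; lia.
have wz : frun win s2 (n + G) = false.
  by rewrite frun_win // zG /= /tgt (_ : (n + G == _) = false) //; lia.
have x2 j : j < n -> s2 j = (j == p).
  move=> lt; rewrite -fx // frun_pre // pz ?addbF ?frun_win //; last by lia.
  by rewrite (_ : (j == tgt) = false) ?addbF // /tgt; lia.
have t2 : s2 tgt = b p.
  have := fz tgt (ltac:(rewrite /tgt; lia)); rewrite frun_pre // pz; last by rewrite /tgt; lia.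
  rewrite addbF frun_win // eqxx /= (bigD1 (Ordinal lp)) //= (x2 p) // eqxx andbT big1 ?addbF.
    by case: (s2 tgt); case: (b p).
  move=> i ne; rewrite x2 // (_ : (i == p :> nat) = false) ?andbF //.
  by apply/negbTE.
rewrite -t2 /s2 U2 frun_pre_ini // -/s0 /cw /N big_split_ord /=.
have -> : xsum n (fun i => (s0 i (+) preX s0 i) && U i) = U p.
  rewrite (bigD1 (Ordinal lp)) //= s0E eqxx pz ?big1 ?addbF //; try lia.
  move=> i ne; rewrite s0E pz; last by have := ltn_ord i; lia.
  by rewrite (_ : (i == p :> nat) = false) //; apply/negbTE.
have -> : xsum G.+2 (fun i => (s0 (n + i) (+) preX s0 (n + i)) && U (n + i)) =
    xsum G (fun u => A p u && U (n + u)).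
  rewrite 2!big_ord_recr /= !s0E !pz; try lia.
  have -> : (n + G == p) = false by lia.
  have -> : (n + G.+1 == p) = false by lia.
  rewrite /= !addbF; apply: eq_bigr => u _; congr andb; have lu := ltn_ord u.
  have -> : s0 (n + u) = false by rewrite s0E; lia.
  rewrite /preX ifT; last by lia.
  rewrite addKn /= (bigD1 (Ordinal lp)) //= s0E eqxx andbT big1 ?addbF // => i ne.
  by rewrite s0E (_ : (i == p :> nat) = false) ?andbF //; apply/negbTE.
by case: (U p); case: (\big[_/_]_(u < G) _).
Qed.

(** One gate per selected column, and one per input at which their sum is wrong. *)
Lemma ncp_upper Z : lsm_feasible ncp_lsm (wt n (fun p => cw G A Z p != b p) + wt G Z).
Proof.
set e := fun p => cw G A Z p != b p.
pose hs : seq gate := [seq (p, tgt) | p <- iota 0 n & e p] ++ [seq (n + u, tgt) | u <- iota 0 G & Z u].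
have hin : all (gate_in N) hs.
  apply/allP => g; rewrite mem_cat => /orP[] /mapP[p]; rewrite mem_filter mem_iota => /andP[_ lp] ->;
  by rewrite /gate_in /N /tgt /=; apply/and3P; split; lia.
have hrun x : size x = n -> frun (pre ++ hs ++ win ++ pre) (nth false (ini0 x)) = nth false (ini0 x).
  move=> sz; apply: completed_run => // s h1 h2 h3.
  rewrite (@frun_disjoint (pred1 tgt)); last first.
    apply/allP => g; rewrite mem_cat => /orP[] /mapP[p]; rewrite mem_filter mem_iota => /andP[_ lp] ->;
    by rewrite /tgt /= eqxx andbT; apply/eqP; lia.
  apply: functional_extensionality => j; congr addb.
  rewrite /hs big_cat !big_map /= eq_sym; case: eqP => _ /=; last by rewrite !big_pred0.
  rewrite !big_filter [X in X (+) _]big_mkcond [X in _ (+) X]big_mkcond /=.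
  rewrite (xsum_iota n (fun p => if e p then s p else false)).
  rewrite (xsum_iota G (fun u => if Z u then s (n + u) else false)).
  have -> : xsum G (fun u => if Z u then s (n + u) else false) =
      xsum n (fun p => cw G A Z p && s p).
    rewrite /cw; under [RHS]eq_bigr => p _ do rewrite big_distrl.
    rewrite exchange_big /=; apply: eq_bigr => u _; have lu := ltn_ord u.
    case: (Z u); last by rewrite big1 // => p _; rewrite andbF.
    by rewrite h3; [|lia]; rewrite addKn; apply: eq_bigr => p _; rewrite andbT.
  rewrite -big_split; apply: eq_bigr => p _ /=; rewrite /e.
  by case: (cw _ _ _); case: (b p); case: (s p).
exists hs; split; first by rewrite size_cat !size_map !size_filter_wt.
split=> //; rewrite /circ_equiv replaceE; split; last split.
- by apply: ncp_anc; [apply: win_in|apply: win_completed].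
- exact: ncp_anc.
move=> x sz; have hall : all (gate_in N) (pre ++ hs ++ win ++ pre).
  by rewrite all_cat pre_in (all_cat _ hs) hin all_cat win_in pre_in.
have hall0 : all (gate_in N) (pre ++ win ++ win ++ pre) by rewrite !all_cat pre_in win_in.
transitivity (mkseq (nth false (ini0 x)) n).
  by apply/(output_nth _ hall0 sz) => j _; rewrite win_completed.
by apply/esym/(output_nth _ hall sz) => j _; rewrite hrun.
Qed.
End Gadget.

(** * Computations as quadratic systems over F2 *)

(* Tape cells are addressed relatively to the head, which sits at position [T]; a head move then
   shifts the whole tape, and the symbols of the next row are quadratic in the current row. *)
Section Step.
Variable M : TM.
Let Q := 'I_(tm_q M).+1.
Variable T : nat.

Definition nxt (r : Q * sym) : Q * sym * move :=
  if tm_delta r.1 r.2 is Some z then z else (r.1, r.2, MStay).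
(** After a move [d], cell [p] shows what cell [sh d p] held before. Truncation at 0 is the reason
    for [0 < p] in the tape equations. *)
Definition sh (d : move) (p : nat) : nat :=
  match d with MLeft => p.-1 | MRight => p.+1 | MStay => p end.
Definition scan_pair (c : config M) : Q * sym := (cf_state c, cf_head c).
Definition sym_at (c : config M) p : sym :=
  if p < T then nth None (cf_left c) (T - p.+1)
  else if p == T then cf_head c else nth None (cf_right c) (p - T.+1).

Lemma step_state (c : config M) : cf_state (tm_step c) = (nxt (scan_pair c)).1.1.
Proof.
by rewrite /tm_step /nxt /=; case: (tm_delta _ _) => [[[q w] []]|].
Qed.

Lemma step_sym (c : config M) p : 0 < p ->
  sym_at (tm_step c) p = let: (_, w, d) := nxt (scan_pair c) in
    if sh d p == T then w else sym_at c (sh d p).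
Proof.
move=> p0; rewrite /tm_step /nxt /=; case: (tm_delta _ _) => [[[q w] d]|] /=; last first.
  by case: eqP => // ->; rewrite /sym_at ltnn eqxx.
case: d; rewrite /sym_at /=.
- case: (ltngtP p T) => h.
  + have -> : (p.-1 == T) = false by lia.
    have -> : (p.-1 < T) = true by lia.
    by rewrite nth_behead; congr nth; lia.
  + case: eqP => h2; first by have -> : p - T.+1 = 0 by lia.
    have -> : (p.-1 < T) = false by lia.
    by have -> : p - T.+1 = (p.-1 - T.+1).+1 by lia.
  + have -> : (p.-1 == T) = false by lia.
    have -> : (p.-1 < T) = true by lia.
    by rewrite -nth0; congr nth; lia.
- case: (ltngtP p T) => h.
  + case: eqP => h2; first by have -> : T - p.+1 = 0 by lia.
    have -> : (p.+1 < T) = true by lia.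
    by have -> : T - p.+1 = (T - p.+2).+1 by lia.
  + have -> : (p.+1 == T) = false by lia.
    have -> : (p.+1 < T) = false by lia.
    by rewrite nth_behead; congr nth; lia.
  + have -> : (p.+1 == T) = false by lia.
    have -> : (p.+1 < T) = false by lia.
    by rewrite -nth0; congr nth; lia.
- by case: (ltngtP p T).
Qed.

Lemma init_state y : cf_state (init_config M y) = ord0.
Proof. by case: y. Qed.

Lemma init_sym y p : sym_at (init_config M y) p =
  if p < T then None else nth None (map Some y) (p - T).
Proof.
rewrite /sym_at; case: (ltngtP p T) => h; case: y => [|b y] //=; rewrite ?nth_nil //.
- by have -> : p - T = (p - T.+1).+1 by lia.
- by rewrite h subnn.
Qed.
End Step.

(** If blanks persist to the right, the guessed cells form a word padded with blanks, as on an
    initial tape. *)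
Lemma read_word_nth (s : seq sym) :
  (forall j, j.+1 < size s -> nth None s j = None -> nth None s j.+1 = None) ->
  size (read_word s) <= size s /\ forall j, nth None s j = nth None (map Some (read_word s)) j.
Proof.
elim: s => [|[b|] s IH] h; first by [].
  have [|h1 h2] := IH; first by move=> j lt; apply: (h j.+1).
  by split=> // -[|j] //=.
split=> // j /=; rewrite nth_nil; elim: j => //= j IHj.
case: (ltnP j.+1 (size (None :: s : seq sym))) => lt; last by rewrite nth_default.
by apply: (h j).
Qed.

Lemma nth_enc_bits x o : o < 2 * size x + 2 ->
  nth false (enc_bits x) o = if o < 2 * size x then (odd o ==> nth false x o./2) else false.
Proof.
rewrite /enc_bits; elim: x o => [|b x IH] o; first by case: o => [|[]].
case: o => [|[|o]] //=; try by move=> _; rewrite ifT //; lia.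
move=> lt; rewrite IH; last by lia.
by rewrite negbK mulnS; congr (if _ then _ else _); lia.
Qed.

Lemma size_enc_bits x : size (enc_bits x) = 2 * size x + 2.
Proof.
elim: x => // b x IH; rewrite -[size (enc_bits _)]/((size (enc_bits x)).+2) IH /=; lia.
Qed.

Lemma In_cat (A : Type) (x : A) s1 s2 :
  List.In x (s1 ++ s2) <-> List.In x s1 \/ List.In x s2.
Proof. by elim: s1 => [|a s IH] /=; tauto. Qed.

Lemma In_map (A B : Type) (f : A -> B) y s :
  List.In y (map f s) <-> exists x, f x = y /\ List.In x s.
Proof.
elim: s => [|a s IH] /=; first by split=> // -[x []].
rewrite IH; split=> [[<-|[x [E h]]]|[x [E [->|h]]]].
- by exists a; split; [|left].
- by exists x; split; [|right].
- by left.
- by right; exists x.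
Qed.

(* The monomial [v_(ma) * v_(mb)], present in the equation of index (i, j) when [mg] holds.
   Variable 0 stands for the constant 1, so linear terms are monomials with [mb = 0]. *)
Record mono := Mono {
  mg : seq bool -> nat -> nat -> bool;
  ma : seq bool -> nat -> nat -> nat;
  mb : seq bool -> nat -> nat -> nat }.

Section Tableau.
Variable M : TM.
Let Q := 'I_(tm_q M).+1.
Let rule : finType := (Q * option bool)%type.
Variables T W : seq bool -> nat.
Implicit Types (inp : seq bool) (t p : nat) (q : Q) (s : sym) (r : Q * sym).

Definition gridS inp := 2 * T inp + 2.
Definition kinds := 3 + (tm_q M).+1 + (tm_q M).+1 * 3.
Definition vidx inp t p k := ((t * gridS inp + p) * kinds + k).+1.
Definition nvars inp := (gridS inp * gridS inp * kinds).+1.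
Definition sidx s := match s with None => 0 | Some false => 1 | Some true => 2 end.
(* Variables: cell p carries s, the state is q, the state and scanned symbol are r, at time t. *)
Definition va inp t p s := vidx inp t p (sidx s).
Definition vs inp t q := vidx inp t 0 (3 + q).
Definition vy inp t r := vidx inp t 0 (3 + (tm_q M).+1 + (r.1 * 3 + sidx r.2)).

Definition zero inp t p := 0.
(* The reversed input [rev inp] is padded by [enc_pair]; the witness occupies the next [W inp]
   cells, which are the only ones not determined by the input. *)
Definition fixed inp p := (p < T inp + (2 * size inp + 2)) || (T inp + (2 * size inp + 2) + W inp <= p).
Definition fixed_sym inp p s : bool :=
  if (T inp <= p) && (p < T inp + (2 * size inp + 2)) then
    let o := p - T inp in
    s == Some (if o < 2 * size inp then odd o ==> nth false inp (size inp - (o./2).+1) else false)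
  else s == None.

Definition fam_sym := [:: Mono (fun _ _ _ => true) (fun _ i _ => i) (fun _ _ j => j);
                          Mono (fun _ _ _ => true) (fun _ _ j => j) (fun _ i _ => i)].
(** On a rank one matrix this reads [x_i x_i = x_i x_0], so a nonzero solution has [x_0 = 1] and
    cannot escape by dropping the constant. *)
Definition fam_idem := [:: Mono (fun _ _ _ => true) (fun _ i _ => i) (fun _ i _ => i);
                           Mono (fun _ _ _ => true) (fun _ i _ => i) zero].
(** A new symbol depends on the state, the scanned symbol and an old symbol. Naming the product of
    the first two keeps the tape equations quadratic. *)
Definition fam_y r := let g inp t p := t <= T inp in
  [:: Mono g (fun inp t _ => vy inp t r) zero;
      Mono g (fun inp t _ => vs inp t r.1) (fun inp t _ => va inp t (T inp) r.2)].
Definition fam_state q := let g inp t p := t < T inp in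
  Mono g (fun inp t _ => vs inp t.+1 q) zero ::
  [seq Mono g (fun inp t _ => vy inp t r) zero | r <- enum [pred r : rule | (nxt r).1.1 == q]].
Definition fam_tape s :=
  let g inp t p := [&& t < T inp, 0 < p & p < 2 * T inp] in
  Mono g (fun inp t p => va inp t.+1 p s) zero ::
  [seq Mono (fun inp t p => g inp t p && ((sh (nxt r).2 p == T inp) && (s == (nxt r).1.2)))
    (fun inp t p => vy inp t r) zero | r <- enum rule] ++
  [seq Mono (fun inp t p => g inp t p && (sh (nxt r).2 p != T inp))
    (fun inp t p => vy inp t r) (fun inp t p => va inp t (sh (nxt r).2 p) s) | r <- enum rule].
Definition fam_state0 q :=
  [:: Mono (fun inp t p => t == 0) (fun inp t p => vs inp 0 q) zero;
      Mono (fun inp t p => (t == 0) && (q == ord0)) zero zero].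
Definition fam_tape0 s :=
  let g inp t p := (p <= 2 * T inp) && fixed inp p in
  [:: Mono g (fun inp t p => va inp 0 p s) zero;
      Mono (fun inp t p => g inp t p && fixed_sym inp p s) zero zero].
(** Witness cells carry exactly one symbol: products of different symbols vanish and the three
    indicators sum to 1. The family [fam_blank] makes blanks persist to the right, which covers
    witnesses shorter than [W inp]. *)
Definition guess inp t p := (p <= 2 * T inp) && ~~ fixed inp p.
Definition fam_guess2 (z : sym * sym) :=
  [:: Mono (fun inp t p => guess inp t p && (z.1 != z.2)) (fun inp t p => va inp 0 p z.1)
        (fun inp t p => va inp 0 p z.2)].
Definition fam_guess1 :=
  [:: Mono guess (fun inp t p => va inp 0 p None) zero;
      Mono guess (fun inp t p => va inp 0 p (Some false)) zero;
      Mono guess (fun inp t p => va inp 0 p (Some true)) zero;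
      Mono guess zero zero].
Definition fam_blank (b : bool) :=
  [:: Mono (fun inp t p => guess inp t p && guess inp t p.+1) (fun inp t p => va inp 0 p None)
        (fun inp t p => va inp 0 p.+1 (Some b))].
Definition fam_accept :=
  [:: Mono (fun _ _ _ => true) (fun inp t p => va inp (T inp) (T inp) (Some true)) zero;
      Mono (fun _ _ _ => true) zero zero].

Definition fams := [:: fam_sym; fam_idem] ++ map fam_y (enum rule) ++ map fam_state (enum Q)
  ++ map fam_tape (enum {: option bool}) ++ map fam_state0 (enum Q) ++ map fam_tape0 (enum {: option bool})
  ++ map fam_guess2 (enum {: option bool * option bool}) ++ [:: fam_guess1] ++ map fam_blank (enum {: bool})
  ++ [:: fam_accept].

Definition ev inp (X : nat -> nat -> bool) (f : seq mono) t p :=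
  \big[addb/false]_(m <- f) (mg m inp t p && X (ma m inp t p) (mb m inp t p)).

Variable inp : seq bool.
Local Notation Tn := (T inp).
Local Notation n0 := (size inp).
Hypothesis WT : 2 * n0 + 2 + W inp <= Tn.

Definition qsat (v : nat -> bool) := forall f t p, List.In f fams -> t < nvars inp -> p < nvars inp ->
  ev inp (fun i j => v i && v j) f t p = false.

Lemma vidx_lt t p k : t < gridS inp -> p < gridS inp -> k < kinds -> vidx inp t p k < nvars inp.
Proof.
move=> lt lp lk; rewrite /vidx /nvars ltnS.
have h1 : (t * gridS inp + p).+1 <= gridS inp * gridS inp.
  by have : t.+1 * gridS inp <= gridS inp * gridS inp; [rewrite leq_mul|rewrite mulSn; lia].
by have := leq_mul h1 (leqnn kinds); rewrite mulSn; lia.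
Qed.

Lemma grid_nvars : gridS inp <= nvars inp.
Proof.
rewrite /nvars; apply: leqW; rewrite -mulnA leq_pmulr // muln_gt0 /gridS /kinds; lia.
Qed.

Definition decode (c : nat -> config M) (i : nat) : bool :=
  if i is i'.+1 then
    let k := i' %% kinds in
    let t := i' %/ kinds %/ gridS inp in
    let p := i' %/ kinds %% gridS inp in
    if k < 3 then k == sidx (sym_at Tn (c t) p)
    else if k < 3 + (tm_q M).+1 then k - 3 == cf_state (c t)
    else k - (3 + (tm_q M).+1) == cf_state (c t) * 3 + sidx (sym_at Tn (c t) Tn)
  else true.

Arguments decode : simpl never.

Lemma decode_zero c t p : decode c (zero inp t p) = true.
Proof. by []. Qed.

Lemma sidx_lt s : sidx s < 3.
Proof. by case: s => [[]|]. Qed.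
Lemma sidx_inj : injective sidx.
Proof. by move=> [[]|] [[]|]. Qed.

Lemma decode_vidx c t p k : p < gridS inp -> k < kinds ->
  decode c (vidx inp t p k) = if k < 3 then k == sidx (sym_at Tn (c t) p)
    else if k < 3 + (tm_q M).+1 then k - 3 == cf_state (c t)
    else k - (3 + (tm_q M).+1) == cf_state (c t) * 3 + sidx (sym_at Tn (c t) Tn).
Proof.
move=> lp lk; rewrite /decode /vidx.
rewrite modnMDl (modn_small lk) divnMDl ?(leq_ltn_trans _ lk) // (divn_small lk) addn0.
by rewrite modnMDl (modn_small lp) divnMDl ?(leq_ltn_trans _ lp) // (divn_small lp) addn0.
Qed.

Lemma decode_va c t p s : p < gridS inp -> decode c (va inp t p s) = (sym_at Tn (c t) p == s).
Proof.
move=> lp; rewrite /va decode_vidx ?sidx_lt //; last by have := sidx_lt s; rewrite /kinds; lia.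
by rewrite (inj_eq sidx_inj) eq_sym.
Qed.

Lemma sym_head (c : config M) : sym_at Tn c Tn = cf_head c.
Proof. by rewrite /sym_at ltnn eqxx. Qed.

Lemma decode_vs c t q : decode c (vs inp t q) = (cf_state (c t) == q).
Proof.
have lq := ltn_ord q.
rewrite /vs decode_vidx; [|by rewrite /gridS; lia|by rewrite /kinds; lia].
have -> : (3 + q < 3) = false by lia.
have -> : (3 + q < 3 + (tm_q M).+1) = true by lia.
by rewrite addKn eq_sym.
Qed.

Lemma vy_kind (r : Q * sym) : 3 + (tm_q M).+1 + (r.1 * 3 + sidx r.2) < kinds.
Proof.
have := ltn_ord r.1; have := sidx_lt r.2; rewrite /kinds.
move: (nat_of_ord r.1) => a h1 h2; have : a.+1 * 3 <= (tm_q M).+1 * 3 by rewrite leq_mul.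
by lia.
Qed.

Lemma decode_vy c t r : decode c (vy inp t r) = (scan_pair (c t) == r).
Proof.
rewrite /vy decode_vidx; [|by rewrite /gridS; lia|exact: vy_kind].
have h0 := vy_kind r; set k := (_ * 3 + _) in h0 *.
have -> : (3 + (tm_q M).+1 + k < 3) = false by lia.
have -> : (3 + (tm_q M).+1 + k < 3 + (tm_q M).+1) = false by lia.
clear h0; rewrite addKn sym_head {}/k /scan_pair; case: r => q s /=.
apply/eqP/eqP => [E|[-> ->]] //.
have h1 := sidx_lt s; have h2 := sidx_lt (cf_head (c t)).
have {}E : (nat_of_ord (cf_state (c t)) = q) /\ sidx (cf_head (c t)) = sidx s by lia.
by congr pair; [apply: val_inj; exact: E.1|apply: sidx_inj; exact: E.2].
Qed.

Definition fixed_ok (c0 : config M) := forall p, p <= 2 * Tn -> fixed inp p ->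
  forall s, (sym_at Tn c0 p == s) = fixed_sym inp p s.

Lemma fixed_init w : size w <= W inp -> fixed_ok (init_config M (enc_pair (rev inp) w)).
Proof.
move=> sw p le; rewrite /fixed /fixed_sym init_sym /enc_pair => hf s.
have sz : size (enc_bits (rev inp)) = 2 * n0 + 2 by rewrite size_enc_bits size_rev.
case: (ltnP p Tn) => h1 /=; first by rewrite eq_sym.
case: (ltnP p (Tn + (2 * n0 + 2))) => h2 /=.
  have h3 : p - Tn < 2 * n0 + 2 by lia.
  rewrite (nth_map false) ?(size_cat (enc_bits _)) ?sz; last by lia.
  rewrite (nth_cat _ (enc_bits _)) sz h3 nth_enc_bits size_rev // eq_sym.
  case: ifP => h4 //; congr (s == Some _).
  by case: (odd _) => //=; rewrite nth_rev //; lia.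
rewrite nth_default 1?eq_sym // size_map (size_cat (enc_bits _)) sz; lia.
Qed.

Lemma ev_pair X m1 m2 t p : ev inp X [:: m1; m2] t p =
  (mg m1 inp t p && X (ma m1 inp t p) (mb m1 inp t p)) (+)
  (mg m2 inp t p && X (ma m2 inp t p) (mb m2 inp t p)).
Proof. by rewrite /ev !big_cons big_nil addbF. Qed.

Lemma big_enum_pick (I : finType) (i0 : I) (P F : pred I) :
  \big[addb/false]_(i <- enum P) ((i0 == i) && F i) = P i0 && F i0.
Proof.
rewrite big_enum /= big_mkcond (bigD1 i0) //= eqxx big1 ?addbF => [|i ne].
  by rewrite -topredE /=; case: (P i0).
by rewrite eq_sym (negbTE ne) if_same.
Qed.

Lemma tableau_complete w : size w <= W inp ->
  cf_head (iter Tn (@tm_step M) (init_config M (enc_pair (rev inp) w))) = Some true ->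
  exists v : nat -> bool, v 0 /\ qsat v.
Proof.
move=> sw acc; pose c t := iter t (@tm_step M) (init_config M (enc_pair (rev inp) w)).
have gT p : p <= 2 * Tn -> p < gridS inp by rewrite /gridS; lia.
exists (decode c); split=> // f t p hf lt lp; move: hf.
rewrite /fams !In_cat => -[|[|[|[|[|[|[|[|[|]]]]]]]]].
- case=> [<-|[<-|[]]]; rewrite ev_pair /=; first by rewrite andbC addbb.
  by rewrite decode_zero andbb andbT addbb.
- move=> /In_map[r [<- _]]; rewrite ev_pair /= decode_zero andbT.
  rewrite decode_vy decode_vs decode_va; last by apply: gT; lia.
  case: (t <= Tn) => //=; rewrite sym_head /scan_pair; case: (r) => q s /=.
  by rewrite xpair_eqE addbb.
- move=> /In_map[q [<- _]]; rewrite /ev big_cons big_map /= decode_zero andbT decode_vs.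
  case: (t < Tn) => /=; last by rewrite big1.
  under eq_bigr => r _ do rewrite ?decode_zero andbT decode_vy -(andbT (_ == r)).
  by rewrite big_enum_pick inE /= andbT step_state addbb.
- move=> /In_map[s [<- _]]; rewrite /ev big_cons big_cat !big_map /= decode_zero andbT.
  case: (ltnP t Tn) => ht /=; last by rewrite !big1.
  case: (ltnP 0 p) => hp0 /=; last by rewrite !big1.
  case: (ltnP p _) => hp1 /=; last by rewrite !big1.
  have gs d : sh d p < gridS inp by case: d; apply: gT; rewrite /=; lia.
  rewrite decode_va; last by apply: gT; lia.
  (* The assignment makes [vy] true for a single rule, so each sum over rules reduces to one
     term. *)
  have E1 : \big[addb/false]_(r <- enum rule)
      (((sh (nxt r).2 p == Tn) && (s == (nxt r).1.2)) && (decode c (vy inp t r) && true)) =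
      (sh (nxt (scan_pair (c t))).2 p == Tn) && (s == (nxt (scan_pair (c t))).1.2).
    rewrite -[RHS](big_enum_pick (scan_pair (c t)) xpredT (fun r => (sh (nxt r).2 p == Tn) && (s == (nxt r).1.2))).
    by apply: eq_bigr => r _; rewrite decode_vy andbT andbC.
  have E2 : \big[addb/false]_(r <- enum rule)
      ((sh (nxt r).2 p != Tn) && (decode c (vy inp t r) && decode c (va inp t (sh (nxt r).2 p) s))) =
      (sh (nxt (scan_pair (c t))).2 p != Tn) && (sym_at Tn (c t) (sh (nxt (scan_pair (c t))).2 p) == s).
    rewrite -[RHS](big_enum_pick (scan_pair (c t)) xpredT (fun r => (sh (nxt r).2 p != Tn) && (sym_at Tn (c t) (sh (nxt r).2 p) == s))).
    by apply: eq_bigr => r _; rewrite decode_vy decode_va // andbCA.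
  rewrite -!enumT E1 E2 /c iterS step_sym //; case: (nxt _) => -[q' w'] d /=.
  by case: (sh d p =P Tn) => _ /=; rewrite ?addbF ?addFb ?addbb // eq_sym addbb.
- move=> /In_map[q [<- _]]; rewrite ev_pair /= !decode_zero decode_vs /c init_state andbT.
  by case: eqP => //= _; rewrite eq_sym andbT addbb.
- move=> /In_map[s [<- _]]; rewrite ev_pair /= !decode_zero !andbT.
  case: (leqP p _) => hp //=; case hf : (fixed inp p) => //=.
  by rewrite decode_va ?gT // (fixed_init sw) // addbb.
- move=> /In_map[[s1 s2] [<- _]]; rewrite /ev big_cons big_nil addbF /= /guess.
  case: (leqP p _) => hp //=; case: (fixed inp p) => //=.
  by rewrite !decode_va ?gT //; case: eqP => //= ne; case: eqP => //= ->; apply/eqP.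
- case=> [<-|[]]; rewrite /ev !big_cons big_nil addbF /= /guess !decode_zero !andbT.
  case: (leqP p _) => hp //=; case: (fixed inp p) => //=.
  by rewrite !decode_va ?gT //; case: (sym_at _ _ _) => [[]|].
- move=> /In_map[b [<- _]]; rewrite /ev big_cons big_nil addbF /= /guess.
  case: (leqP p _) => hp //=; case: (leqP p.+1 _) => hp1 /=; last by rewrite andbF.
  rewrite !decode_va ?gT // !init_sym /fixed.
  case: (ltnP p (Tn + (2 * n0 + 2))) => h1 //=.
  have -> : (p < Tn) = false by lia.
  have -> : (p.+1 < Tn) = false by lia.
  case: (_ =P None) => [E|_]; last by rewrite !andbF.
  rewrite [nth _ _ (p.+1 - Tn)]nth_default ?andbF // leqNgt size_map; apply/negP => lt'.
  by move: E; rewrite (nth_map false) //; lia.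
- case=> [<-|[]]; rewrite ev_pair /= !decode_zero andbT decode_va ?gT //; last by lia.
  by rewrite sym_head /c acc.
Qed.

Lemma addb0_eq (a b : bool) : a (+) b = false -> a = b.
Proof. by case: a; case: b. Qed.

Section Sound.
Variable v : nat -> bool.
Hypotheses (v0 : v 0) (hv : qsat v).

Let ev_fam f t p : List.In f fams -> t <= Tn -> p <= 2 * Tn ->
  ev inp (fun i j => v i && v j) f t p = false.
Proof.
by move=> hf ht hp; apply: hv => //; apply: leq_trans grid_nvars; rewrite /gridS; lia.
Qed.

Let In_enum (I : finType) (i : I) : List.In i (enum I).
Proof.
have : i \in enum I by rewrite mem_enum.
by elim: (enum I) => //= a s IH; rewrite inE => /orP[/eqP->|/IH]; [left|right].
Qed.

Ltac pick_fam x := rewrite /fams !In_cat; repeat first [solve [left;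
  apply (proj2 (In_map _ _ _)); exists x; split; [reflexivity|apply: In_enum]] | right].
Ltac pick_single := rewrite /fams !In_cat; repeat first
  [solve [left; left; reflexivity] | solve [left; reflexivity] | right].

Lemma sound_y t r : t <= Tn -> v (vy inp t r) = v (vs inp t r.1) && v (va inp t Tn r.2).
Proof.
move=> ht; have := @ev_fam (fam_y r) t 0; rewrite ev_pair /= ht v0 andbT => H.
apply: addb0_eq; apply: H => //; pick_fam r.
Qed.

Lemma sound_state t q : t < Tn -> v (vs inp t.+1 q) =
  \big[addb/false]_(r <- enum [pred r : rule | (nxt r).1.1 == q]) v (vy inp t r).
Proof.
move=> ht; have := @ev_fam (fam_state q) t 0; rewrite /ev big_cons big_map /= ht v0 andbT => H.
apply: addb0_eq; rewrite -[RHS]H //; last exact: ltnW.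
  by congr addb; apply: eq_bigr => r _; rewrite andbT.
pick_fam q.
Qed.

Lemma sound_tape t p s : t < Tn -> 0 < p -> p < 2 * Tn -> v (va inp t.+1 p s) =
  \big[addb/false]_(r <- enum rule) (v (vy inp t r) &&
     (if sh (nxt r).2 p == Tn then s == (nxt r).1.2 else v (va inp t (sh (nxt r).2 p) s))).
Proof.
move=> ht h0 hp; have := @ev_fam (fam_tape s) t p.
rewrite /ev big_cons big_cat !big_map /= -!enumT ht h0 hp v0 andbT => H.
apply: addb0_eq; rewrite -[RHS]H; [|pick_fam s|
  exact: ltnW|exact: ltnW].
congr addb; first by rewrite andbT.
rewrite -big_split; apply: eq_bigr => r _ /=; rewrite andbT.
by case: (sh (nxt r).2 p =P Tn) => _ /=; rewrite ?addbF ?addFb // andbC.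
Qed.

Lemma sound_state0 q : v (vs inp 0 q) = (q == ord0).
Proof.
have := @ev_fam (fam_state0 q) 0 0; rewrite ev_pair /= v0 !andbT => H.
by apply: addb0_eq; apply: H => //; pick_fam q.
Qed.

Lemma sound_tape0 p s : p <= 2 * Tn -> fixed inp p -> v (va inp 0 p s) = fixed_sym inp p s.
Proof.
move=> hp hf; have := @ev_fam (fam_tape0 s) 0 p; rewrite ev_pair /= v0 hp hf !andbT => H.
by apply: addb0_eq; apply: H => //; pick_fam s.
Qed.

Definition guessed p : sym :=
  if v (va inp 0 p None) then None else Some (v (va inp 0 p (Some true))).

Lemma sound_guess p s : p <= 2 * Tn -> ~~ fixed inp p -> v (va inp 0 p s) = (guessed p == s).
Proof.
move=> hp hf; have g : guess inp 0 p by rewrite /guess hp.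
have hin : List.In fam_guess1 fams by pick_single.
have := ev_fam hin (leq0n Tn) hp; rewrite /ev !big_cons big_nil /= /guess hp hf v0 /= !andbT => H.
rewrite /guessed.
have D s1 s2 : s1 != s2 -> v (va inp 0 p s1) && v (va inp 0 p s2) = false.
  move=> ne; have := @ev_fam (fam_guess2 (s1, s2)) 0 p.
  rewrite /ev big_cons big_nil /= g ne addbF /=; apply=> //.
  pick_fam (s1, s2).
have := D None (Some false) isT; have := D None (Some true) isT.
have := D (Some false) (Some true) isT; have : false = false by [].
have {}H : [|| v (va inp 0 p None), v (va inp 0 p (Some false)) | v (va inp 0 p (Some true))].
  by move: H; do 3!case: (v _).
case: s => [[]|]; move: H; case: (v (va inp 0 p None)); case: (v (va inp 0 p (Some false)));
  by case: (v (va inp 0 p (Some true))).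
Qed.

Lemma sound_blank p : p.+1 <= 2 * Tn -> ~~ fixed inp p -> ~~ fixed inp p.+1 ->
  guessed p = None -> guessed p.+1 = None.
Proof.
move=> hp h1 h2 E; case E2: (guessed p.+1) => [b|] //.
have hin : List.In (fam_blank b) fams by pick_fam b.
have := ev_fam hin (leq0n Tn) (ltnW hp); rewrite /ev big_cons big_nil addbF /=.
by rewrite /guess (ltnW hp) hp h1 h2 /= !sound_guess ?(ltnW hp) // E E2 !eqxx.
Qed.

Lemma tableau_sound : exists2 w, size w <= W inp &
  cf_head (iter Tn (@tm_step M) (init_config M (enc_pair (rev inp) w))) = Some true.
Proof.
pose base := Tn + (2 * n0 + 2).
pose z := [seq guessed (base + j) | j <- iota 0 (W inp)].
have zE j : j < W inp -> nth None z j = guessed (base + j).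
  by move=> lt; rewrite (nth_map 0) ?size_iota // nth_iota.
have nf p : ~~ fixed inp p = (base <= p) && (p < base + W inp).
  by rewrite /fixed negb_or -leqNgt -ltnNge.
have [sw wE] := @read_word_nth z (ltac:(
  move=> j; rewrite size_map size_iota => lt; rewrite !zE //; last exact: ltnW;
  rewrite addnS; apply: sound_blank; rewrite ?nf /base; lia)).
rewrite size_map size_iota in sw.
exists (read_word z) => //; set w := read_word z.
pose c t := iter t (@tm_step M) (init_config M (enc_pair (rev inp) w)).
(* A light cone: each cell depends on its neighbours, so the correct region loses one cell on both
   sides per step. At time [Tn] the head cell [Tn] is what remains. *)
have inv t : t <= Tn -> (forall q, v (vs inp t q) = (cf_state (c t) == q)) /\
    (forall p s, t <= p -> p <= 2 * Tn - t -> v (va inp t p s) = (sym_at Tn (c t) p == s)).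
  elim: t => [|t IH] lt.
    split=> [q|p s _]; first by rewrite sound_state0 /c init_state eq_sym.
    rewrite subn0 => hp; case hf: (fixed inp p).
      by rewrite sound_tape0 // (fixed_init sw).
    rewrite sound_guess ?hf //; congr (_ == s).
    have := nf p; rewrite hf => /esym/andP[b1 b2].
    rewrite init_sym ifF; last by rewrite /base in b1; lia.
    rewrite /enc_pair (map_cat _ (enc_bits _)) (nth_cat _ (map _ (enc_bits _))) size_map size_enc_bits size_rev ifF; last first.
      by rewrite /base in b1; lia.
    rewrite -wE zE; last by rewrite /base in b2 *; lia.
    by congr guessed; rewrite /base in b1 *; lia.
  have [IHs IHt] := IH (ltnW lt).
  have Ey r : v (vy inp t r) = (scan_pair (c t) == r).
    rewrite sound_y ?(ltnW lt) // IHs IHt; try lia.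
    by rewrite sym_head; case: r.
  split=> [q|p s h1 h2].
    rewrite sound_state //; under eq_bigr => r _ do rewrite Ey -(andbT (_ == r)).
    by rewrite big_enum_pick inE /= andbT step_state.
  rewrite sound_tape //; try lia.
  under eq_bigr => r _ do rewrite Ey.
  rewrite big_enum_pick -[c t.+1]/(tm_step (c t)) step_sym /=; last by lia.
  case: (nxt _) => -[q' w'] d /=; case: eqP => h3; first exact: eq_sym.
  by apply: IHt; case: (d) h3 => /=; lia.
have [_ /(_ Tn (Some true))] := inv Tn (leqnn _).
rewrite sym_head => H; apply/eqP; rewrite -H; try lia.
have hin : List.In fam_accept fams by pick_single.
have := ev_fam hin (leq0n Tn) (leq0n _); rewrite ev_pair /= v0 andbT.
exact: addb0_eq.
Qed.
End Sound.
End Tableau.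

(** * The quadratic system as linear constraints on a matrix *)

Section Quadratic.
Variable M : TM.
Variables T W : seq bool -> nat.

Definition nfams := size (fams M T W).
(* The functional of equation c = (k, i, j), family k at index (i, j), on matrices u |-> X u
   with entry (u %% N, u %/ N). *)
Definition quad inp c u :=
  let N := nvars M T inp in
  let i := c %/ nfams %% N in let j := c %/ nfams %/ N in
  \big[addb/false]_(k <- iota 0 nfams) ((c %% nfams == k) &&
    \big[addb/false]_(m <- nth [::] (fams M T W) k)
      (mg m inp i j && ((u %% N == ma m inp i j) && (u %/ N == mb m inp i j)))).

Variable inp : seq bool.
Hypothesis WT : 2 * size inp + 2 + W inp <= T inp.
Local Notation N := (nvars M T inp).

(** [quad] compares with the entries of an [N] by [N] matrix, so a monomial with a variable out of
    range would silently vanish. *)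
Lemma fams_bound f m i j : List.In f (fams M T W) -> List.In m f -> i < N -> j < N ->
  mg m inp i j -> ma m inp i j < N /\ mb m inp i j < N.
Proof.
move=> hf hm hi hj; move: hf hm.
have z0 : 0 < N by [].
have gv t p s : t <= T inp -> p <= 2 * T inp -> va M T inp t p s < N.
  move=> ht hp; apply: (vidx_lt WT); rewrite /gridS /kinds; try lia.
  by have := sidx_lt s; lia.
have gs t (q : 'I_(tm_q M).+1) : t <= T inp -> vs T inp t q < N.
  move=> ht; apply: (vidx_lt WT); rewrite /gridS /kinds; try lia.
  by have := ltn_ord q; lia.
have gy t (r : 'I_(tm_q M).+1 * sym) : t <= T inp -> vy T inp t r < N.
  by move=> ht; apply: (vidx_lt WT); [rewrite /gridS; lia|rewrite /gridS; lia|apply: (vy_kind WT)].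
rewrite /fams !In_cat => -[|[|[|[|[|[|[|[|[|]]]]]]]]].
- by case=> [<-|[<-|[]]] /= [<-|[<-|[]]].
- move=> /In_map[r [<- _]] [<-|[<-|[]]] /= ht; split=> //; try by [apply: gs|apply: gy].
  by apply: gv => //; lia.
- move=> /In_map[q [<- _]] [<-|/In_map[r [<- _]]] /= ht; split=> //.
    exact: gs.
  exact/gy/ltnW.
- move=> /In_map[s [<- _]] [<-|/In_cat[]/In_map[r [<- _]]] /=.
  + by move=> /and3P[h1 h2 h3]; split=> //; apply: gv => //; apply: ltnW.
  + by move=> /andP[/and3P[h1 h2 h3] _]; split=> //; apply/gy/ltnW.
  + move=> /andP[/and3P[h1 h2 h3] _]; split; first exact/gy/ltnW.
    by apply: gv; [apply: ltnW|case: (nxt r).2 => /=; lia].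
- by move=> /In_map[q [<- _]] [<-|[<-|[]]] /= ht; split=> //; apply: gs.
- move=> /In_map[s [<- _]] [<-|[<-|[]]] //= /andP[hp _]; split=> //; exact: gv.
- move=> /In_map[s [<- _]] [<-|[]] //= /andP[/andP[hp _] _]; split=> //; exact: gv.
- by case=> [<-|[]] [<-|[<-|[<-|[<-|[]]]]] //= /andP[hp _]; split=> //; exact: gv.
- by move=> /In_map[b [<- _]] [<-|[]] //= /andP[/andP[h1 _] /andP[h2 _]]; split; apply: gv.
- case=> [<-|[]] [<-|[<-|[]]] //= _; split=> //; apply: gv => //; lia.
Qed.

Lemma cw_quad X c : c < nfams * (N * N) -> cw (N * N) (quad inp) X c =
  ev inp (fun i j => X (i + N * j)) (nth [::] (fams M T W) (c %% nfams))
    (c %/ nfams %% N) (c %/ nfams %/ N).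
Proof.
move=> hc; have f0 : 0 < nfams by [].
set f := nth _ _ _; set i := _ %% N; set j := _ %/ N.
have hf : List.In f (fams M T W).
  have : c %% nfams < nfams by rewrite ltn_mod.
  rewrite /f /nfams; elim: (fams M T W) (c %% _) => [|a s IH] [|k] //= lt; first by left.
  by right; apply: IH.
have hi : i < N by rewrite ltn_mod.
have hj : j < N by rewrite ltn_divLR // ltn_divLR // mulnC.
have qE u : quad inp c u = \big[addb/false]_(m <- f)
    (mg m inp i j && ((u %% N == ma m inp i j) && (u %/ N == mb m inp i j))).
  rewrite /quad -/i -/j (xsum_iota nfams (fun k => (c %% nfams == k) &&
    \big[addb/false]_(m <- nth [::] (fams M T W) k)
      (mg m inp i j && ((u %% N == ma m inp i j) && (u %/ N == mb m inp i j))))).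
  rewrite (bigD1 (Ordinal (ltn_pmod c f0))) //= eqxx /= [X in _ (+) X]big1 ?addbF // => k ne.
  by rewrite eq_sym (_ : (k == _ :> nat) = false) //; apply/negbTE.
have : forall m, List.In m f -> List.In m f by [].
rewrite /cw; under eq_bigr => u _ do rewrite qE big_distrl /=.
rewrite exchange_big /ev /=; move: {-2}f; elim=> [|m s IH] hs; first by rewrite !big_nil.
rewrite !big_cons IH; last by move=> m' h; apply: hs; right.
congr addb; case g: (mg m inp i j) => /=; last by rewrite big1.
have [ba bb] := fams_bound hf (hs m (or_introl erefl)) hi hj g.
rewrite (xsum_ord_mul N N (fun u => ((u %% N == ma m inp i j) && (u %/ N == mb m inp i j)) && X u)).
rewrite (bigD1 (Ordinal ba)) //= (bigD1 (Ordinal bb)) //=.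
have [-> ->] := digit0 (mb m inp i j) ba; rewrite !eqxx /=.
rewrite big1 => [|b ne]; last first.
  have [-> ->] := digit0 b ba; rewrite (_ : (b == mb m inp i j :> nat) = false) ?andbF //.
  by apply/negbTE.
rewrite addbF big1 ?addbF // => a ne; rewrite big1 // => b _.
have [-> ->] := digit0 b (ltn_ord a); rewrite (_ : (a == ma m inp i j :> nat) = false) //.
by apply/negbTE.
Qed.

Definition nquad := nfams * (N * N).

Lemma quad_ev X k i j : sat (N * N) nquad (quad inp) X -> k < nfams -> i < N -> j < N ->
  ev inp (fun i j => X (i + N * j)) (nth [::] (fams M T W) k) i j = false.
Proof.
move=> hs hk hi hj; have := hs (k + nfams * (i + N * j)).
have lt : k + nfams * (i + N * j) < nquad.
  rewrite /nquad; have : nfams * (i + N * j).+1 <= nfams * (N * N).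
    rewrite leq_mul //; have : N * j.+1 <= N * N by [rewrite leq_mul]; rewrite mulnS; lia.
  by rewrite mulnS; lia.
rewrite cw_quad //; have [-> ->] := digit0 (i + N * j) hk; have [-> ->] := digit0 j hi.
exact.
Qed.

Lemma quad_sound X : sat (N * N) nquad (quad inp) X -> 0 < wt (N * N) X ->
  (forall i j, i < N -> j < N -> X (i + N * j) = X (j + N * i)) /\
  forall x : nat -> bool, (forall i j, i < N -> j < N -> X (i + N * j) = x i && x j) ->
    exists2 w, size w <= W inp &
    cf_head (iter (T inp) (@tm_step M) (init_config M (enc_pair (rev inp) w))) = Some true.
Proof.
move=> hs X0; split=> [i j hi hj|x hx].
  (* Families 0 and 1 are [fam_sym] and [fam_idem]; the latter transfers truth from any [x i] to the
     constant [x 0]. *)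
  have := quad_ev (k := 0) hs isT hi hj; rewrite ev_pair /=; exact: addb0_eq.
have xx i : i < N -> x i -> x 0.
  move=> hi xi; have := quad_ev (k := 1) hs isT hi hi; rewrite ev_pair /= /zero !hx // xi andbT.
  by case: (x 0).
have x0 : x 0.
  have [u lt Xu] := wt_gt0P _ _ X0.
  have l1 : u %% N < N by rewrite ltn_mod.
  have l2 : u %/ N < N by rewrite ltn_divLR.
  move: Xu; rewrite (divn_eq u N) addnC mulnC hx // => /andP[+ _]; exact: xx.
apply: (tableau_sound WT x0) => f i j hf hi hj.
have [k hk <-] : exists2 k, k < nfams & nth [::] (fams M T W) k = f.
  rewrite /nfams; elim: (fams M T W) hf => //= a s IH [->|/IH[k hk E]]; first by exists 0.
  by exists k.+1.
rewrite -[RHS](quad_ev hs hk hi hj) /ev.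
have : forall m, List.In m (nth [::] (fams M T W) k) -> List.In m (nth [::] (fams M T W) k) by [].
have hin : List.In (nth [::] (fams M T W) k) (fams M T W).
  by move: hk; rewrite /nfams; elim: (fams M T W) k => [|a s IH] [|k] //= lt; [left|right; apply: IH].
move: {-2}(nth _ _ _); elim=> [|m s IH] hm; first by rewrite !big_nil.
rewrite !big_cons IH; last by move=> m' h; apply: hm; right.
congr addb; case g: (mg m inp i j) => //=.
have [ba bb] := fams_bound hin (hm m (or_introl erefl)) hi hj g.
by rewrite hx.
Qed.

Lemma quad_complete w : size w <= W inp ->
  cf_head (iter (T inp) (@tm_step M) (init_config M (enc_pair (rev inp) w))) = Some true ->
  exists v : nat -> bool, v 0 /\ sat (N * N) nquad (quad inp) (sqvec N v).
Proof.
move=> sw acc; have [v [v0 hv]] := tableau_complete WT sw acc.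
exists v; split=> // c hc; rewrite cw_quad //.
have f0 : 0 < nfams by [].
have hi : c %/ nfams %% N < N by rewrite ltn_mod.
have hj : c %/ nfams %/ N < N by rewrite ltn_divLR // ltn_divLR // mulnC.
have hf : List.In (nth [::] (fams M T W) (c %% nfams)) (fams M T W).
  have : c %% nfams < nfams by rewrite ltn_mod.
  by rewrite /nfams; elim: (fams M T W) (c %% _) => [|a s IH] [|k] //= lt; [left|right; apply: IH].
rewrite -[RHS](hv _ _ _ hf hi hj) /ev.
have H m : List.In m (nth [::] (fams M T W) (c %% nfams)) ->
    mg m inp (c %/ nfams %% N) (c %/ nfams %/ N) ->
    ma m inp (c %/ nfams %% N) (c %/ nfams %/ N) < N by move=> hm g; have [] := fams_bound hf hm hi hj g.
elim: (nth [::] _ _) H => [|m s IH] H; first by rewrite !big_nil.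
rewrite !big_cons IH; last by move=> m' h; apply: H; right.
congr addb; case g: (mg m inp _ _) => //=.
have ba := H m (or_introl erefl) g.
by rewrite /sqvec; have [-> ->] := digit0 (mb m inp (c %/ nfams %% N) (c %/ nfams %/ N)) ba.
Qed.
End Quadratic.

(** * The hard instances *)

Section TensorNCP.
Variables (I P R S : nat) (K q : nat -> nat -> bool) (wc : nat).
Hypotheses (I0 : 0 < I) (wc0 : 0 < wc).

(* Row r = (f, c, rho): for f < S it applies constraint c to slot f of the tensor, the other slots
   being frozen at the digits of rho; for f = S it reads the entry 0, which [target] sets to 1. *)
Definition row r u :=
  let f := r %% S.+1 in let c := r %/ S.+1 %% R in let rho := r %/ S.+1 %/ R in
  if f < S then [&& u %% I ^ f == rho %% I ^ f, u %/ I ^ f.+1 == rho %/ I ^ f.+1 &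
                   q c (u %/ I ^ f %% I)]
  else u == 0.
Definition nrows := S.+1 * (R * I ^ S).
Definition npos := P ^ S + wc * nrows.
(** The tensor code comes first, then every row [wc] times, so that a single violated row costs at
    least [wc]. *)
Definition gen p u := if p < P ^ S then tcode I P K S p u else row ((p - P ^ S) %/ wc) u.
Definition target p := (P ^ S <= p) && ((p - P ^ S) %/ wc %% S.+1 == S).

Lemma wt_npos (F : nat -> bool) : wt npos F = wt (P ^ S) F +
  \sum_(c < wc) \sum_(r < nrows) F (P ^ S + (c + wc * r)).
Proof.
rewrite /wt /npos big_split_ord /=; congr addn.
by rewrite (sum_ord_mul wc nrows (fun i => nat_of_bool (F (P ^ S + i)))).
Qed.

Lemma gen_row c r u : c < wc -> gen (P ^ S + (c + wc * r)) u = row r u.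
Proof. by move=> lt; rewrite /gen ltnNge leq_addr addKn (digit0 r lt).2. Qed.

Lemma target_row c r : c < wc -> target (P ^ S + (c + wc * r)) = (r %% S.+1 == S).
Proof. by move=> lt; rewrite /target leq_addr addKn (digit0 r lt).2. Qed.

Definition bad Z p := cw (I ^ S) gen Z p != target p.
Definition bad_row Z r := cw (I ^ S) row Z r != (r %% S.+1 == S).

Lemma wt_bad Z : wt npos (bad Z) = wt (P ^ S) (cw (I ^ S) (tcode I P K S) Z) +
  wc * wt nrows (bad_row Z).
Proof.
rewrite wt_npos; congr addn.
  apply: wt_ext => p lp; rewrite /bad /target leqNgt lp /= eqbF_neg negbK.
  by apply: eq_bigr => u _; rewrite /gen lp.
have -> : wc * wt nrows (bad_row Z) = \sum_(c < wc) wt nrows (bad_row Z).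
  by rewrite sum_nat_const card_ord.
apply: eq_bigr => c _.
apply: eq_bigr => r _; rewrite /bad /bad_row target_row //; congr (_ != _).
by apply: eq_bigr => u _; rewrite gen_row.
Qed.

Lemma cw_row Z l c rho : l < S -> c < R -> rho < I ^ S ->
  cw (I ^ S) row Z (l + S.+1 * (c + R * rho)) =
  cw I q (fun i => Z (rho %% I ^ l + I ^ l * (i + I * (rho %/ I ^ l.+1)))) c.
Proof.
move=> lS cR lrho; set lo := rho %% I ^ l; set hi := rho %/ I ^ l.+1.
have llo : lo < I ^ l by rewrite ltn_mod expn_gt0 I0.
have lhi : hi < I ^ (S - l.+1).
  by rewrite ltn_divLR ?expn_gt0 ?I0 // -expnD subnK.
have ES : I ^ S = I ^ l * (I * I ^ (S - l.+1)) by rewrite -expnS -expnD; congr expn; lia.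
have lt1 : l < S.+1 by lia.
have [e1 e2] := digit0 (c + R * rho) lt1; have [e3 e4] := digit0 rho cR.
rewrite /cw /row e1 e2 e3 e4 lS ES -/lo -/hi.
rewrite (xsum_ord_mul (I ^ l) (I * I ^ (S - l.+1)) (fun u =>
  [&& u %% I ^ l == lo, u %/ I ^ l.+1 == hi & q c (u %/ I ^ l %% I)] && Z u)).
rewrite (bigD1 (Ordinal llo)) //= [X in _ (+) X]big1 ?addbF; last first.
  move=> lo' ne; rewrite big1 // => x _; rewrite (digit0 x (ltn_ord lo')).1.
  by rewrite (_ : (lo' == lo :> nat) = false) //; apply/negbTE.
rewrite (xsum_ord_mul I (I ^ (S - l.+1)) (fun x =>
  [&& (lo + I ^ l * x) %% I ^ l == lo, (lo + I ^ l * x) %/ I ^ l.+1 == hi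
   & q c ((lo + I ^ l * x) %/ I ^ l %% I)] && Z (lo + I ^ l * x))).
apply: eq_bigr => i _.
rewrite (bigD1 (Ordinal lhi)) //= [X in _ (+) X]big1 ?addbF; last first.
  move=> h ne; have [_ j2] := digit0 (i + I * h) llo.
  rewrite expnSr !divnMA j2 (digit0 h (ltn_ord i)).2.
  by rewrite (_ : (h == hi :> nat) = false) ?andbF //; apply/negbTE.
have [j1 j2] := digit0 (i + I * hi) llo; have [i1 i2] := digit0 hi (ltn_ord i).
by rewrite expnSr !divnMA j1 j2 i1 i2 !eqxx.
Qed.

Lemma cw_affine Z r : r %% S.+1 = S -> cw (I ^ S) row Z r = Z 0.
Proof.
move=> E; have lt : 0 < I ^ S by rewrite expn_gt0 I0.
rewrite /cw /row E ltnn (bigD1 (Ordinal lt)) //= big1 ?addbF // => u ne.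
by rewrite (_ : (u == 0 :> nat) = false) //; apply/negbTE.
Qed.

Lemma good_rows Z : 0 < R -> wt nrows (bad_row Z) = 0 -> tsat I R q S Z /\ Z 0.
Proof.
move=> R0 hb; have good r : r < nrows -> cw (I ^ S) row Z r = (r %% S.+1 == S).
  move=> lt; apply/eqP/negbNE/negP => ne; have : 0 < wt nrows (bad_row Z).
    by apply/wt_gt0P; exists r.
  by rewrite hb.
split=> [l c lo hi lS cR llo lhi|].
  (* A row number that freezes [lo] below slot [l] and [hi] above it, with digit 0 in the slot
     itself. *)
  pose rho := lo + I ^ l * (0 + I * hi).
  have lrho : rho < I ^ S.
    have -> : I ^ S = I ^ l * (I * I ^ (S - l.+1)) by rewrite -expnS -expnD; congr expn; lia.
    apply: (@leq_trans (I ^ l * (I * hi).+1)); first by rewrite mulnS /rho; lia.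
    by rewrite leq_mul //; have : I * hi.+1 <= I * I ^ (S - l.+1); [rewrite leq_mul|rewrite mulnS; lia].
  have lt1 : l < S.+1 by lia.
  have [r1 r2] := digit0 (0 + I * hi) llo; have [r3 r4] := digit0 hi I0.
  have := cw_row Z lS cR lrho; rewrite expnSr divnMA r1 r2 r4 => <-.
  rewrite good; first by rewrite (digit0 _ lt1).1; lia.
  rewrite /nrows; have : R * rho.+1 <= R * I ^ S by rewrite leq_mul.
  have : S.+1 * (c + R * rho).+1 <= S.+1 * (R * rho.+1) by rewrite leq_mul // mulnS; lia.
  move=> h1 h2; have : S.+1 * (R * rho.+1) <= S.+1 * (R * I ^ S) by rewrite leq_mul.
  by rewrite mulnS in h1; lia.
have lt : S < nrows.
  rewrite /nrows; apply: (@leq_trans (S.+1 * 1)); first by rewrite muln1.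
  by rewrite leq_mul // muln_gt0 R0 expn_gt0 I0.
by rewrite -(@cw_affine Z S) ?modn_small // good ?modn_small.
Qed.

Lemma tvec_rows y : sat I R q y -> y 0 -> wt nrows (bad_row (tvec I y S)) = 0.
Proof.
move=> hs y0; rewrite /wt big1 // => r _; rewrite /bad_row.
apply/eqP; rewrite eqb0 negbK; apply/eqP.
case: (r %% S.+1 =P S) => [/cw_affine ->|/eqP ne].
  have tv0 s : tvec I y s 0 by elim: s => //= s IH; rewrite mod0n div0n y0.
  by rewrite tv0.
set l := r %% S.+1 in ne; set c := r %/ S.+1 %% R; set rho := r %/ S.+1 %/ R.
have lS : l < S by have : l < S.+1; [rewrite ltn_mod|lia].
have lr := ltn_ord r; rewrite {2}/nrows in lr.
have R0 : 0 < R by case: (posnP R) lr => // ->; rewrite mul0n muln0.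
have cR : c < R by rewrite ltn_mod.
have lrho : rho < I ^ S by rewrite /rho !ltn_divLR // -mulnA mulnC mulnAC mulnA in lr *; lia.
have -> : (r : nat) = l + S.+1 * (c + R * rho).
  by rewrite /l /c /rho (addnC (_ %% R)) (mulnC R) -divn_eq addnC mulnC -divn_eq.
rewrite cw_row //.
apply: (tsat_tvec I0 hs lS cR).
  by rewrite ltn_mod expn_gt0 I0.
by rewrite ltn_divLR ?expn_gt0 ?I0 // -expnD subnK.
Qed.
End TensorNCP.

Section Gap.
Variables (M : TM) (T W : seq bool -> nat) (a t tau : nat).

Definition Nv inp := nvars M T inp.
Definition Jv inp := up_log 2 (16 * Nv inp).
Definition Mv inp := 2 ^ Jv inp * Nv inp.
Definition Pv inp := (Mv inp * (Mv inp * 2 ^ Jv inp)) ^ t.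
Definition Cv inp := codeT (Nv inp) (Jv inp) t.
Definition Dv inp := Pv inp %/ 2.
Definition Gv inp := (Nv inp * Nv inp) ^ tau.
(** One half pays for the weight of a rank one solution, the other for the gates reading column
    wires, at most [Gv inp] of them; [D_ge] makes this fit. *)
Definition kv inp := 2 * (Dv inp ^ 2) ^ tau.
(** Chosen so that one violated constraint alone exceeds [a] times the budget [kv]. *)
Definition wcv inp := (a * kv inp).+1.
Definition nv inp := npos (Nv inp * Nv inp) (Pv inp * Pv inp) (nquad M T W inp) tau (wcv inp).
Definition Av inp := gen (Nv inp * Nv inp) (Pv inp * Pv inp) (nquad M T W inp) tau
  (sqcode (Nv inp) (Pv inp) (Cv inp)) (quad M T W inp) (wcv inp).
Definition bv inp := target (Pv inp * Pv inp) tau (wcv inp).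
Definition instance inp := ncp_lsm (nv inp) (Gv inp) (Av inp) (bv inp).

Variable inp : seq bool.
Hypothesis WT : 2 * size inp + 2 + W inp <= T inp.
Hypothesis ht : 12 * 31 ^ t <= 32 ^ t.
Hypothesis htau : (2 * a).+1 * 4 ^ tau <= 5 ^ tau.

Definition accepts := exists2 w, size w <= W inp &
  cf_head (iter (T inp) (@tm_step M) (init_config M (enc_pair (rev inp) w))) = Some true.

Local Notation N := (Nv inp).
Local Notation P := (Pv inp).
Local Notation C := (Cv inp).
Local Notation D := (Dv inp).

Lemma N_gt0 : 0 < N. Proof. by []. Qed.

Lemma H_ge : 16 * N <= 2 ^ Jv inp.
Proof. exact: up_logP. Qed.

Lemma t_gt0 : 0 < t.
Proof. by move: ht; case: t. Qed.

Lemma P_even : P = 2 * D.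
Proof.
rewrite /Dv mulnC divnK // /Pv; have J0 : 0 < Jv inp by rewrite /Jv up_log_gt0; have := N_gt0; lia.
by rewrite -(prednK t_gt0) expnS -(prednK J0) expnS /Mv; apply/dvdn_mulr/dvdn_mull/dvdn_mull/dvdn_mulr.
Qed.

Lemma D_ge : N <= D.
Proof.
have h : 2 * N <= P.
  have h1 : 2 * N <= Mv inp by rewrite /Mv leq_mul //; have := H_ge; have := N_gt0; lia.
  have h2 : 0 < 2 ^ Jv inp by rewrite expn_gt0.
  have h0 := N_gt0.
  have h3 : Mv inp <= Mv inp * (Mv inp * 2 ^ Jv inp).
    by rewrite leq_pmulr // muln_gt0 h2 andbT; lia.
  apply: leq_trans h1 (leq_trans h3 _); rewrite /Pv -{1}(expn1 (_ * _)) leq_pexp2l ?t_gt0 //.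
  by have m0 : 0 < Mv inp; [rewrite /Mv muln_gt0 h2|rewrite muln_gt0 m0 muln_gt0 m0 h2].
by rewrite P_even leq_pmul2l in h.
Qed.

Lemma code_bounds x : 0 < wt N x ->
  wt P (cw N C x) <= D /\ 11 * D <= 12 * wt P (cw N C x).
Proof.
move=> x0; have := balanced N_gt0 H_ge ht x0.
by rewrite -/(Cv inp) -[(_ * _) ^ t]/P P_even => -[h1 h2]; lia.
Qed.

Lemma nv_gt0 : 0 < nv inp.
Proof.
by rewrite ltn_addr // expn_gt0 muln_gt0; have := D_ge; have := P_even; have := N_gt0; lia.
Qed.

Lemma wt_mismatch Z : wt (nv inp) (fun p => cw (Gv inp) (Av inp) Z p != bv inp p) =
  wt ((P * P) ^ tau) (cw (Gv inp) (tcode (N * N) (P * P) (sqcode N P C) tau) Z) +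
  wcv inp * wt (nrows (N * N) (nquad M T W inp) tau)
    (bad_row (N * N) (nquad M T W inp) tau (quad M T W inp) Z).
Proof. exact: wt_bad. Qed.

Lemma instance_valid : lsm_valid (instance inp).
Proof.
exact: ncp_valid nv_gt0.
Qed.

Lemma nquad_gt0 : 0 < nquad M T W inp.
Proof. by []. Qed.

Lemma instance_yes w : accepts -> lsm_opt (instance inp) w -> w <= kv inp.
Proof.
move=> [wit sw acc] [_ hmin].
have [v [v0 hs]] := quad_complete WT sw acc.
have I0 : 0 < N * N by [].
pose Z := tvec (N * N) (sqvec N v) tau.
apply: leq_trans (hmin _ (ncp_upper (Gv inp) (Av inp) (bv inp) nv_gt0 Z)) _.
rewrite wt_mismatch (tvec_rows _ I0 (ltn0Sn a) hs); last first.
  by rewrite /sqvec mod0n div0n v0.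
rewrite muln0 addn0 wt_tvec // wt_sqvec.
have vN : 0 < wt N v by apply/wt_gt0P; exists 0.
have [h1 _] := code_bounds vN.
rewrite /kv mulSn mul1n leq_add //; first by rewrite !leq_expW.
apply: (@leq_trans (Gv inp)).
  rewrite -[X in _ <= X]card_ord -sum1_card; apply: leq_sum => i _; exact: leq_b1.
by rewrite /Gv leq_expW // -mulnn leq_mul // D_ge.
Qed.

(** Either a repeated row is violated and its copies exceed the bound, or [Z] is a nonzero tensor
    over the solution space. Without an accepting witness that space contains no rank one matrix, so
    the amplified gap applies. *)
Lemma instance_no w : ~ accepts -> lsm_opt (instance inp) w -> a * kv inp < w.
Proof.
move=> nacc [/(ncp_lower nv_gt0)[Z hZ] _]; apply: leq_trans hZ.
have I0 : 0 < N * N by [].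
rewrite wt_mismatch.
case: (posnP (wt (nrows (N * N) (nquad M T W inp) tau)
    (bad_row (N * N) (nquad M T W inp) tau (quad M T W inp) Z))) => [E|gt]; last first.
  by apply: leq_trans (leq_addl _ _); rewrite -[X in X <= _]/(wcv inp) leq_pmulr.
have [hs Z0] := good_rows I0 (ltn0Sn a) nquad_gt0 E; apply: leq_trans (leq_addr _ _).
have D0 : 0 < D by apply: leq_trans D_ge.
(* 5/4 of [D ^ 2], rounded up. The available factor is 3/2 times the square of 11/12, that is
   363/288. *)
pose d := (5 * D ^ 2 + 3) %/ 4.
have hd y : sat (N * N) (nquad M T W inp) (quad M T W inp) y -> 0 < wt (N * N) y ->
    d <= wt (P * P) (cw (N * N) (sqcode N P C) y).
  move=> hy y0; have [sym rk] := quad_sound WT hy y0.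
  pose dd := (11 * D + 11) %/ 12.
  have cd x : 0 < wt N x -> dd <= wt P (cw N C x).
    by move=> /code_bounds[_ h]; rewrite /dd; lia.
  have := rank_gap N_gt0 cd sym y0.
  have h0 : ~ exists x : nat -> bool, forall i j, i < N -> j < N -> y (i + N * j) = x i && x j.
    by move=> [x hx]; apply: nacc; apply: rk hx.
  move=> /(_ h0); set X := wt _ _ => h.
  have h12 : 11 * D <= 12 * dd by rewrite /dd; lia.
  have h2 : 121 * (D * D) <= 144 * (dd * dd).
    by have := leq_mul h12 h12; lia.
  by rewrite /d -mulnn; lia.
have Zn : 0 < wt ((N * N) ^ tau) Z.
  by apply/wt_gt0P; exists 0; rewrite // expn_gt0.
have := tensor_gap I0 hd hs Zn; apply: leq_trans.
have d4 : 5 * D ^ 2 <= 4 * d by rewrite /d; lia.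
have := leq_expW tau d4; rewrite (expnMn 5) (expnMn 4) => h.
have : (2 * a).+1 * 4 ^ tau * (D ^ 2) ^ tau <= 4 ^ tau * d ^ tau.
  by apply: leq_trans h; rewrite leq_mul.
rewrite mulnAC (mulnC _ (4 ^ tau)) leq_pmul2l ?expn_gt0 // => {}h.
apply: leq_trans h; have : 0 < (D ^ 2) ^ tau by rewrite expn_gt0 expn_gt0 D0.
by rewrite /kv; move: (_ ^ tau) => Y Y0; nia.
Qed.
End Gap.

(** * Evaluability of the instances *)

Lemma comp_half F : evaluable F -> evaluable (fun inp e => (F inp e)./2).
Proof. by move=> hF; apply: comp_ext (comp_div hF (comp_const 2)) => inp e; rewrite divn2. Qed.

Lemma compb_or a b : compb a -> compb b -> compb (fun inp e => a inp e || b inp e).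
Proof.
move=> ha hb; apply: comp_ext (compb_neg (compb_and (compb_neg ha) (compb_neg hb))) => inp e.
by rewrite negb_and !negbK.
Qed.

Lemma compb_imply a b : compb a -> compb b -> compb (fun inp e => a inp e ==> b inp e).
Proof. by move=> ha hb; apply: comp_ext (compb_or (compb_neg ha) hb) => inp e; rewrite implybE. Qed.

Lemma compb_if c a b : compb c -> compb a -> compb b ->
  compb (fun inp e => if c inp e then a inp e else b inp e).
Proof.
by move=> hc ha hb; apply: comp_ext (comp_if hc ha hb) => inp e; case: (c inp e).
Qed.

Lemma compb_seq (A : Type) (s : seq A) (b : A -> seq bool -> seq nat -> bool) :
  (forall a, List.In a s -> compb (b a)) ->
  compb (fun inp e => \big[addb/false]_(a <- s) b a inp e).
Proof.
elim: s => [|a s IH] h.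
  by apply: comp_ext (comp_const 0) => inp e; rewrite big_nil.
have := compb_xor (h a (or_introl erefl)) (IH (fun a' h' => h a' (or_intror h'))).
by apply: comp_ext => inp e; rewrite big_cons.
Qed.

Ltac evt := repeat first
  [ assumption | exact: comp_size | exact: comp_head | exact: (comp_behead comp_head) | exact: comp_const
  | match goal with H : evaluable _ |- _ => exact (comp_behead H) end
  | apply: comp_add | apply: comp_sub | apply: comp_mul | apply: comp_div | apply: comp_mod
  | apply: compb_and | apply: compb_or | apply: compb_neg | apply: compb_imply
  | apply: compb_odd | apply: compb_pow2 | apply: comp_input
  | apply: compb_eq | apply: compb_leq | apply: comp_half | apply: comp_exp | apply: comp_succ ].

(** Exactly one power of two lies in the half-open interval from [X] to [2 * X], and a bounded sum
    finds it. This makes [2 ^ Jv] evaluable without a logarithm. *)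
Lemma pow2_up X : 1 < X -> 2 ^ up_log 2 X = \sum_(d < 2 * X) (pow2 d && (X <= d)) * d.
Proof.
move=> X1; set j := up_log 2 X.
have h1 : X <= 2 ^ j by apply: up_logP.
have h2 : 2 ^ j < 2 * X.
  have j0 : 0 < j by rewrite up_log_gt0 X1.
  by rewrite -(prednK j0) expnS ltn_pmul2l //; apply: up_log_gtn.
rewrite (bigD1 (Ordinal h2)) //= pow2_exp h1 mul1n big1 ?addn0 // => d ne.
case: (boolP (pow2 d && (X <= d))) => // /andP[/eqP E le]; case/eqP: ne; apply: val_inj => /=.
have := ltn_ord d; rewrite E in le *; set k := logn _ _ in le *.
case: (ltngtP k j) => [lt|lt|->//] h3.
- by have : 2 ^ k.+1 <= 2 ^ j; [rewrite leq_exp2l|rewrite expnS; lia].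
- by have : 2 ^ j.+1 <= 2 ^ k; [rewrite leq_exp2l|rewrite expnS; lia].
Qed.

Section Eval.
Variables (M : TM) (T W : seq bool -> nat) (a t tau : nat).
Hypotheses (hT : evaluable (fun inp _ => T inp)) (hW : evaluable (fun inp _ => W inp)).
Implicit Types g : seq bool -> seq nat -> nat.

Lemma ev_vidx g1 g2 g3 : evaluable g1 -> evaluable g2 -> evaluable g3 ->
  evaluable (fun inp e => vidx M T inp (g1 inp e) (g2 inp e) (g3 inp e)).
Proof. by move=> h1 h2 h3; rewrite /vidx /gridS; evt. Qed.

Lemma ev_va g1 g2 s : evaluable g1 -> evaluable g2 ->
  evaluable (fun inp e => va M T inp (g1 inp e) (g2 inp e) s).
Proof. by move=> h1 h2; apply: ev_vidx => //; evt. Qed.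

Lemma ev_vs g1 (q : 'I_(tm_q M).+1) : evaluable g1 -> evaluable (fun inp e => vs T inp (g1 inp e) q).
Proof. by move=> h1; apply: ev_vidx => //; evt. Qed.

Lemma ev_vy g1 (r : 'I_(tm_q M).+1 * sym) : evaluable g1 -> evaluable (fun inp e => vy T inp (g1 inp e) r).
Proof. by move=> h1; apply: ev_vidx => //; evt. Qed.

Lemma ev_fixed g : evaluable g -> compb (fun inp e => fixed T W inp (g inp e)).
Proof. by move=> h; rewrite /fixed; evt. Qed.

Lemma ev_fixed_sym g s : evaluable g -> compb (fun inp e => fixed_sym T inp (g inp e) s).
Proof.
move=> h; rewrite /fixed_sym.
pose b inp e := (g inp e - T inp < 2 * size inp) &&
  (odd (g inp e - T inp) ==> nth false inp (size inp - ((g inp e - T inp)./2).+1)).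
have hb : compb b by rewrite /b; evt.
have hc : compb (fun inp e => (T inp <= g inp e) && (g inp e < T inp + (2 * size inp + 2))) by evt.
pose c0 := s == None; pose c1 := s == Some true; pose c2 := s == Some false.
have ha : compb (fun inp e => (b inp e && c1) || (~~ b inp e && c2)) by evt.
have h0 : compb (fun _ _ => c0) by exact: comp_const.
have := compb_if hc ha h0.
apply: comp_ext => inp e; case: (_ && _) => //; rewrite /b /c1 /c2.
by case: (_ < 2 * _); case: (_ ==> _); case: (s) => [[]|].
Qed.

Lemma ev_guess g1 g2 : evaluable g1 -> evaluable g2 ->
  compb (fun inp e => guess T W inp (g1 inp e) (g2 inp e)).
Proof.
move=> h1 h2; rewrite /guess; apply: compb_and; first by evt.
by apply: compb_neg; apply: ev_fixed.
Qed.

Lemma ev_sh d g : evaluable g -> evaluable (fun inp e => sh d (g inp e)).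
Proof.
move=> h; case: d => //=; last by evt.
by apply: comp_ext (comp_sub h (comp_const 1)) => inp e; rewrite subn1.
Qed.

Definition mono_ok m := forall g1 g2, evaluable g1 -> evaluable g2 ->
  [/\ compb (fun inp e => mg m inp (g1 inp e) (g2 inp e)),
      evaluable (fun inp e => ma m inp (g1 inp e) (g2 inp e)) &
      evaluable (fun inp e => mb m inp (g1 inp e) (g2 inp e))].

Ltac evm := repeat first [exact: comp_const | apply: ev_va | apply: ev_vs | apply: ev_vy
  | apply: ev_fixed_sym | apply: ev_guess | apply: ev_fixed | apply: ev_sh
  | apply: compb_and | apply: compb_neg | apply: compb_eq | apply: compb_leq | progress evt].

Lemma fams_ok f m : List.In f (fams M T W) -> List.In m f -> mono_ok m.
Proof.
rewrite /fams !In_cat => -[|[|[|[|[|[|[|[|[|]]]]]]]]].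
- by case=> [<-|[<-|[]]] [<-|[<-|[]]] g1 g2 h1 h2; split; evm.
- by move=> /In_map[r [<- _]] [<-|[<-|[]]] g1 g2 h1 h2; split; evm.
- by move=> /In_map[q [<- _]] [<-|/In_map[r [<- _]]] g1 g2 h1 h2; split; evm.
- by move=> /In_map[s [<- _]] [<-|/In_cat[]/In_map[r [<- _]]] g1 g2 h1 h2; split; evm.
- by move=> /In_map[q [<- _]] [<-|[<-|[]]] g1 g2 h1 h2; split; evm.
- by move=> /In_map[s [<- _]] [<-|[<-|[]]] g1 g2 h1 h2; split; evm.
- by move=> /In_map[s [<- _]] [<-|[]] g1 g2 h1 h2; split; evm.
- by case=> [<-|[]] [<-|[<-|[<-|[<-|[]]]]] g1 g2 h1 h2; split; evm.
- by move=> /In_map[b [<- _]] [<-|[]] g1 g2 h1 h2; split; evm.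
- by case=> [<-|[]] [<-|[<-|[]]] g1 g2 h1 h2; split; evm.
Qed.

Lemma ev_N : evaluable (fun inp _ => Nv M T inp).
Proof. by rewrite /Nv /nvars /gridS; evt. Qed.

Lemma ev_quad gc gu : evaluable gc -> evaluable gu ->
  compb (fun inp e => quad M T W inp (gc inp e) (gu inp e)).
Proof.
move=> hc hu; have hN := ev_N; rewrite /quad -/(Nv M T _).
have hi : evaluable (fun inp e => gc inp e %/ nfams M T W %% Nv M T inp) by evt.
have hj : evaluable (fun inp e => gc inp e %/ nfams M T W %/ Nv M T inp) by evt.
apply: (compb_seq (b := fun k inp e => (gc inp e %% nfams M T W == k) &&
  \big[addb/false]_(m <- nth [::] (fams M T W) k)
    (mg m inp (gc inp e %/ nfams M T W %% Nv M T inp) (gc inp e %/ nfams M T W %/ Nv M T inp) &&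
    ((gu inp e %% Nv M T inp == ma m inp (gc inp e %/ nfams M T W %% Nv M T inp)
        (gc inp e %/ nfams M T W %/ Nv M T inp)) &&
     (gu inp e %/ Nv M T inp == mb m inp (gc inp e %/ nfams M T W %% Nv M T inp)
        (gc inp e %/ nfams M T W %/ Nv M T inp)))))) => k hk.
have lk : k < nfams M T W.
  have : k \in iota 0 (nfams M T W).
    by elim: (iota _ _) hk => //= x s IH [->|/IH h]; rewrite inE ?eqxx // h orbT.
  by rewrite mem_iota.
apply: compb_and; first by evt.
apply: compb_seq => m hm.
have hf : List.In (nth [::] (fams M T W) k) (fams M T W).
  by move: lk; rewrite /nfams; elim: (fams M T W) (k) => [|x s IH] [|k'] //= lt; [left|right; apply: IH].
have [h1 h2 h3] := fams_ok hf hm hi hj.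
by apply: compb_and => //; apply: compb_and; apply: compb_eq => //; evt.
Qed.

Lemma ev_H : evaluable (fun inp _ => 2 ^ Jv M T inp).
Proof.
have hN := ev_N.
have h : evaluable (fun inp e => \sum_(d < 2 * (16 * Nv M T inp)) (pow2 d && (16 * Nv M T inp <= d)) * d).
  apply: (comp_sum (G := fun inp _ d => (pow2 d && (16 * Nv M T inp <= d)) * d)); by evt.
apply: comp_ext h => inp _; rewrite -pow2_up //.
by have := N_gt0 M T inp; lia.
Qed.

Lemma ev_M : evaluable (fun inp _ => Mv M T inp).
Proof. by have hN := ev_N; have hH := ev_H; rewrite /Mv; evt. Qed.

Lemma ev_P : evaluable (fun inp _ => Pv M T t inp).
Proof. by have hN := ev_N; have hH := ev_H; have hM := ev_M; rewrite /Pv; evt. Qed.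

Lemma ev_code1 g1 g2 : evaluable g1 -> evaluable g2 ->
  compb (fun inp e => code1 (Nv M T inp) (Jv M T inp) (g1 inp e) (g2 inp e)).
Proof.
move=> h1 h2; have hH := ev_H; have hM := ev_M; rewrite /code1 -/(Mv M T _).
apply: (compb_xsum (b := fun inp e d => pow2 d && (odd ((g1 inp e %/ (Mv M T inp * Mv M T inp)) %/ d) &&
  (((g1 inp e %% Mv M T inp * g2 inp e + (g1 inp e %/ Mv M T inp) %% Mv M T inp) %% Mv M T inp) * d
     < Mv M T inp)))); by evt.
Qed.

(** The depth [s] is a constant of the reduction, so the recursion is unrolled into the program. *)
Lemma ev_codeT s g1 g2 : evaluable g1 -> evaluable g2 ->
  compb (fun inp e => codeT (Nv M T inp) (Jv M T inp) s (g1 inp e) (g2 inp e)).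
Proof.
move=> h1 h2; have hH := ev_H; have hM := ev_M.
elim: s g1 h1 => [|s IH] g1 h1; first exact: comp_const 0.
rewrite /= -/(Mv M T _); apply: compb_xor; first by apply: ev_code1 => //; evt.
by apply: (IH (fun inp e => g1 inp e %/ (Mv M T inp * (Mv M T inp * 2 ^ Jv M T inp)))); evt.
Qed.

Lemma ev_sqcode g1 g2 : evaluable g1 -> evaluable g2 ->
  compb (fun inp e => sqcode (Nv M T inp) (Pv M T t inp) (Cv M T t inp) (g1 inp e) (g2 inp e)).
Proof.
move=> h1 h2; have hN := ev_N; have hP := ev_P; rewrite /sqcode /Cv.
by apply: compb_and; apply: ev_codeT; evt.
Qed.

Lemma ev_tcode s g1 g2 : evaluable g1 -> evaluable g2 ->
  compb (fun inp e => tcode (Nv M T inp * Nv M T inp) (Pv M T t inp * Pv M T t inp)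
    (sqcode (Nv M T inp) (Pv M T t inp) (Cv M T t inp)) s (g1 inp e) (g2 inp e)).
Proof.
have hN := ev_N; have hP := ev_P.
elim: s g1 g2 => [|s IH] g1 g2 h1 h2; first exact: comp_const 1.
rewrite /=; apply: compb_and; first by apply: ev_sqcode; evt.
by apply: (IH (fun inp e => g1 inp e %/ (Pv M T t inp * Pv M T t inp))
  (fun inp e => g2 inp e %/ (Nv M T inp * Nv M T inp))); evt.
Qed.

Lemma ev_nquad : evaluable (fun inp _ => nquad M T W inp).
Proof. by have hN := ev_N; rewrite /nquad -/(Nv M T _); evt. Qed.

(** The exponent [f] varies with the row while [comp_exp] wants a fixed one. As [f < tau] with [tau]
    constant, a sum over the cases [f == l] resolves this. *)
Lemma ev_row g1 g2 : evaluable g1 -> evaluable g2 ->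
  compb (fun inp e => row (Nv M T inp * Nv M T inp) (nquad M T W inp) tau (quad M T W inp)
    (g1 inp e) (g2 inp e)).
Proof.
move=> h1 h2; have hN := ev_N; have hq := ev_nquad.
pose f inp e := g1 inp e %% tau.+1.
pose c inp e := g1 inp e %/ tau.+1 %% nquad M T W inp.
pose rho inp e := g1 inp e %/ tau.+1 %/ nquad M T W inp.
have hf : evaluable f by rewrite /f; evt.
have hc : evaluable c by rewrite /c; evt.
have hr : evaluable rho by rewrite /rho; evt.
pose b l inp e := (f inp e == l) && [&& g2 inp e %% (Nv M T inp * Nv M T inp) ^ l ==
    rho inp e %% (Nv M T inp * Nv M T inp) ^ l,
  g2 inp e %/ (Nv M T inp * Nv M T inp) ^ l.+1 == rho inp e %/ (Nv M T inp * Nv M T inp) ^ l.+1 &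
  quad M T W inp (c inp e) (g2 inp e %/ (Nv M T inp * Nv M T inp) ^ l %% (Nv M T inp * Nv M T inp))].
have hb : compb (fun inp e => \big[addb/false]_(l <- iota 0 tau) b l inp e).
  apply: compb_seq => l _; apply: compb_and; first by evt.
  apply: compb_and; first by evt.
  apply: compb_and; first by evt.
  by apply: ev_quad => //; evt.
have hd : compb (fun inp e => f inp e < tau) by evt.
have he : compb (fun inp e => g2 inp e == 0) by evt.
apply: comp_ext (compb_if hd hb he) => inp e; rewrite /row -/(f inp e) -/(c inp e) -/(rho inp e).
case: ltnP => // lt; rewrite (xsum_iota tau (fun l => b l inp e)) (bigD1 (Ordinal lt)) //=.
rewrite [X in _ (+) X]big1 ?addbF; first by rewrite /b eqxx.
by move=> l ne; rewrite /b eq_sym (_ : (l == f inp e :> nat) = false) //; apply/negbTE.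
Qed.

Lemma ev_k : evaluable (fun inp _ => kv M T t tau inp).
Proof. by have hP := ev_P; rewrite /kv /Dv; evt. Qed.

Lemma ev_wc : evaluable (fun inp _ => wcv M T a t tau inp).
Proof. by have hk := ev_k; rewrite /wcv; evt. Qed.

Lemma ev_A g1 g2 : evaluable g1 -> evaluable g2 ->
  compb (fun inp e => Av M T W a t tau inp (g1 inp e) (g2 inp e)).
Proof.
move=> h1 h2; have hP := ev_P; have hw := ev_wc; rewrite /Av /gen.
apply: compb_if; [by evt|exact: ev_tcode|apply: ev_row => //; evt].
Qed.

Lemma ev_b g1 : evaluable g1 -> compb (fun inp e => bv M T a t tau inp (g1 inp e)).
Proof. by move=> h1; have hP := ev_P; have hw := ev_wc; rewrite /bv /target; evt. Qed.

Lemma ev_n : evaluable (fun inp _ => nv M T W a t tau inp).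
Proof.
have hP := ev_P; have hw := ev_wc; have hN := ev_N; have hq := ev_nquad.
by rewrite /nv /npos /nrows; evt.
Qed.

Lemma ev_G : evaluable (fun inp _ => Gv M T tau inp).
Proof. by have hN := ev_N; rewrite /Gv; evt. Qed.

Definition enc_gate (g : gate) := enc_nat g.1 ++ enc_nat g.2.

Lemma outs_instance :
  outs (fun inp _ => enc_lsm (instance M T W a t tau inp) (kv M T t tau inp)).
Proof.
have hn := ev_n; have hG := ev_G; have hk := ev_k.
have gate_out gb g1 g2 : compb gb -> evaluable g1 -> evaluable g2 ->
    outs (fun inp e => enc_gate (ctrl (nv M T W a t tau inp) (Gv M T tau inp) (gb inp e) (g1 inp e), g2 inp e)).
  move=> hb h1 h2; rewrite /enc_gate /ctrl; apply: outs_cat; last exact: outs_enc_nat.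
  by apply: outs_enc_nat; apply: comp_if => //; evt.
have hpre : outs (fun inp _ => flatten [seq enc_gate x | x <- pre (nv M T W a t tau inp)
    (Gv M T tau inp) (Av M T W a t tau inp)]).
  have h : outs (fun inp e => flatten [seq flatten [seq enc_gate
      (ctrl (nv M T W a t tau inp) (Gv M T tau inp) (Av M T W a t tau inp p u) p, nv M T W a t tau inp + u)
      | p <- iota 0 (nv M T W a t tau inp)] | u <- iota 0 (Gv M T tau inp)]).
    apply: outs_flatten => //; apply: outs_flatten => //.
    by apply: gate_out; [apply: ev_A; evt|evt|evt].
  apply: outs_ext h => inp _; rewrite /pre; elim: (iota 0 (Gv _ _ _ _)) => //= u s ->.
  by rewrite map_cat flatten_cat -map_comp.
have hwin : outs (fun inp _ => flatten [seq enc_gate x | x <- win (nv M T W a t tau inp)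
    (Gv M T tau inp) (bv M T a t tau inp)]).
  have h : outs (fun inp e => flatten [seq enc_gate (ctrl (nv M T W a t tau inp) (Gv M T tau inp)
      (bv M T a t tau inp p) p, (nv M T W a t tau inp + Gv M T tau inp).+1)
      | p <- iota 0 (nv M T W a t tau inp)]).
    by apply: outs_flatten => //; apply: gate_out; [apply: ev_b; evt|evt|evt].
  by apply: outs_ext h => inp _; rewrite /win -map_comp.
have h : outs (fun inp e => let n := nv M T W a t tau inp in let G := Gv M T tau inp in
   enc_nat n ++ enc_nat (G + 2) ++ enc_nat (2 * (G * n + n)) ++ enc_nat (G * n).+1 ++
   enc_nat (G * n + n) ++ (flatten [seq enc_gate x | x <- pre n G (Av M T W a t tau inp)] ++
   flatten [seq enc_gate x | x <- win n G (bv M T a t tau inp)] ++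
   flatten [seq enc_gate x | x <- win n G (bv M T a t tau inp)] ++
   flatten [seq enc_gate x | x <- pre n G (Av M T W a t tau inp)]) ++ enc_nat (kv M T t tau inp)).
  by cbv zeta; repeat first [exact: hpre | exact: hwin | apply: outs_enc_nat | apply: outs_cat]; evt.
apply: outs_ext h => inp e; rewrite /enc_lsm /instance /ncp_lsm.
by cbn [lsm_n lsm_m lsm_s lsm_L lsm_R lsm_gates]; rewrite !map_cat !flatten_cat addn2.
Qed.
End Eval.

(** * The reduction from an arbitrary NP language *)

Lemma halted_iter (M : TM) (c : config M) n m : n <= m -> halted (iter n (@tm_step M) c) ->
  iter m (@tm_step M) c = iter n (@tm_step M) c.
Proof.
move=> le h; rewrite -(subnK le); elim: (m - n) => //= d ->.
by move: h; rewrite /halted /tm_step; case: (tm_delta _ _).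
Qed.

Theorem theorem5p4 : forall alpha : R, Rle R1 alpha -> NP_hard_to_approx_LSM alpha.
Proof.
move=> alpha _ L [V [[M [c1 [k1 hM]]] [c2 [k2 hL]]]].
have [a ha] : exists a, Rle alpha (INR a).
  have [h _] := archimed alpha.
  exists (Z.to_nat (up alpha)); rewrite INR_IZR_INZ.
  apply: Rle_trans (Rlt_le _ _ h) _; apply: IZR_le; lia.
have [t ht] := expS_gt 12 31; have [tau htau] := expS_gt (2 * a).+1 4.
pose W (inp : seq bool) := c2 * size inp ^ k2 + c2.
pose B (inp : seq bool) := 2 * size inp + 2 + W inp.
(* [B] bounds the length of the encoded pair, the other summand the running time of the verifier on
   it. One horizon serves all witnesses, because a halted machine stays put. *)
pose T inp := B inp + (c1 * B inp ^ k1 + c1).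
have hW : evaluable (fun inp _ => W inp) by rewrite /W; evt.
have hT : evaluable (fun inp _ => T inp) by rewrite /T /B; evt.
have WT inp : 2 * size inp + 2 + W inp <= T inp by rewrite leq_addr.
have acc x : L x <-> accepts M T W (rev x).
  rewrite hL /accepts revK /W size_rev -/(W x).
  have key w : size w <= W x ->
    (cf_head (iter (T (rev x)) (@tm_step M) (init_config M (enc_pair x w))) = Some true <->
     V (enc_pair x w)).
    move=> sw; have [s [les [hs ho]]] := hM (enc_pair x w).
    have le : s <= T (rev x).
      apply: leq_trans les _; rewrite /T; apply: leq_trans (leq_addl _ _).
      rewrite leq_add2r leq_mul //; apply: leq_expW.
      by rewrite /enc_pair size_cat size_enc_bits /B /W size_rev leq_add2l.
    rewrite (halted_iter le hs); move: ho; rewrite /tm_output.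
    by case: (cf_head _) => [b|] //= [<- _]; split=> [[]|->].
  by split=> -[w]; [case=> sw hv|move=> sw hv]; exists w; first [done|split=> //|idtac]; apply/key.
exists (fun x => enc_lsm (instance M T W a t tau (rev x)) (kv M T t tau (rev x))); split.
  exact: outs_poly_time (outs_instance M a t tau hT hW).
move=> x; exists (instance M T W a t tau (rev x)), (kv M T t tau (rev x)); split=> //.
split; first exact: instance_valid.
split=> [/acc hx w|hx w]; first exact: instance_yes.
move=> /(instance_no (WT _) ht htau (fun h => hx (proj2 (acc x) h))) lt.
apply: Rle_lt_trans (_ : Rle _ (INR (a * kv M T t tau (rev x)))) _.
  by rewrite (mult_INR a); apply: Rmult_le_compat_r ha; apply: pos_INR.
by apply: lt_INR; apply/ltP.
Qed.
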